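(* Suppose $F$ is continuous in neighborhoods of $v\pm\xi$ and differentiable at $v$ and at $v\pm\xi$, with $F'(v)>0$ and $G'(\xi)=F'(v-\xi)+F'(v+\xi)>0$. Then, as $n\to\infty$, $$\begin{pmatrix}\sqrt n(\mathrm{Med}_n^*-v)\\ \sqrt n(\mathrm{MAD}_n^*-\xi)\end{pmatrix}\overset{d}{\longrightarrow}N\left(\begin{pmatrix}0\\0\end{pmatrix},\Sigma\right),$$ where $\Sigma=(\sigma_{ij})_{2\times2}$ with $$\sigma_{11}=\frac{1}{2F'(v)^2},\qquad \sigma_{12}=\sigma_{21}=\frac{1}{2F'(v)G'(\xi)}\left(1-4F(v-\xi)+\frac{\beta}{F'(v)}\right),\qquad \sigma_{22}=\frac{1}{2G'(\xi)^2}\left(1+\frac{\gamma}{F'(v)^2}\right),$$ and $\alpha=F(v-\xi)+F(v+\xi)$, $\beta=F'(v-\xi)-F'(v+\xi)$, $\gamma=\beta^2+4(1-\alpha)\beta F'(v)$.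
   Context: $X_1,X_2,\ldots$ are i.i.d. real random variables with distribution function $F$. The median is $v=F^{-1}(1/2)=\inf\{x:F(x)\ge 1/2\}$. $G(y)=P(|X_1-v|\le y)=F(v+y)-F((v-y)-)$ is the distribution function of $|X_1-v|$, and $\xi=G^{-1}(1/2)$ is its median. $F_n$ is the empirical distribution function of $X_1,\ldots,X_n$. For each $n$, the bootstrap sample $X_1^*,\ldots,X_n^*$ (of size $n$) is, conditionally on $X_1,\ldots,X_n$, i.i.d. with distribution function $F_n$. Convergence in distribution is with respect to the joint (unconditional) probability. $\lfloor\cdot\rfloor$ is the floor function, and $Y_{1:n}\le\cdots\le Y_{n:n}$ denote order statistics. The bootstrap median is $\mathrm{Med}_n^*=\frac12\left(X^*_{\lfloor (n+1)/2\rfloor:n}+X^*_{\lfloor (n+2)/2\rfloor:n}\right)$. With $\widetilde W_i^*=|X_i^*-\mathrm{Med}_n^*|$, $1\le i\le n$, the bootstrap median absolute deviation is $\mathrm{MAD}_n^*=\frac12\left(\widetilde W^*_{\lfloor (n+1)/2\rfloor:n}+\widetilde W^*_{\lfloor (n+2)/2\rfloor:n}\right)$. *)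

(* Defs.v *)
From HB Require Import structures.
From mathcomp Require Import all_boot all_order all_algebra.
From mathcomp Require Import all_classical all_reals all_analysis.

Set Implicit Arguments.
Unset Strict Implicit.
Unset Printing Implicit Defensive.

Import Order.TTheory GRing.Theory Num.Theory.
Import numFieldNormedType.Exports.

Local Open Scope classical_set_scope.
Local Open Scope ring_scope.

Section quantiles.
Context {R : realType}.

Definition quantile (F : R -> R) (p : R) : R := inf [set x | p <= F x].

(* The order statistic Y_{k:n}, with k numbered from 1. *)
Definition order_stat (n : nat) (Y : 'I_n -> R) (k : nat) : R :=
  nth 0 (sort <=%R [seq Y i | i : 'I_n]) k.-1.

Definition sample_median (n : nat) (Y : 'I_n -> R) : R :=
  2^-1 * (order_stat Y ((n + 1) %/ 2)%N + order_stat Y ((n + 2) %/ 2)%N).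

Definition sample_mad (n : nat) (Y : 'I_n -> R) : R :=
  sample_median (fun i => `|Y i - sample_median Y|).

Definition empirical_cdf (n : nat) (Y : 'I_n -> R) (x : R) : R :=
  n%:R^-1 * \sum_(i < n) (Y i <= x)%R%:R.

End quantiles.

Section probability_notions.
Context d (T : measurableType d) {R : realType} (P : probability T R).

Definition mutually_independent (X : nat -> T -> R) : Prop :=
  forall (J : seq nat) (A : nat -> set R), uniq J ->
    (forall j, measurable (A j)) ->
    P (\bigcap_(j in [set` J]) (X j @^-1` A j)) =
    (\big[*%E/1%E]_(j <- J) P (X j @^-1` A j))%E.

Definition iid_with_cdf (X : nat -> {RV P >-> R}) (F : R -> R) : Prop :=
  mutually_independent (fun i => X i) /\
  forall i x, cdf (X i) x = (F x)%:E.

(* V is a version of the conditional probability P(A | G), where G is a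
   sub-sigma-algebra given as a set of events. *)
Definition cond_prob_version (G : set (set T)) (A : set T) (V : T -> R) :
    Prop :=
  [/\ forall B : set R, measurable B -> G (V @^-1` B),
      P.-integrable setT (EFin \o V) &
      forall B, G B -> (\int[P]_(w in B) (V w)%:E)%E = P (A `&` B)].

(* Conditional independence given G of a finite family; taking some of the A i
   to be setT gives the product rule for the subfamilies. *)
Definition cond_independent (G : set (set T)) (n : nat) (Y : 'I_n -> T -> R) :
    Prop :=
  forall (A : 'I_n -> set R) (V : 'I_n -> T -> R),
    (forall i, measurable (A i)) ->
    (forall i, cond_prob_version G (Y i @^-1` A i) (V i)) ->
    cond_prob_version G (\bigcap_(i in setT) (Y i @^-1` A i))
      (fun w => \prod_(i < n) V i w).

Definition cond_iid_with_cdf (G : set (set T)) (n : nat)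
    (Y : 'I_n -> T -> R) (H : T -> R -> R) : Prop :=
  cond_independent G Y /\
  forall i x, cond_prob_version G (Y i @^-1` `]-oo, x]) (fun w => H w x).

(* Xs n is, for each n, a bootstrap sample of size n from X 0, ..., X n.-1.
   Nothing is assumed about the joint law of Xs n and Xs m for n != m. *)
Definition bootstrap_samples (X : nat -> {RV P >-> R})
    (Xs : forall n, 'I_n -> {RV P >-> R}) : Prop :=
  forall n, cond_iid_with_cdf
    (g_sigma_preimage (fun i : 'I_n => X i : T -> R))
    (fun i => Xs n i : T -> R)
    (fun w => empirical_cdf (fun i : 'I_n => X i w)).

Definition joint_cdf (mu : set (R * R) -> \bar R) (z : R * R) : \bar R :=
  mu [set x | x.1 <= z.1 /\ x.2 <= z.2].

(* Convergence in distribution in R^2: pointwise convergence of the joint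
   distribution functions at the continuity points of the limit. *)
Definition cvg_in_distribution (Z : nat -> T -> R * R)
    (mu : probability (R * R)%type R) : Prop :=
  (forall n, measurable_fun setT (Z n)) /\
  forall z : R * R, {for z, continuous (joint_cdf mu)} ->
    (fun n => joint_cdf (pushforward P (Z n)) z) @ \oo --> joint_cdf mu z.

End probability_notions.

Section bivariate_normal.
Context {R : realType}.

Definition affine2 (m : R * R) (A : 'M[R]_2) (z : R * R) : R * R :=
  (m.1 + A 0 0 * z.1 + A 0 1 * z.2, m.2 + A 1 0 * z.1 + A 1 1 * z.2).

(* mu = N(m, S): the law of m + A z, where z is a pair of independent standard
   normal variables and A A^T = S. Any A with A A^T = S gives the same law. *)
Definition is_bivariate_normal (mu : set (R * R) -> \bar R) (m : R * R)
    (S : 'M[R]_2) : Prop :=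
  exists A : 'M[R]_2, A *m A^T = S /\
    forall B : set (R * R), measurable B ->
      mu B = (normal_prob 0 1 \x normal_prob 0 1)%E (affine2 m A @^-1` B).

Definition mx2 (a b c e : R) : 'M[R]_2 :=
  \matrix_(i < 2, j < 2)
    if i == 0 then (if j == 0 then a else b) else (if j == 0 then c else e).

End bivariate_normal.

(* Main.v *)
Require Import Defs.
From HB Require Import structures.
From mathcomp Require Import all_boot all_order all_algebra.
From mathcomp Require Import all_classical all_reals all_analysis.
From mathcomp Require Import measurable_realfun.
From mathcomp Require Import ring lra zify.

Import Order.TTheory GRing.Theory Num.Theory.
Import numFieldNormedType.Exports.

Local Open Scope classical_set_scope.
Local Open Scope ring_scope.

Set Implicit Arguments.
Unset Strict Implicit.
Unset Printing Implicit Defensive.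

(** Let H be the empirical distribution function of the bootstrap sample, r = 1 / sqrt n, f = F'(v),
fm = F'(v - xi), fp = F'(v + xi), and let M1 = (Med - v) / r and M2 = (MAD - xi) / r be the rescaled
estimators.

Linearization. By a Chebyshev bound for both levels of sampling ([bootstrap_chebyshev]), an increment
of H over an interval of length of order r is its F-increment up to o(r) in probability, so
differentiability of F at x gives H (x + s r) - H x = s r F'(x) + o(r) ([increment_rem_negligible]).
Comparing Med with v + s r amounts to comparing H (v + s r) with 1/2, hence M1 is close to
Z1 = - (H v - 1/2) / (r f). Comparing MAD with xi + t r amounts to comparing with 1/2 the mass which H
gives to the interval of radius xi + t r around Med; expanding at v - xi and v + xi, M2 is close to
Z2 = (- (H (v + xi) - H (v - xi) - 1/2) / r + (fm - fp) Z1) / (fm + fp). Closeness is needed only in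
the form: for each s and each e > 0, the probability that s separates M and Z by more than e tends
to 0 ([separated_median_negligible], [separated_mad_negligible]). For M2 the random centre Med is
first confined to a cell of a finite grid, so that H is only ever evaluated at finitely many
deterministic points. This form suffices to squeeze the joint distribution function of (M1, M2)
between those of (Z1, Z2).

Central limit theorem. Z1 and Z2 are r times sums, over the bootstrap sample, of functions of the
colour of an observation, namely the one of the four intervals cut out by v - xi, v and v + xi in
which it lies. The joint law of the colours of the two samples is explicit ([bootstrap_colour_law]):
n colours e are drawn independently from the law of the colour of X_0, and then n colours
independently from the frequencies in e. This reduces everything to finite sums. Lindeberg's
replacement of the summands by Gaussian ones, one at a time, is applied twice ([bootstrap_clt]).
Given e, the bootstrap sum is centred at the sum over e and its covariance is that of the frequencies
in e, close to the population covariance; averaging over e, the sum over e is itself asymptotically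
normal with the same covariance. The two independent normal contributions add up to twice the
covariance of a single colour score, which is Sigma. Smooth functions squeezing the indicator of a
quadrant ([smooth_quadrant]) turn this into bounds on distribution functions ([approx_event_le],
[approx_event_ge]), which meet at the continuity points of the limit ([cvg_probability_squeeze]). *)

(** * Convolution and moments of centred normal laws *)

Section normal_integral.
Context {R : realType}.
Local Notation mu := (@lebesgue_measure R).

(** The normal law is defined through its density; this is the change of measure for nonnegative
integrands, the signed case being [integral_normal_prob]. *)
Lemma ge0_integral_normal_prob (m s : R) (f : R -> \bar R) :
  (forall x, 0 <= f x)%E -> measurable_fun setT f ->
  (\int[normal_prob m s]_x f x = \int[mu]_x (f x * (normal_pdf m s x)%:E))%E.
Proof.
move=> f0 mf.
have dom := normal_prob_dominates m s.
rewrite -(Radon_Nikodym_SigmaFinite.change_of_variables dom f0)//.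
have iRN := Radon_Nikodym_SigmaFinite.f_integrable dom.
apply: ae_eq_integral => //.
- by apply: emeasurable_funM => //; exact: measurable_int iRN.
- by apply: emeasurable_funM => //; apply/measurable_EFinP; exact: measurable_normal_pdf.
- apply: ae_eqe_mul2l; apply: integral_ae_eq => //.
  + by apply/measurable_EFinP; exact: measurable_normal_pdf.
  + by move=> E _ mE; rewrite -Radon_Nikodym_SigmaFinite.f_integral.
Qed.

Lemma ge0_integral_shift (f : R -> R) (a : R) :
  continuous f -> (forall x, 0 <= f x) ->
  (\int[mu]_x (f x)%:E = \int[mu]_x (f (x + a))%:E)%E.
Proof.
move=> cf f0.
have dF (x : R) : is_derive x (1 : R) (fun y : R => y + a) (1 : R).
  by apply: is_derive_eq; rewrite addr0.
have F'E : derive1 (fun y : R => y + a) = cst (1 : R).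
  by apply/funext => x; rewrite derive1E; apply: derive_val.
rewrite (@increasing_ge0_integration_by_substitutionT _ (fun y => y + a))//.
- by apply: eq_integral => x _; rewrite F'E/= mulr1.
- by move=> x y; rewrite ltrD2r.
- by rewrite F'E => x; exact: cvg_cst.
- by rewrite F'E; exact: is_cvg_cst.
- by rewrite F'E; exact: is_cvg_cst.
- exact: cvg_addrr_Ny.
- exact: cvg_addrr.
Qed.

(** Completing the square in y: as a function of y, the joint density of (Y, X = Y + Z) is the density
of X times the conditional density of Y given X, which is again normal. *)
Lemma normal_pdf_mul (s t x y : R) : 0 < s -> 0 < t ->
  let u := Num.sqrt (s ^+ 2 + t ^+ 2) in
  normal_pdf 0 t (x - y) * normal_pdf 0 s y =
  normal_pdf 0 u x * normal_pdf (x * (s / u) ^+ 2) (s * t / u) y.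
Proof.
move=> s0 t0 u.
have u0 : 0 < u by rewrite sqrtr_gt0 addr_gt0// exprn_gt0.
have u2 : u ^+ 2 = s ^+ 2 + t ^+ 2 by rewrite sqr_sqrtr// addr_ge0// sqr_ge0.
have [s1 t1 u1] : [/\ s != 0, t != 0 & u != 0] by rewrite !gt_eqF.
rewrite !normal_pdfE//; last by rewrite !mulf_neq0// invr_neq0.
rewrite /normal_peak /normal_fun mulrACA [RHS]mulrACA -!expRD; congr (_ * expR _).
  rewrite -!invfM; congr (_^-1).
  have pos (r : R) : 0 <= r ^+ 2 * pi *+ 2.
    by rewrite mulrn_wge0// mulr_ge0 ?sqr_ge0 ?pi_ge0.
  rewrite -[LHS]sqrtrM// -[RHS]sqrtrM//; congr Num.sqrt.
  by field.
rewrite !subr0 !mulNr -!opprD; congr (- _).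
have [S0 T0 U0] : [/\ s ^+ 2 != 0, t ^+ 2 != 0 & s ^+ 2 + t ^+ 2 != 0].
  by rewrite -u2 !expf_neq0.
rewrite !mulr2n !expr_div_n !exprMn u2.
move: (s ^+ 2) (t ^+ 2) S0 T0 U0 => S T' S0 T0 U0; field.
by rewrite -!mulr2n !mulrn_eq0 mulf_eq0 !negb_or S0 T0 U0.
Qed.

(** By [normal_pdf_mul] the inner variable integrates out to 1. *)
Lemma ge0_normal_convolution (s t : R) (f : R -> R) : 0 < s -> 0 < t ->
  continuous f -> (forall x, 0 <= f x) ->
  (\int[normal_prob 0%R s]_y \int[normal_prob 0%R t]_z (f (y + z)%R)%:E =
   \int[normal_prob 0%R (Num.sqrt (s ^+ 2 + t ^+ 2)%R)]_x (f x)%:E)%E.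
Proof.
move=> s0 t0 cf f0; set u := Num.sqrt _.
have mf := continuous_measurable_fun cf.
have mfD : measurable_fun setT (fun p : R * R => (f (p.1 + p.2))%:E).
  by apply/measurable_EFinP/measurableT_comp => //; exact: measurable_funD.
rewrite ge0_integral_normal_prob; first last.
- by apply: (@measurable_fun_fubini_tonelli_F _ _ _ _ _ (normal_prob 0 t)
    (fun p : R * R => (f (p.1 + p.2)%R)%:E)) => // p; rewrite lee_fin.
- by move=> y; apply: integral_ge0 => z _; rewrite lee_fin.
transitivity (\int[mu]_y \int[mu]_x
   (f x * (normal_pdf 0 t (x - y)%R * normal_pdf 0 s y)%R)%:E)%E.
  apply: eq_integral => y _.
  rewrite ge0_integral_normal_prob; first last.
  - apply/measurable_EFinP/measurableT_comp => //.
    exact: measurable_funD.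
  - by move=> x; rewrite lee_fin.
  rewrite -ge0_integralZr//; first last.
  - by rewrite lee_fin normal_pdf_ge0.
  - by move=> x _; rewrite mule_ge0// lee_fin ?normal_pdf_ge0.
  - apply: emeasurable_funM; apply/measurable_EFinP.
      by apply: measurableT_comp => //; exact: measurable_funD.
    exact: measurable_normal_pdf.
  have cpdf : continuous (normal_pdf 0 t).
    by apply: continuous_normal_pdf; rewrite gt_eqF.
  rewrite [in RHS](@ge0_integral_shift _ y); first last.
  - by move=> x; rewrite !mulr_ge0 ?normal_pdf_ge0.
  - move=> x; apply: cvgM; first exact: cf.
    apply: cvgM; last exact: cvg_cst.
    apply: (@cvg_comp _ _ _ (fun x => x - y) (normal_pdf 0 t)); last exact: cpdf.
    by apply: cvgB; [exact: cvg_id|exact: cvg_cst].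
  by apply: eq_integral => x _; rewrite addrK [in RHS]mulrA addrC !EFinM.
pose g p := (f p.2 * (normal_pdf 0 t (p.2 - p.1) * normal_pdf 0 s p.1))%:E.
transitivity (\int[mu]_x \int[mu]_y g (y, x))%E.
  apply: (fubini_tonelli (m1 := mu) (m2 := mu) g).
    apply/measurable_EFinP/measurable_funM; first exact: measurableT_comp.
    apply/measurable_funM.
      apply: measurableT_comp; first exact: measurable_normal_pdf.
      exact: measurable_funB.
    by apply: measurableT_comp => //; exact: measurable_normal_pdf.
  by move=> p; rewrite lee_fin !mulr_ge0 ?normal_pdf_ge0.
rewrite /g/=.
rewrite [RHS]ge0_integral_normal_prob; first last.
- exact/measurable_EFinP.
- by move=> x; rewrite lee_fin.
apply: eq_integral => x _.
under eq_integral do rewrite normal_pdf_mul// mulrA EFinM.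
rewrite ge0_integralZl//; first last.
- by rewrite lee_fin mulr_ge0 ?normal_pdf_ge0.
- by move=> y _; rewrite lee_fin normal_pdf_ge0.
- by apply/measurable_EFinP; exact: measurable_normal_pdf.
by rewrite integral_normal_pdf mule1 EFinM.
Qed.

End normal_integral.

Lemma Rintegral_probability_cst d (T : measurableType d) (R : realType)
  (P : probability T R) (c : R) : \int[P]_x c = c.
Proof.
rewrite Rintegral_cst//; transitivity (c * fine 1%E); last by rewrite mulr1.
by congr (c * fine _); exact: probability_setT.
Qed.

Section normal_moments.
Context {R : realType}.
Local Notation mu := (@lebesgue_measure R).

Lemma integral_normal_prob (m s : R) (f : R -> \bar R) :
  (normal_prob m s).-integrable setT f ->
  (\int[normal_prob m s]_x f x = \int[mu]_x (f x * (normal_pdf m s x)%:E))%E.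
Proof.
move=> /integrableP[mf fi].
have ge0 (g : R -> \bar R) : (forall x, 0 <= g x)%E -> measurable_fun setT g ->
    (\int[normal_prob m s]_x g x = \int[mu]_x (g x * (normal_pdf m s x)%:E))%E.
  exact: ge0_integral_normal_prob.
rewrite integralE [RHS]integralE; congr (_ - _)%E; rewrite ge0//.
- apply: eq_integral => x _.
  by rewrite !funeposE -!(muleC (normal_pdf m s x)%:E) maxe_pMr ?mule0// ?lee_fin normal_pdf_ge0.
- exact: measurable_funepos.
- apply: eq_integral => x _.
  by rewrite !funenegE -!(muleC (normal_pdf m s x)%:E) -muleN maxe_pMr ?mule0// ?lee_fin normal_pdf_ge0.
- exact: measurable_funeneg.
Qed.

(** The moment identities below are instances: each centred integrand is a derivative of a polynomial
multiple of the density, which vanishes at infinity. *)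
Lemma integral_derive_eq0 (f F : R -> R) :
  continuous f -> mu.-integrable setT (EFin \o f) ->
  (forall x : R, is_derive x (1 : R) F (f x)) ->
  (fun n : nat => F n.+1%:R - F (- n.+1%:R)) @ \oo --> (0 : R) ->
  (\int[mu]_x (f x)%:E = 0)%E.
Proof.
move=> cf intf dF F0.
pose I (n : nat) : set R := `[- n.+1%:R, n.+1%:R]%classic.
have mI n : measurable (I n) by exact: measurable_itv.
have cF : continuous F by move=> x; exact/differentiable_continuous/derivable1_diffP.
have h1 : (\int[mu]_x ((EFin \o f) \_ (I n)) x @[n --> \oo] --> \int[mu]_x (f x)%:E)%E.
  apply: (@dominated_cvg _ _ _ mu setT measurableT (fun n => (EFin \o f) \_ (I n))
     (EFin \o f) (fun x => `|f x|%:E)) => //.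
  - move=> n; apply/(measurable_restrictT _ _).1; first exact: mI.
    by apply: measurable_funTS; apply/measurable_EFinP; exact: continuous_measurable_fun.
  - move=> x _; apply: cvg_near_cst; exists (Num.truncn `|x|) => // n /= hn.
    rewrite patchE mem_set// /I/= in_itv/= -ler_norml ltW//.
    by rewrite (lt_le_trans (truncnS_gt _))// ler_nat.
  - exact: integrable_norm.
  - move=> n x _; rewrite patchE; case: ifPn => //= _.
    by rewrite lee_fin normr0.
have h2 : (\int[mu]_x ((EFin \o f) \_ (I n)) x @[n --> \oo] --> 0%E)%E.
  rewrite (_ : (fun n => _) = fun n => (F n.+1%:R - F (- n.+1%:R))%:E); last first.
    apply/funext => n; rewrite -integral_mkcond (@continuous_FTC2 _ f F) //.
    - by rewrite (lt_trans (y := 0)) ?oppr_lt0.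
    - exact: continuous_subspaceT.
    - split.
      + by move=> x _.
      + by apply: cvg_at_right_filter; exact: cF.
      + by apply: cvg_at_left_filter; exact: cF.
    - by move=> x _; rewrite derive1E; apply: derive_val.
  by apply: cvg_EFin => //; near=> n.
exact: cvg_unique h1 h2.
Unshelve. all: by end_near. Qed.

Lemma is_derive_normal_pdf (s z : R) : s != 0 ->
  is_derive z (1 : R) (normal_pdf 0 s) (- (z / s ^+ 2) * normal_pdf 0 s z).
Proof.
move=> s0; rewrite normal_pdfE// /normal_fun.
have -> : (fun x => normal_peak s * expR (- (x - 0) ^+ 2 / (s ^+ 2 *+ 2))) =
   normal_peak s *: (expR \o ((- (s ^+ 2 *+ 2)^-1) *: (fun x : R => x ^+ 2))).
  apply/funext => x; rewrite subr0 mulNr (mulrC (x ^+ 2)) -mulNr.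
  by [].
apply: is_derive_eq.
rewrite -mulr_natr subr0.
have -> : (- (s ^+ 2 * 2)^-1 *: (fun x : R => x ^+ 2)) z = - z ^+ 2 / (s ^+ 2 * 2).
  by rewrite mulNr (mulrC (z ^+ 2)) -mulNr.
set e := expR _; set p := normal_peak s.
transitivity (p * (e * (- (s ^+ 2 * 2)^-1 * (z * 1 + z * 1)))) => //.
by field.
Qed.

(** With u = z ^ 2 / (8 s ^ 2), this is u ^ 2 <= exp (2 u): the density of variance 2 s ^ 2 exceeds
that of variance s ^ 2 by a factor exp (2 u), up to normalization. It gives integrability of the
powers up to 4 and a bound on the fourth moment without computing it. *)
Lemma pow4_normal_pdf_le (s z : R) : 0 < s ->
  z ^+ 4 * normal_pdf 0 s z <=
  64 * Num.sqrt 2 * s ^+ 4 * normal_pdf 0 (Num.sqrt 2 * s) z.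
Proof.
move=> s0; have s1 : s != 0 by rewrite gt_eqF.
have r0 : 0 < Num.sqrt (2 : R) by rewrite sqrtr_gt0.
have r2 : Num.sqrt (2 : R) ^+ 2 = 2 by rewrite sqr_sqrtr.
have r1 : Num.sqrt (2 : R) != 0 by rewrite gt_eqF.
rewrite !normal_pdfE ?mulf_neq0// /normal_peak /normal_fun !subr0 exprMn r2.
have -> : Num.sqrt (2 * s ^+ 2 * pi *+ 2) = Num.sqrt 2 * Num.sqrt (s ^+ 2 * pi *+ 2).
  by rewrite -sqrtrM//; congr Num.sqrt; ring.
set p := Num.sqrt (_ *+ 2).
have p0 : 0 < p by rewrite sqrtr_gt0 mulrn_wgt0// mulr_gt0 ?exprn_gt0// pi_gt0.
set u := z ^+ 2 / (8 * s ^+ 2).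
have u0 : 0 <= u by rewrite mulr_ge0 ?sqr_ge0// invr_ge0 mulr_ge0 ?sqr_ge0.
have -> : - z ^+ 2 / (s ^+ 2 *+ 2) = - (4 * u).
  by rewrite /u -mulr_natr; field.
have -> : - z ^+ 2 / (2 * s ^+ 2 *+ 2) = - (4 * u) + (u + u).
  by rewrite /u -mulr_natr; field.
rewrite expRD expRD [X in _ <= X](_ : _ =
   p^-1 * expR (- (4 * u)) * (64 * s ^+ 4 * (expR u * expR u))); last first.
  by field; rewrite r1 gt_eqF.
rewrite mulrC; apply: ler_wpM2l; first by rewrite mulr_ge0 ?expR_ge0// invr_ge0 ltW.
have -> : z ^+ 4 = 64 * s ^+ 4 * (u * u) by rewrite /u; field.
apply: ler_wpM2l; first by rewrite mulr_ge0// exprn_ge0// ltW.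
(* the fourth power is 64 s ^ 4 u ^ 2, and u <= exp u is used for each of the two factors *)
have ue : u <= expR u by apply: le_trans (expR_ge1Dx _); rewrite lerDr.
by apply: ler_pM.
Qed.

Lemma ge0_integral_normal_pow4 (s : R) : 0 < s ->
  (\int[normal_prob 0%R s]_z (z ^+ 4)%:E <= (64 * Num.sqrt 2 * s ^+ 4)%:E)%E.
Proof.
move=> s0; rewrite ge0_integral_normal_prob; first last.
- by apply/measurable_EFinP; exact: measurable_funX.
- by move=> z; rewrite lee_fin exprn_even_ge0.
apply: (@le_trans _ _ (\int[mu]_z
    ((64 * Num.sqrt 2 * s ^+ 4)%:E * (normal_pdf 0 (Num.sqrt 2 * s) z)%:E)))%E.
  apply: ge0_le_integral => //.
  - by move=> z _; rewrite mule_ge0 ?lee_fin ?exprn_even_ge0 ?normal_pdf_ge0.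
  - apply: emeasurable_funM; apply/measurable_EFinP; first exact: measurable_funX.
    exact: measurable_normal_pdf.
  - apply: emeasurable_funM; apply/measurable_EFinP => //.
    exact: measurable_normal_pdf.
  - by move=> z _; rewrite -!EFinM lee_fin pow4_normal_pdf_le.
rewrite ge0_integralZl//.
- by rewrite integral_normal_pdf mule1.
- by apply/measurable_EFinP; exact: measurable_normal_pdf.
- by move=> z _; rewrite lee_fin normal_pdf_ge0.
- by rewrite lee_fin mulr_ge0 ?exprn_ge0 ?(ltW s0)// mulr_ge0.
Qed.

Lemma integrable_normal_pow4 (s : R) : 0 < s ->
  (normal_prob 0 s).-integrable setT (fun z : R => (z ^+ 4)%:E).
Proof.
move=> s0; apply/integrableP; split.
  by apply/measurable_EFinP; exact: measurable_funX.
apply: le_lt_trans (ltry (64 * Num.sqrt 2 * s ^+ 4)).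
apply: le_trans (ge0_integral_normal_pow4 s0).
rewrite le_eqVlt; apply/orP; left; apply/eqP; apply: eq_integral => z _.
by rewrite gee0_abs// lee_fin exprn_even_ge0.
Qed.

Lemma integrable_normal_pow (s : R) k : 0 < s -> (k <= 4)%N ->
  (normal_prob 0 s).-integrable setT (fun z : R => (z ^+ k)%:E).
Proof.
move=> s0 k4; apply: (@le_integrable _ _ _ (normal_prob 0 s) _ measurableT
    (fun z : R => (z ^+ k)%:E) (fun z : R => (1 + z ^+ 4)%:E)).
- by apply/measurable_EFinP; exact: measurable_funX.
- move=> z _; rewrite !abse_EFin lee_fin.
  have z4 : 0 <= z ^+ 4 by rewrite exprn_even_ge0.
  rewrite [leRHS]ger0_norm ?addr_ge0// normrX.
  have [z1|/ltW z1] := leP `|z| 1.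
    by rewrite (le_trans (exprn_ile1 k (normr_ge0 z) z1))// lerDl.
  rewrite (le_trans (ler_weXn2l z1 k4))// -normrX ger0_norm// lerDr//.
- apply: (@eq_integrable _ _ _ (normal_prob 0 s) _ measurableT (cst 1%E \+ (fun z : R => (z ^+ 4)%:E))%E) => //.
  apply: integrableD => //; last exact: integrable_normal_pow4.
  exact: finite_measure_integrable_cst.
Qed.

Lemma integrable_mul_normal_pdf (s : R) (f : R -> R) :
  (normal_prob 0 s).-integrable setT (EFin \o f) ->
  mu.-integrable setT (EFin \o (fun z => f z * normal_pdf 0 s z)).
Proof.
move=> /integrableP[mf fi].
have mf' : measurable_fun setT f by apply/measurable_EFinP.
apply/integrableP; split.
  by apply/measurable_EFinP/measurable_funM => //; exact: measurable_normal_pdf.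
rewrite ge0_integral_normal_prob// in fi; last exact: measurableT_comp.
rewrite (le_lt_trans _ fi)// le_eqVlt; apply/orP; left; apply/eqP.
by apply: eq_integral => z _; rewrite /= normrM EFinM (ger0_norm (normal_pdf_ge0 _ _ _)).
Qed.

(** The bound of [pow4_normal_pdf_le] makes z ^ 4 times the density bounded, hence z times it tends to 0. *)
Lemma cvg_normal_pdf_tail (s : R) : 0 < s ->
  (fun n : nat => n.+1%:R * normal_pdf 0 s n.+1%:R) @ \oo --> (0 : R).
Proof.
move=> s0; pose c := 64 * Num.sqrt 2 * s ^+ 4 * normal_peak (Num.sqrt 2 * s).
have r1 : Num.sqrt 2 * s != 0 by rewrite mulf_neq0 ?gt_eqF// sqrtr_gt0.
have c0 : 0 <= c.
  rewrite mulr_ge0 ?normal_peak_ge0//.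
  by rewrite mulr_ge0 ?exprn_ge0 ?(ltW s0)// mulr_ge0.
apply: (@squeeze_cvgr _ _ _ _ (cst 0) (fun n : nat => c * n.+1%:R^-1)).
- apply: nearW => n; rewrite mulr_ge0 ?normal_pdf_ge0//=.
  rewrite ler_pdivlMr ?ltr0n// mulrAC.
  rewrite (@le_trans _ _ (n.+1%:R ^+ 4 * normal_pdf 0 s n.+1%:R))//.
    rewrite ler_wpM2r ?normal_pdf_ge0// -expr2.
    by rewrite ler_weXn2l// ler1n.
  rewrite (le_trans (pow4_normal_pdf_le _ s0))// /c ler_wpM2l ?normal_pdf_ub//.
  by rewrite mulr_ge0 ?exprn_ge0 ?(ltW s0)// mulr_ge0.
- exact: cvg_cst.
- rewrite -[X in _ --> X](mulr0 c); apply: cvgM; first exact: cvg_cst.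
  exact: cvg_harmonic.
Qed.

Lemma normal_pdfN (s z : R) : s != 0 -> normal_pdf 0 s (- z) = normal_pdf 0 s z.
Proof. by move=> s0; rewrite !normal_pdfE// /normal_fun !subr0 sqrrN. Qed.

(** z times the density is the derivative of - s ^ 2 times the density. *)
Lemma normal_mean (s : R) : 0 < s -> \int[normal_prob 0 s]_z z = 0.
Proof.
move=> s0; have s1 : s != 0 by rewrite gt_eqF.
have i1 := integrable_normal_pow s0 (isT : (1 <= 4)%N).
rewrite /Rintegral integral_normal_prob//.
rewrite [X in fine X](_ : _ = 0%E)//.
apply: (@integral_derive_eq0 (fun z => z * normal_pdf 0 s z)
  (fun z => - s ^+ 2 * normal_pdf 0 s z)).
- by move=> z; apply: cvgM; [exact: cvg_id|exact: continuous_normal_pdf].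
- exact: integrable_mul_normal_pdf.
- move=> z; have dz := is_derive_normal_pdf z s1.
  rewrite (_ : z * _ = - s ^+ 2 * (- (z / s ^+ 2) * normal_pdf 0 s z)).
    exact: (is_deriveZ (- s ^+ 2) dz).
  by field.
- under eq_fun do rewrite normal_pdfN// subrr.
  exact: cvg_cst.
Qed.

(** (z ^ 2 - s ^ 2) times the density is the derivative of - s ^ 2 z times the density. *)
Lemma normal_second_moment (s : R) : 0 < s ->
  \int[normal_prob 0 s]_z (z ^+ 2) = s ^+ 2.
Proof.
move=> s0; have s1 : s != 0 by rewrite gt_eqF.
have i2 := integrable_normal_pow s0 (isT : (2 <= 4)%N).
have ic : (normal_prob 0 s).-integrable setT (EFin \o cst (s ^+ 2)).
  exact: finite_measure_integrable_cst.
have i3 : (normal_prob 0 s).-integrable setT (fun z : R => (z ^+ 2 - s ^+ 2)%:E).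
  exact: (integrableB measurableT i2 ic).
apply/eqP; rewrite -subr_eq0; apply/eqP.
transitivity (\int[normal_prob 0 s]_z (z ^+ 2 - s ^+ 2)).
  by rewrite RintegralB// Rintegral_probability_cst.
rewrite /Rintegral integral_normal_prob//.
rewrite [X in fine X](_ : _ = 0%E)//.
apply: (@integral_derive_eq0 (fun z => (z ^+ 2 - s ^+ 2) * normal_pdf 0 s z)
  (fun z => - s ^+ 2 * (z * normal_pdf 0 s z))).
- move=> z; apply: cvgM; last exact: continuous_normal_pdf.
  by apply: cvgB; [exact: exprn_continuous|exact: cvg_cst].
- exact: integrable_mul_normal_pdf.
- move=> z; have dz := is_derive_normal_pdf z s1.
  rewrite (_ : _ * normal_pdf 0 s z = - s ^+ 2 *
    (z * (- (z / s ^+ 2) * normal_pdf 0 s z) + normal_pdf 0 s z * 1)).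
    exact: (is_deriveZ (- s ^+ 2) (is_deriveM (is_derive_id z (1 : R)) dz)).
  by field.
- rewrite (_ : (fun n : nat => _) =
      fun n : nat => (- s ^+ 2 *+ 2) * (n.+1%:R * normal_pdf 0 s n.+1%:R)).
    rewrite -[X in _ --> X](mulr0 (- s ^+ 2 *+ 2)).
    by apply: cvgM; [exact: cvg_cst|exact: cvg_normal_pdf_tail].
  apply/funext => n; rewrite normal_pdfN//; move: (n.+1%:R) => m.
  by move: (normal_pdf 0 s m) => p; ring.
Qed.

(** |z| ^ 3 <= s z ^ 2 + z ^ 4 / s reduces the third absolute moment to the second and the fourth; only
its order s ^ 3 matters for the remainder terms. *)
Lemma normal_third_moment (s : R) : 0 < s ->
  (normal_prob 0 s).-integrable setT (fun z : R => (`|z| ^+ 3)%:E) /\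
  \int[normal_prob 0 s]_z (`|z| ^+ 3) <= (64 * Num.sqrt 2 + 1) * s ^+ 3.
Proof.
move=> s0; have s1 : s != 0 by rewrite gt_eqF.
have i3 : (normal_prob 0 s).-integrable setT (fun z : R => (`|z| ^+ 3)%:E).
  apply: (@eq_integrable _ _ _ (normal_prob 0 s) _ measurableT (fun z : R => `|z ^+ 3|%:E)) => //.
    by move=> z _; rewrite normrX.
  exact: (integrable_norm (integrable_normal_pow s0 _)).
have i2 := integrable_normal_pow s0 (isT : (2 <= 4)%N).
have i4 := integrable_normal_pow s0 (isT : (4 <= 4)%N).
split=> //.
have i24 : (normal_prob 0 s).-integrable setT (fun z : R => (s * z ^+ 2 + s^-1 * z ^+ 4)%:E).
  apply: (@eq_integrable _ _ _ (normal_prob 0 s) _ measurableT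
    ((fun z : R => s%:E * (z ^+ 2)%:E) \+ (fun z : R => s^-1%:E * (z ^+ 4)%:E))%E) => //.
  by apply: integrableD => //; exact: integrableZl.
apply: (@le_trans _ _ (\int[normal_prob 0 s]_z (s * z ^+ 2 + s^-1 * z ^+ 4))).
  apply: le_Rintegral => // z _.
  have z2 : z ^+ 2 = `|z| ^+ 2 by rewrite real_normK// num_real.
  have -> : z ^+ 4 = `|z| ^+ 4 by rewrite (exprM z 2 2) z2 -exprM.
  rewrite z2; move: (normr_ge0 z); move: (`|z|) => a a0.
  rewrite -subr_ge0.
  have -> : s * a ^+ 2 + s^-1 * a ^+ 4 - a ^+ 3 =
      s^-1 * (a ^+ 2 * ((s - a) ^+ 2 + s * a)) by field.
  rewrite mulr_ge0 ?invr_ge0 ?(ltW s0)// mulr_ge0 ?sqr_ge0//.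
  by rewrite addr_ge0 ?sqr_ge0// mulr_ge0// ltW.
rewrite RintegralD//; first last.
- exact: (integrableZl measurableT s^-1 i4).
- exact: (integrableZl measurableT s i2).
rewrite !RintegralZl// normal_second_moment// [leRHS]mulrDl mul1r addrC -exprS lerD2r.
rewrite ler_pdivrMl//.
have -> : s * (64 * Num.sqrt 2 * s ^+ 3) = 64 * Num.sqrt 2 * s ^+ 4 by ring.
have := ge0_integral_normal_pow4 s0.
by rewrite -(fineK (integrable_fin_num measurableT i4)) lee_fin.
Qed.

End normal_moments.

(** * Bounded integrals over probability spaces *)

Section probability_Rintegral.
Context d (T : measurableType d) (R : realType) (P : probability T R).
Implicit Types f g : T -> R.

Lemma integrable_bounded f (K : R) : measurable_fun setT f ->
  (forall x, `|f x| <= K) -> P.-integrable setT (EFin \o f).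
Proof.
move=> mf fK; apply: measurable_bounded_integrable => //.
- by rewrite -ge0_fin_numE// fin_num_measure.
- exists K; split; first exact: num_real.
  by move=> M KM x _; exact: le_trans (fK x) (ltW KM).
Qed.

Lemma integrable_addr f g : P.-integrable setT (EFin \o f) ->
  P.-integrable setT (EFin \o g) -> P.-integrable setT (EFin \o (fun x => f x + g x)).
Proof. by move=> fi gi; exact: (integrableD measurableT fi gi). Qed.

Lemma integrable_subr f g : P.-integrable setT (EFin \o f) ->
  P.-integrable setT (EFin \o g) -> P.-integrable setT (EFin \o (fun x => f x - g x)).
Proof. by move=> fi gi; exact: (integrableB measurableT fi gi). Qed.

Lemma integrable_mull f (c : R) : P.-integrable setT (EFin \o f) ->
  P.-integrable setT (EFin \o (fun x => c * f x)).
Proof. by move=> fi; exact: (integrableZl measurableT c fi). Qed.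

Lemma integrable_constr (c : R) : P.-integrable setT (EFin \o (fun=> c)).
Proof. exact: finite_measure_integrable_cst. Qed.

Lemma Rintegral_addr f g : P.-integrable setT (EFin \o f) ->
  P.-integrable setT (EFin \o g) -> \int[P]_x (f x + g x) = \int[P]_x f x + \int[P]_x g x.
Proof. exact: RintegralD. Qed.

Lemma Rintegral_subr f g : P.-integrable setT (EFin \o f) ->
  P.-integrable setT (EFin \o g) -> \int[P]_x (f x - g x) = \int[P]_x f x - \int[P]_x g x.
Proof. exact: RintegralB. Qed.

Lemma Rintegral_mull f (c : R) : P.-integrable setT (EFin \o f) ->
  \int[P]_x (c * f x) = c * \int[P]_x f x.
Proof. exact: RintegralZl. Qed.

Lemma normr_Rintegral_le f g : P.-integrable setT (EFin \o f) ->
  P.-integrable setT (EFin \o g) -> (forall x, `|f x| <= g x) ->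
  `|\int[P]_x f x| <= \int[P]_x g x.
Proof.
move=> fi gi fg; rewrite (le_trans (le_normr_Rintegral _ fi))//.
by apply: le_Rintegral => //; exact: integrable_norm.
Qed.

Lemma normr_Rintegral_le_cst f (K : R) : P.-integrable setT (EFin \o f) ->
  (forall x, `|f x| <= K) -> `|\int[P]_x f x| <= K.
Proof.
move=> fi fK; rewrite -[leRHS](Rintegral_probability_cst P).
by apply: normr_Rintegral_le => //; exact: integrable_constr.
Qed.

End probability_Rintegral.

(** Boundedness replaces all integrability conditions, and the real-valued integrals keep the later
algebra free of extended reals. *)
Lemma Rfubini d1 d2 (T1 : measurableType d1) (T2 : measurableType d2) (R : realType)
  (P : probability T1 R) (Q : probability T2 R) (f : T1 * T2 -> R) (K : R) :
  measurable_fun setT f -> (forall p, `|f p| <= K) ->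
  \int[P]_x \int[Q]_y f (x, y) = \int[Q]_y \int[P]_x f (x, y) /\
  \int[P]_x \int[Q]_y f (x, y) = fine (\int[P \x Q]_p (f p)%:E)%E.
Proof.
move=> mf fK.
have fi : (P \x Q)%E.-integrable setT (EFin \o f).
  apply: measurable_bounded_integrable => //.
    rewrite (_ : [set: _] = [set: T1] `*` [set: T2]); last by rewrite setXTT.
    have := product_measure1E P Q (@measurableT _ T1) (@measurableT _ T2).
    by move=> /= ->; rewrite !probability_setT mule1 ltry.
  by exists K; split=> [|M KM x _]; [exact: num_real|exact: le_trans (fK x) (ltW KM)].
have iQ x : (\int[Q]_y (f (x, y))%:E = (\int[Q]_y f (x, y))%R%:E)%E.
  rewrite fineK//; apply: integrable_fin_num => //.
  by apply: (@integrable_bounded _ _ _ _ _ K) => //; exact: measurableT_comp.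
have iP y : (\int[P]_x (f (x, y))%:E = (\int[P]_x f (x, y))%R%:E)%E.
  rewrite fineK//; apply: integrable_fin_num => //.
  by apply: (@integrable_bounded _ _ _ _ _ K) => //; exact: measurableT_comp.
rewrite /Rintegral; split.
  congr fine; under eq_integral do rewrite -iQ.
  under [RHS]eq_integral do rewrite -iP.
  exact: (Fubini fi).
congr fine; under eq_integral do rewrite -iQ.
exact: (integral12_prod_meas1 fi).
Qed.

(** * Gaussian averages of bounded Lipschitz functions of two variables *)

Section averaging.
Context {R : realType}.
Implicit Types (f : R -> R -> R) (b c : R * R) (K s t : R).

(** Bounded Lipschitz functions: a class stable under averaging, and measurable on the plane, so that
iterated integrals can be exchanged. *)
Definition blip K f :=
  (forall x y, `|f x y| <= K) /\
  forall x y x' y', `|f x y - f x' y'| <= K * (`|x - x'| + `|y - y'|).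

Lemma lipschitz_continuous (h : R -> R) (L : R) :
  (forall z w, `|h z - h w| <= L * `|z - w|) -> continuous h.
Proof.
move=> hL z; have L0 : 0 <= L by have := hL 1 0; rewrite subr0 normr1 mulr1; apply: le_trans.
have L1 : 0 < L + 1 by rewrite ltr_wpDl.
apply/cvgrPdist_le => e e0; near=> w.
rewrite (le_trans (hL _ _))//.
rewrite (@le_trans _ _ ((L + 1) * `|z - w|))// ?ler_wpM2r ?lerDl//.
rewrite -ler_pdivlMl// mulrC.
near: w; exists (e / (L + 1)) => [|w /= /ltW//]; rewrite /= divr_gt0//.
Unshelve. all: by end_near. Qed.

Lemma blip_ge0 K f : blip K f -> 0 <= K.
Proof. by case=> fK _; apply: le_trans (fK 0 0). Qed.

(** Joint measurability: f p < a exactly when f (q, p.2) + K |p.1 - q| < a for some rational q, which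
expresses the sublevel set as a countable union of measurable sets. *)
Lemma blip_measurable K f : blip K f ->
  measurable_fun setT (fun p : R * R => f p.1 p.2).
Proof.
move=> fK; have K0 := blip_ge0 fK; case: fK => fK fL.
apply: (measurability _ (RGenInftyO.measurableE R)) => _ [_ [a ->] <-].
rewrite setTI (_ : _ @^-1` _ = \bigcup_(q in [set: rat])
    [set p : R * R | f (ratr q) p.2 + K * `|p.1 - ratr q| < a]); last first.
  apply/seteqP; split=> [p/=|p [q _ /=]]; rewrite in_itv/=; last first.
    apply: le_lt_trans; rewrite -lerBlDl (le_trans (ler_norm _))//.
    by rewrite (le_trans (fL _ _ _ _))// subrr normr0 addr0.
  move=> fa; pose e := (a - f p.1 p.2) / (2 * K + 1).
  have e0 : 0 < e by rewrite divr_gt0 ?subr_gt0// ltr_wpDl// mulr_ge0.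
  have [q] := @rat_in_itvoo R (p.1 - e) (p.1 + e) ltac:(by rewrite ltrD2l gtrN).
  rewrite in_itv/= => /andP[q1 q2]; exists q => //=.
  have pq : `|p.1 - ratr q| < e by rewrite ltr_norml; apply/andP; split; lra.
  have := fL (ratr q) p.2 p.1 p.2; rewrite subrr normr0 addr0 distrC => h.
  have : f (ratr q) p.2 <= f p.1 p.2 + K * `|ratr q - p.1|.
    by rewrite -lerBlDl (le_trans (ler_norm _))// distrC.
  rewrite (distrC (ratr q)) => h'.
  have : K * `|p.1 - ratr q| <= K * e by rewrite ler_wpM2l// ltW.
  have -> : a = f p.1 p.2 + 2 * (K * e) + e by rewrite /e; field; rewrite gt_eqF// ltr_wpDl// mulr_ge0.
  lra.
apply: bigcupT_measurable_rat => q.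
rewrite (_ : [set p : R * R | _] = setT `&`
    (fun p : R * R => f (ratr q) p.2 + K * `|p.1 - ratr q|) @^-1` `]-oo, a[%classic).
  apply: (_ : measurable_fun setT _) => //; apply: measurable_funD.
    apply: (measurableT_comp (f := f (ratr q))) => //.
    apply: continuous_measurable_fun; apply: (@lipschitz_continuous _ K) => z w.
    by have := fL (ratr q) z (ratr q) w; rewrite subrr normr0 add0r.
  apply: measurable_funM => //; apply: measurableT_comp => //; exact: measurable_funB.
by rewrite setTI; apply/seteqP; split=> p /=; rewrite in_itv.
Qed.

End averaging.

Section gaussian_averaging.
Context {R : realType}.
Implicit Types (f : R -> R -> R) (b c : R * R) (K s t : R).

(** The expectation of f at (x, y) displaced by a centred normal variable of standard deviation s along
the direction b. *)
Definition gavg s b f (x y : R) : R :=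
  \int[normal_prob 0 s]_z f (x + b.1 * z) (y + b.2 * z).

Lemma blip_line K f b x y : blip K f ->
  forall z w, `|f (x + b.1 * z) (y + b.2 * z) - f (x + b.1 * w) (y + b.2 * w)| <=
    K * (`|b.1| + `|b.2|) * `|z - w|.
Proof.
move=> [_ fL] z w; rewrite (le_trans (fL _ _ _ _))// -mulrA mulrDl -!normrM.
have h (u v : R) : u + v * z - (u + v * w) = v * (z - w) by ring.
by rewrite !h.
Qed.

Lemma continuous_blip_line K f b x y : blip K f ->
  continuous (fun z : R => f (x + b.1 * z) (y + b.2 * z)).
Proof. by move=> fK; apply: lipschitz_continuous; exact: (blip_line b x y fK). Qed.

Lemma integrable_gavg K s f b x y : blip K f ->
  (normal_prob 0 s).-integrable setT
    (EFin \o (fun z => f (x + b.1 * z) (y + b.2 * z))).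
Proof.
move=> fK; apply: (@integrable_bounded _ _ _ _ _ K); last by move=> z; exact: fK.1.
by apply: continuous_measurable_fun; exact: continuous_blip_line fK.
Qed.

Lemma blip_gavg K s b f : blip K f -> blip K (gavg s b f).
Proof.
move=> fK; split=> [x y|x y x' y'].
  by apply: normr_Rintegral_le_cst; [exact: integrable_gavg fK|move=> z; exact: fK.1].
rewrite /gavg -Rintegral_subr; [|exact: integrable_gavg fK..].
apply: normr_Rintegral_le_cst; first by apply: integrable_subr; exact: integrable_gavg fK.
move=> z; rewrite (le_trans (fK.2 _ _ _ _))//.
have h (u v w : R) : u + w - (v + w) = u - v by ring.
by rewrite !h.
Qed.

Lemma gavgC K s t b c f : blip K f ->
  gavg s b (gavg t c f) = gavg t c (gavg s b f).
Proof.
move=> fK; apply/funext => x; apply/funext => y; rewrite /gavg.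
pose F (p : R * R) := f (x + b.1 * p.1 + c.1 * p.2) (y + b.2 * p.1 + c.2 * p.2).
have mF : measurable_fun setT F.
  have h (u v w : R) : measurable_fun setT (fun p : R * R => w + u * p.1 + v * p.2).
    apply: measurable_funD; last exact: measurable_funM.
    by apply: measurable_funD => //; exact: measurable_funM.
  apply: (measurableT_comp (blip_measurable fK)
    (g := fun p : R * R => (x + b.1 * p.1 + c.1 * p.2, y + b.2 * p.1 + c.2 * p.2))).
  by apply/measurable_fun_pairP; split; exact: h.
have FK p : `|F p| <= K by exact: fK.1.
have [e _] := @Rfubini _ _ _ _ R (normal_prob 0 s) (normal_prob 0 t) F K mF FK.
rewrite /F/= in e; rewrite e; apply: eq_Rintegral => z _; apply: eq_Rintegral => w _.
by rewrite -!addrA (addrC (c.1 * z)) (addrC (c.2 * z)).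
Qed.

(** The semigroup law, from the convolution of normal laws. *)
Lemma gavgD K s t b f : 0 < s -> 0 < t -> blip K f ->
  gavg s b (gavg t b f) = gavg (Num.sqrt (s ^+ 2 + t ^+ 2)) b f.
Proof.
move=> s0 t0 fK; apply/funext => x; apply/funext => y; rewrite /gavg.
(* adding the bound K makes the integrand nonnegative, as the convolution formula requires *)
pose h z := f (x + b.1 * z) (y + b.2 * z) + K.
have K0 := blip_ge0 fK.
have ch : continuous h.
  by move=> z; apply: cvgD; [exact: (continuous_blip_line fK)|exact: cvg_cst].
have h0 z : 0 <= h z by have := fK.1 (x + b.1 * z) (y + b.2 * z); rewrite /h ler_norml; lra.
have ih u : (normal_prob 0 u).-integrable setT (EFin \o h).
  by apply: integrable_addr; [exact: integrable_gavg fK|exact: integrable_constr].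
have hE u : \int[normal_prob 0 u]_z h z =
    \int[normal_prob 0 u]_z f (x + b.1 * z) (y + b.2 * z) + K.
  rewrite /h Rintegral_addr ?Rintegral_probability_cst//; last exact: integrable_constr.
  exact: integrable_gavg fK.
apply: (addIr K).
transitivity (fine (\int[normal_prob 0%R s]_z \int[normal_prob 0%R t]_w (h (z + w)%R)%:E)%E);
  last by rewrite ge0_normal_convolution//; exact: hE.
have it z : (normal_prob 0 t).-integrable setT
    (EFin \o (fun w => f (x + b.1 * (z + w)) (y + b.2 * (z + w)))).
  have := integrable_gavg t b (x + b.1 * z) (y + b.2 * z) fK.
  by apply: eq_integrable => // w _ /=; rewrite !mulrDr !addrA.
have iz z : (\int[normal_prob 0%R t]_w (h (z + w)%R)%:E =
    (gavg t b f (x + b.1 * z) (y + b.2 * z) + K)%:E)%E.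
  transitivity ((\int[normal_prob 0 t]_w h (z + w))%:E).
    rewrite fineK//; apply: integrable_fin_num => //.
    exact: (integrable_addr (it z) (integrable_constr _ K)).
  congr EFin; rewrite /h Rintegral_addr//; last exact: integrable_constr.
  rewrite Rintegral_probability_cst; congr (_ + _); apply: eq_Rintegral => w _.
  by rewrite !mulrDr !addrA.
transitivity (\int[normal_prob 0 s]_z (gavg t b f (x + b.1 * z) (y + b.2 * z) + K)).
  rewrite Rintegral_addr ?Rintegral_probability_cst//; last exact: integrable_constr.
  exact: integrable_gavg (blip_gavg t b fK).
by congr fine; apply: eq_integral => z _; rewrite iz.
Qed.

End gaussian_averaging.

(** * Sampling from a finite law, and resampling from the sample *)

Section iid_expectation.
Context {R : realType} {C : finType}.
Implicit Types (q p g : C -> R) (G H : seq C -> R) (n : nat).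

Definition prob_vector q := (forall c, 0 <= q c) /\ \sum_c q c = 1.

(** The expectation of G (c_1, ..., c_n) for independent colours of law q. The recursion on n is the
form in which replacement, one summand at a time, is carried out; [iid_Ex_tuple] is the closed form. *)
Fixpoint iid_Ex q n G : R :=
  if n is m.+1 then \sum_c q c * iid_Ex q m (fun s => G (c :: s)) else G [::].

Lemma iid_Ex_le q n G H : prob_vector q ->
  (forall s, size s = n -> G s <= H s) -> iid_Ex q n G <= iid_Ex q n H.
Proof.
move=> [q0 q1]; elim: n G H => [|n IH] G H GH /=; first exact: GH.
by apply: ler_sum => c _; apply: ler_wpM2l => //; apply: IH => s sn; apply: GH; rewrite /= sn.
Qed.

Lemma eq_Ex q n G H : (forall s, size s = n -> G s = H s) -> iid_Ex q n G = iid_Ex q n H.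
Proof.
elim: n G H => [|n IH] G H GH /=; first exact: GH.
by apply: eq_bigr => c _; congr (_ * _); apply: IH => s sn; apply: GH; rewrite /= sn.
Qed.

Lemma iid_ExD q n G H : iid_Ex q n (fun s => G s + H s) = iid_Ex q n G + iid_Ex q n H.
Proof.
elim: n G H => [|n IH] G H //=; rewrite -big_split/=.
by apply: eq_bigr => c _; rewrite IH mulrDr.
Qed.

Lemma iid_ExZ q n G (a : R) : iid_Ex q n (fun s => a * G s) = a * iid_Ex q n G.
Proof.
elim: n G => [|n IH] G //=; rewrite mulr_sumr.
by apply: eq_bigr => c _; rewrite IH mulrCA.
Qed.

Lemma iid_Ex_cst q n (a : R) : prob_vector q -> iid_Ex q n (fun=> a) = a.
Proof.
move=> [q0 q1]; elim: n => [|n IH] //=.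
by under eq_bigr do rewrite IH; rewrite -mulr_suml q1 mul1r.
Qed.

Lemma iid_ExB q n G H : iid_Ex q n (fun s => G s - H s) = iid_Ex q n G - iid_Ex q n H.
Proof.
rewrite -(mulN1r (iid_Ex q n H)) -iid_ExZ -iid_ExD; apply: eq_Ex => s _.
by rewrite mulN1r.
Qed.

Lemma normr_Ex_le q n G H : prob_vector q ->
  (forall s, size s = n -> `|G s| <= H s) -> `|iid_Ex q n G| <= iid_Ex q n H.
Proof.
move=> qp GH; rewrite ler_norml; apply/andP; split.
  rewrite -mulN1r -iid_ExZ; apply: iid_Ex_le => // s sn.
  by have := GH s sn; rewrite ler_norml mulN1r => /andP[].
by apply: iid_Ex_le => // s sn; have := GH s sn; rewrite ler_norml => /andP[].
Qed.

Lemma iid_Ex_sum q n g : prob_vector q ->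
  iid_Ex q n (fun s => \sum_(c <- s) g c) = n%:R * \sum_c q c * g c.
Proof.
move=> qp; elim: n => [|n IH] /=; first by rewrite big_nil mul0r.
under eq_bigr => c _.
  under (@eq_Ex _ _ _ _) => s _ do rewrite big_cons.
  rewrite iid_ExD iid_Ex_cst// IH; over.
under eq_bigr do rewrite mulrDr.
by rewrite big_split/= -mulr_suml qp.2 mul1r -natr1 mulrDl mul1r addrC.
Qed.

(** The offset a makes the induction go through. *)
Lemma iid_Ex_sqr_sum q n g (a : R) : prob_vector q -> \sum_c q c * g c = 0 ->
  iid_Ex q n (fun s => (a + \sum_(c <- s) g c) ^+ 2) =
  a ^+ 2 + n%:R * \sum_c q c * g c ^+ 2.
Proof.
move=> qp qg; elim: n a => [|n IH] a /=; first by rewrite big_nil addr0 mul0r addr0.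
under eq_bigr => c _.
  under (@eq_Ex _ _ _ _) => s _ do rewrite big_cons addrA.
  rewrite IH sqrrD; over.
rewrite (eq_bigr (fun c => q c * a ^+ 2 + (2 * a) * (q c * g c) + q c * g c ^+ 2 +
    q c * (n%:R * \sum_c q c * g c ^+ 2))); last first.
  by move=> c _; rewrite -mulr_natr; ring.
rewrite !big_split/= -!mulr_suml -mulr_sumr qp.2 qg mulr0 addr0 !mul1r -natr1 mulrDl mul1r.
by rewrite -addrA; congr (_ + _); rewrite addrC.
Qed.

Definition freq n (e : seq C) (c : C) : R := (count_mem c e)%:R / n%:R.

Lemma sum_freq n e g : \sum_c freq n e c * g c = (\sum_(c <- e) g c) / n%:R.
Proof.
rewrite mulr_suml; under eq_bigr do rewrite mulrAC.
rewrite -!mulr_suml; congr (_ / _).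
elim: e => [|c e IH] /=; first by rewrite big_nil big1// => c _; rewrite mul0r.
rewrite big_cons -IH; under eq_bigr do rewrite natrD mulrDl.
rewrite big_split/=; congr (_ + _).
rewrite (bigD1 c)//= eqxx mul1r big1 ?addr0// => c' c'c.
by rewrite eq_sym (negbTE c'c) mul0r.
Qed.

Lemma prob_vector_freq n e : (0 < n)%N -> size e = n -> prob_vector (freq n e).
Proof.
move=> n0 en; split=> [c|]; first by rewrite divr_ge0.
under eq_bigr do rewrite -[freq _ _ _]mulr1.
rewrite sum_freq big_const_seq count_predT en -Monoid.iteropE.
by rewrite -[iterop _ _ _ _]/(1 *+ n) divff// pnatr_eq0 -lt0n.
Qed.

Lemma big_tuple_cons n (F : n.+1.-tuple C -> R) :
  \sum_(w : n.+1.-tuple C) F w = \sum_c \sum_(w : n.-tuple C) F [tuple of c :: w].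
Proof.
rewrite pair_big/= (reindex (fun p : C * n.-tuple C => [tuple of p.1 :: p.2]))//=.
exists (fun w => (thead w, [tuple of behead w])) => [[c w] _|w _] /=.
  by congr pair; apply: val_inj.
by rewrite -tuple_eta.
Qed.

Lemma iid_Ex_tuple q n G :
  iid_Ex q n G = \sum_(w : n.-tuple C) (\prod_(c <- w) q c) * G w.
Proof.
elim: n G => [|n IH] G /=.
  rewrite (bigD1 [tuple])//= big_nil mul1r big1 ?addr0// => w.
  by move=> /eqP[]; exact: tuple0.
rewrite big_tuple_cons; apply: eq_bigr => c _; rewrite IH mulr_sumr.
by apply: eq_bigr => w _; rewrite big_cons mulrA.
Qed.

(** The expectation of G over a bootstrap sample: e is the sample drawn from p, and the bootstrap sample
is drawn from the frequencies in e. *)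
Definition boot_Ex p n G : R := iid_Ex p n (fun e => iid_Ex (freq n e) n G).

(** A first-moment bound from the second moment without Cauchy-Schwarz: b <= r + b ^ 2 / r. *)
Lemma normr_Ex_mean_le p n g (M r : R) : (0 < n)%N -> prob_vector p ->
  \sum_c p c * g c = 0 -> (forall c, g c ^+ 2 <= M) -> r ^+ 2 = n%:R^-1 -> 0 < r ->
  iid_Ex p n (fun e => `|(\sum_(c <- e) g c) / n%:R|) <= (1 + M) * r.
Proof.
move=> n0 pp pg gM r2 r0.
have nn : (n%:R : R) != 0 by rewrite pnatr_eq0 -lt0n.
apply: (@le_trans _ _ (iid_Ex p n (fun e => r + (r^-1 * n%:R^-1 ^+ 2) * (0 + \sum_(c <- e) g c) ^+ 2))).
  apply: iid_Ex_le => // e _; rewrite add0r; set a := \sum_(c <- e) g c.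
  have -> : r^-1 * n%:R^-1 ^+ 2 * a ^+ 2 = r^-1 * `|a / n%:R| ^+ 2.
    by rewrite real_normK ?num_real//; field; rewrite nn gt_eqF.
  move: (`|_|) (normr_ge0 (a / n%:R)) => b b0.
  rewrite -subr_ge0.
  have -> : r + r^-1 * b ^+ 2 - b = r^-1 * ((r - b) ^+ 2 + r * b) by field; rewrite gt_eqF.
  by rewrite mulr_ge0 ?invr_ge0 ?addr_ge0 ?sqr_ge0 ?mulr_ge0// ltW.
rewrite iid_ExD iid_Ex_cst// iid_ExZ iid_Ex_sqr_sum// expr0n add0r mulrDl mul1r lerD2l.
have -> : r^-1 * n%:R^-1 ^+ 2 * (n%:R * \sum_c p c * g c ^+ 2) =
    (\sum_c p c * g c ^+ 2) * r.
  rewrite -r2; have -> : n%:R = (r ^+ 2)^-1 by rewrite r2 invrK.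
  by field; rewrite gt_eqF.
apply: ler_wpM2r; first exact: ltW.
rewrite -[leRHS]mul1r -pp.2 mulr_suml; apply: ler_sum => c _.
by apply: ler_wpM2l; [exact: pp.1|exact: gM].
Qed.

(** Conditionally on the sample e, the bootstrap sum has mean the sum over e and variance at most the
sum of the squares over e; the factor 2 collects the two levels of sampling. *)
Lemma boot_Ex_sqr_sum_le p n g : (0 < n)%N -> prob_vector p -> \sum_c p c * g c = 0 ->
  boot_Ex p n (fun s => (\sum_(c <- s) g c) ^+ 2) <= 2 * n%:R * \sum_c p c * g c ^+ 2.
Proof.
move=> n0 pp pg; rewrite /boot_Ex.
have nn : (n%:R : R) != 0 by rewrite pnatr_eq0 -lt0n.
apply: (@le_trans _ _ (iid_Ex p n (fun e => (0 + \sum_(c <- e) g c) ^+ 2 +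
    \sum_(c <- e) g c ^+ 2))); last first.
  rewrite iid_ExD iid_Ex_sqr_sum// iid_Ex_sum// expr0n add0r le_eqVlt; apply/orP; left.
  by apply/eqP; ring.
apply: iid_Ex_le => // e en.
have qe := prob_vector_freq n0 en.
pose m := (\sum_(c <- e) g c) / n%:R.
have mE : \sum_c freq n e c * (g c - m) = 0.
  under eq_bigr do rewrite mulrBr.
  by rewrite big_split/= sumrN -mulr_suml qe.2 mul1r sum_freq subrr.
have -> : iid_Ex (freq n e) n (fun s => (\sum_(c <- s) g c) ^+ 2) =
    iid_Ex (freq n e) n (fun s => (n%:R * m + \sum_(c <- s) (g c - m)) ^+ 2).
  apply: eq_Ex => s sn; congr (_ ^+ 2).
  by rewrite big_split/= sumrN big_const_seq count_predT sn iter_addr_0 mulr_natl addrCA subrr addr0.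
rewrite iid_Ex_sqr_sum//; have -> : n%:R * m = 0 + \sum_(c <- e) g c by rewrite add0r /m mulrC divfK.
rewrite lerD2l.
have -> : \sum_(c <- e) g c ^+ 2 = n%:R * \sum_c freq n e c * g c ^+ 2.
  by rewrite sum_freq mulrC divfK.
rewrite ler_wpM2l// -subr_ge0.
rewrite (_ : _ - _ = m ^+ 2) ?sqr_ge0//.
rewrite -sumrB.
rewrite (eq_bigr (fun c => 2 * m * (freq n e c * (g c - m)) + m ^+ 2 * freq n e c)); last first.
  by move=> c _; ring.
by rewrite big_split/= -!mulr_sumr mE qe.2 mulr0 add0r mulr1.
Qed.

End iid_expectation.

(** * Taylor expansions under Gaussian averaging *)

Ltac integrable_lin := do ?[ apply: integrable_subr | apply: integrable_addr
  | apply: integrable_mull | apply: integrable_constr ].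

Section smooth_functions.
Context {R : realType}.
Implicit Types (f g D : R -> R -> R) (b c : R * R) (K s t : R).

(** D1, D2, D11, D12 and D22 are the partial derivatives of f up to order two. They enter only through
the Taylor expansion, so no derivative of f is ever taken. *)
Record taylor2 K f D1 D2 D11 D12 D22 : Prop := Taylor2 {
  taylor2_f : blip K f;
  taylor2_D1 : blip K D1; taylor2_D2 : blip K D2;
  taylor2_D11 : blip K D11; taylor2_D12 : blip K D12; taylor2_D22 : blip K D22;
  taylor2_rem : forall x y h k, `|f (x + h) (y + k) - (f x y + (h * D1 x y + k * D2 x y) +
    (h ^+ 2 / 2 * D11 x y + h * k * D12 x y + k ^+ 2 / 2 * D22 x y))| <=
    K * (`|h| + `|k|) ^+ 3 }.

(** The expansion is preserved because averaging is linear and commutes with displacements. *)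
Lemma taylor2_gavg K s b f D1 D2 D11 D12 D22 : taylor2 K f D1 D2 D11 D12 D22 ->
  taylor2 K (gavg s b f) (gavg s b D1) (gavg s b D2)
    (gavg s b D11) (gavg s b D12) (gavg s b D22).
Proof.
case=> f0 f1 f2 f11 f12 f22 rem; split; try exact: blip_gavg.
move=> x y h k; rewrite /gavg.
have i g : blip K g -> (normal_prob 0 s).-integrable setT
    (EFin \o (fun z => g (x + b.1 * z) (y + b.2 * z))) by exact: integrable_gavg.
have ih : (normal_prob 0 s).-integrable setT
    (EFin \o (fun z => f (x + h + b.1 * z) (y + k + b.2 * z))) by exact: integrable_gavg f0.
rewrite -(Rintegral_mull h (i _ f1)) -(Rintegral_mull k (i _ f2)).
rewrite -(Rintegral_mull (h ^+ 2 / 2) (i _ f11)) -(Rintegral_mull (h * k) (i _ f12)).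
rewrite -(Rintegral_mull (k ^+ 2 / 2) (i _ f22)).
have iM a g : blip K g -> (normal_prob 0 s).-integrable setT
    (EFin \o (fun z => a * g (x + b.1 * z) (y + b.2 * z))).
  by move=> /i; exact: integrable_mull.
rewrite -!Rintegral_addr; integrable_lin; try by [exact: ih|exact: i|exact: iM].
rewrite -Rintegral_subr; integrable_lin; try by [exact: ih|exact: i|exact: iM].
apply: normr_Rintegral_le_cst.
  by integrable_lin; try by [exact: ih|exact: i|exact: iM].
by move=> z; rewrite [x + h + _]addrAC [y + k + _]addrAC; exact: rem.
Qed.

(** The Hessian form in the direction b. *)
Definition quad b D11 D12 D22 (x y : R) : R :=
  b.1 ^+ 2 * D11 x y + 2 * (b.1 * b.2) * D12 x y + b.2 ^+ 2 * D22 x y.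

Let C3 : R := 64 * Num.sqrt 2 + 1.

(** The linear term has mean 0 and the quadratic one mean s ^ 2; the third absolute moment bounds the
remainder. *)
Lemma gavg_taylor K s b f D1 D2 D11 D12 D22 x y : 0 < s ->
  taylor2 K f D1 D2 D11 D12 D22 ->
  `|gavg s b f x y - f x y - s ^+ 2 / 2 * quad b D11 D12 D22 x y| <=
    K * (`|b.1| + `|b.2|) ^+ 3 * (C3 * s ^+ 3).
Proof.
move=> s0 T; have [f0 _ _ _ _ _ rem] := T.
have K0 := blip_ge0 f0.
set a := b.1 * D1 x y + b.2 * D2 x y; set Q := quad _ _ _ _ _ _.
have i1 : (normal_prob 0 s).-integrable setT (EFin \o (fun z : R => z)).
  exact: (integrable_normal_pow s0 (isT : (1 <= 4)%N)).
have i2 : (normal_prob 0 s).-integrable setT (EFin \o (fun z : R => z ^+ 2)).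
  exact: (integrable_normal_pow s0 (isT : (2 <= 4)%N)).
have [i3 le3] := normal_third_moment s0.
have ig := integrable_gavg s b x y f0.
have -> : gavg s b f x y - f x y - s ^+ 2 / 2 * Q =
  \int[normal_prob 0 s]_z (f (x + b.1 * z) (y + b.2 * z) - (f x y + a * z + Q / 2 * z ^+ 2)).
  rewrite Rintegral_subr; integrable_lin => //.
  rewrite Rintegral_addr; integrable_lin => //.
  rewrite Rintegral_addr; integrable_lin => //.
  rewrite Rintegral_probability_cst !Rintegral_mull// normal_mean// normal_second_moment//.
  by rewrite /gavg; ring.
apply: (@le_trans _ _ (\int[normal_prob 0 s]_z (K * (`|b.1| + `|b.2|) ^+ 3 * `|z| ^+ 3))).
  apply: normr_Rintegral_le; integrable_lin => // z.
  have h := rem x y (b.1 * z) (b.2 * z); rewrite !normrM -mulrDl in h.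
  rewrite (_ : K * _ * _ = K * ((`|b.1| + `|b.2|) * `|z|) ^+ 3); last first.
    by ring.
  apply: le_trans h; rewrite le_eqVlt; apply/orP; left.
  by apply/eqP; congr (`|_|); rewrite /a /Q /quad; field.
rewrite Rintegral_mull// ler_wpM2l// mulr_ge0// exprn_ge0// addr_ge0//.
Qed.

Lemma gavg_near K s b D x y : 0 < s -> blip K D ->
  `|gavg s b D x y - D x y| <= K * (`|b.1| + `|b.2|) * s.
Proof.
move=> s0 DK; have K0 := blip_ge0 DK.
have i2 : (normal_prob 0 s).-integrable setT (EFin \o (fun z : R => z ^+ 2)).
  exact: (integrable_normal_pow s0 (isT : (2 <= 4)%N)).
have ig := integrable_gavg s b x y DK.
rewrite -[X in _ - X](Rintegral_probability_cst (normal_prob 0 s)) -Rintegral_subr; integrable_lin => //.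
apply: (@le_trans _ _ (\int[normal_prob 0 s]_z (K * (`|b.1| + `|b.2|) * (s / 2 + (s^-1 / 2) * z ^+ 2)))).
  apply: normr_Rintegral_le; integrable_lin => // z.
  rewrite (le_trans (DK.2 _ _ _ _))// -mulrA ler_wpM2l//.
  rewrite ![_ + _ * z]addrC !addrK !normrM -mulrDl ler_wpM2l ?addr_ge0//.
  rewrite -(real_normK (num_real z)); move: (`|z|) => a.
  rewrite -subr_ge0 (_ : _ - _ = s^-1 / 2 * (s - a) ^+ 2); last by field; rewrite gt_eqF.
  by rewrite mulr_ge0 ?sqr_ge0// mulr_ge0// invr_ge0 ltW.
rewrite Rintegral_mull; integrable_lin => //.
rewrite Rintegral_addr; integrable_lin => //.
rewrite Rintegral_probability_cst Rintegral_mull// normal_second_moment//.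
rewrite ler_wpM2l ?mulr_ge0 ?addr_ge0//.
rewrite le_eqVlt; apply/orP; left; apply/eqP; field; rewrite gt_eqF//.
Qed.

End smooth_functions.

(** * Lindeberg replacement *)

Section lindeberg.
Context {R : realType} {C : finType}.
Implicit Types (f g D : R -> R -> R) (b c : R * R) (K s t r B : R)
  (q p : C -> R) (u : C -> R * R).

(** Averaging against a centred normal vector of covariance s ^ 2 (b b^T + c c^T). Two directions are
enough to reach every covariance matrix of size 2. *)
Definition gavg2 s b c f := gavg s b (gavg s c f).

Lemma gavg2D K s t b c f : 0 < s -> 0 < t -> blip K f ->
  gavg2 s b c (gavg2 t b c f) = gavg2 (Num.sqrt (s ^+ 2 + t ^+ 2)) b c f.
Proof.
move=> s0 t0 fK; rewrite /gavg2.
rewrite (@gavgC _ K s t c b (gavg t c f)); last exact: blip_gavg.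
rewrite (@gavgD _ K s t b); [|by []..|by do 2 apply: blip_gavg].
by rewrite (@gavgD _ K s t c).
Qed.

(** The sum of n + 1 independent normal vectors: the Gaussian side of the replacement telescopes to a
single average. *)
Lemma iter_gavg2 K s b c f n : 0 < s -> blip K f ->
  iter n.+1 (gavg2 s b c) f = gavg2 (s * Num.sqrt n.+1%:R) b c f.
Proof.
move=> s0 fK; elim: n => [|n IH]; first by rewrite sqrtr1 mulr1.
rewrite iterS IH.
rewrite (@gavg2D K s (s * Num.sqrt n.+1%:R) b c f s0 _ fK); last first.
  by rewrite mulr_gt0// sqrtr_gt0 ltr0n.
have e : Num.sqrt (s ^+ 2 + (s * Num.sqrt n.+1%:R) ^+ 2) = s * Num.sqrt n.+2%:R.
  rewrite exprMn (sqr_sqrtr (ler0n _ n.+1)).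
  have -> : s ^+ 2 + s ^+ 2 * n.+1%:R = s ^+ 2 * n.+2%:R.
    by rewrite -(natr1 n.+1); ring.
  by rewrite sqrtrM ?sqr_ge0 ?sqrtr_sqr ?(gtr0_norm s0).
exact: (congr1 (fun v => gavg2 v b c f) e).
Qed.

Definition smooth K f := exists D1 D2 D11 D12 D22, taylor2 K f D1 D2 D11 D12 D22.

Lemma smooth_gavg2 K s b c f : smooth K f -> smooth K (gavg2 s b c f).
Proof.
move=> [D1 [D2 [D11 [D12 [D22 T]]]]].
by do 5 eexists; do 2 apply: taylor2_gavg; exact: T.
Qed.

Lemma smooth_blip K f : smooth K f -> blip K f.
Proof. by move=> [D1 [D2 [D11 [D12 [D22 []]]]]]. Qed.

Definition gavg2_const b c : R :=
  (64 * Num.sqrt 2 + 1) * ((`|b.1| + `|b.2|) ^+ 3 + (`|c.1| + `|c.2|) ^+ 3) +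
  (`|b.1| + `|b.2|) ^+ 2 * (`|c.1| + `|c.2|).

Lemma gavg2_taylor K s b c f D1 D2 D11 D12 D22 x y : 0 < s ->
  taylor2 K f D1 D2 D11 D12 D22 ->
  `|gavg2 s b c f x y - f x y -
    s ^+ 2 / 2 * (quad b D11 D12 D22 x y + quad c D11 D12 D22 x y)| <=
    K * gavg2_const b c * s ^+ 3.
Proof.
move=> s0 T; have K0 : 0 <= K by case: T => /blip_ge0.
have h1 := gavg_taylor b x y s0 (taylor2_gavg s c T).
have h2 := gavg_taylor c x y s0 T.
have near D : blip K D -> `|gavg s c D x y - D x y| <= K * (`|c.1| + `|c.2|) * s.
  by move=> DK; exact: gavg_near.
set Bb := `|b.1| + `|b.2| in h1; set Bc := `|c.1| + `|c.2| in h2 near.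
have h3 : `|quad b (gavg s c D11) (gavg s c D12) (gavg s c D22) x y - quad b D11 D12 D22 x y|
    <= Bb ^+ 2 * (K * Bc * s).
  have -> : quad b (gavg s c D11) (gavg s c D12) (gavg s c D22) x y - quad b D11 D12 D22 x y =
    b.1 ^+ 2 * (gavg s c D11 x y - D11 x y) + 2 * (b.1 * b.2) * (gavg s c D12 x y - D12 x y)
    + b.2 ^+ 2 * (gavg s c D22 x y - D22 x y) by rewrite /quad; ring.
  rewrite (le_trans (ler_normD _ _))//.
  have -> : Bb ^+ 2 * (K * Bc * s) = (`|b.1| ^+ 2 * (K * Bc * s) +
     2 * (`|b.1| * `|b.2|) * (K * Bc * s)) + `|b.2| ^+ 2 * (K * Bc * s) by rewrite /Bb; ring.
  apply: lerD; last first.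
    rewrite normrM normrX ler_wpM2l ?sqr_ge0//; apply: near; exact: taylor2_D22 T.
  rewrite (le_trans (ler_normD _ _))//; apply: lerD.
    rewrite normrM normrX ler_wpM2l ?sqr_ge0//; apply: near; exact: taylor2_D11 T.
  rewrite !normrM ger0_norm// ler_wpM2l ?mulr_ge0//; apply: near; exact: taylor2_D12 T.
rewrite /gavg2; set G := gavg s b _ x y in h1 *; set g := gavg s c f x y in h1 h2 *.
set Qb := quad b D11 D12 D22 x y in h3 *; set Qc := quad c D11 D12 D22 x y in h2 *.
set Q' := quad b (gavg s c D11) _ _ _ _ in h1 h3 *.
have -> : G - f x y - s ^+ 2 / 2 * (Qb + Qc) =
  (G - g - s ^+ 2 / 2 * Q') + (g - f x y - s ^+ 2 / 2 * Qc) + s ^+ 2 / 2 * (Q' - Qb) by field.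
have h3' : `|s ^+ 2 / 2 * (Q' - Qb)| <= s ^+ 2 * (Bb ^+ 2 * (K * Bc * s)).
  have s2 : 0 <= s ^+ 2 by exact: sqr_ge0.
  rewrite normrM ger0_norm ?divr_ge0//; apply: ler_pM => //; first exact: divr_ge0.
  by rewrite ler_pdivrMr// ler_peMr// ler1n.
rewrite (le_trans (ler_normD _ _))// (le_trans (lerD (ler_normD _ _) (lexx _)))//.
rewrite (le_trans (lerD (lerD h1 h2) h3'))// le_eqVlt; apply/orP; left; apply/eqP.
by rewrite /gavg2_const /Bb /Bc; ring.
Qed.

(** One step of the random walk with increments r u(i), i of law q. *)
Definition qavg q u r f (x y : R) : R :=
  \sum_i q i * f (x + r * (u i).1) (y + r * (u i).2).

Lemma iid_Ex_iter_qavg q u r f n x y :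
  iid_Ex q n (fun w => f (x + r * \sum_(i <- w) (u i).1) (y + r * \sum_(i <- w) (u i).2)) =
  iter n (qavg q u r) f x y.
Proof.
elim: n x y => [|n IH] x y /=; first by rewrite !big_nil mulr0 !addr0.
rewrite [RHS]/qavg; apply: eq_bigr => i _; congr (_ * _); rewrite -IH.
by apply: eq_Ex => s _; rewrite !big_cons !mulrDr !addrA.
Qed.

Definition mom11 q u : R := \sum_i q i * (u i).1 ^+ 2.
Definition mom12 q u : R := \sum_i q i * ((u i).1 * (u i).2).
Definition mom22 q u : R := \sum_i q i * (u i).2 ^+ 2.

Lemma qavg_taylor K q u r B f D1 D2 D11 D12 D22 x y :
  prob_vector q -> \sum_i q i * (u i).1 = 0 -> \sum_i q i * (u i).2 = 0 ->
  (forall i, `|(u i).1| <= B) -> (forall i, `|(u i).2| <= B) -> 0 <= r ->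
  taylor2 K f D1 D2 D11 D12 D22 ->
  `|qavg q u r f x y - f x y - r ^+ 2 / 2 *
     (mom11 q u * D11 x y + 2 * mom12 q u * D12 x y + mom22 q u * D22 x y)| <=
  K * (8 * B ^+ 3) * r ^+ 3.
Proof.
move=> qp q1 q2 u1 u2 r0 T; have K0 : 0 <= K by case: T => /blip_ge0.
have rem := taylor2_rem T.
pose d i := f (x + r * (u i).1) (y + r * (u i).2) - (f x y + ((r * (u i).1) * D1 x y +
  (r * (u i).2) * D2 x y) + ((r * (u i).1) ^+ 2 / 2 * D11 x y +
   (r * (u i).1) * (r * (u i).2) * D12 x y + (r * (u i).2) ^+ 2 / 2 * D22 x y)).
have -> : qavg q u r f x y - f x y - r ^+ 2 / 2 *
     (mom11 q u * D11 x y + 2 * mom12 q u * D12 x y + mom22 q u * D22 x y) = \sum_i q i * d i.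
  rewrite [RHS](eq_bigr (fun i => q i * f (x + r * (u i).1) (y + r * (u i).2) -
     (f x y * q i + r * D1 x y * (q i * (u i).1) + r * D2 x y * (q i * (u i).2) +
      r ^+ 2 / 2 * D11 x y * (q i * (u i).1 ^+ 2) +
      r ^+ 2 * D12 x y * (q i * ((u i).1 * (u i).2)) +
      r ^+ 2 / 2 * D22 x y * (q i * (u i).2 ^+ 2)))); last first.
    by move=> i _; rewrite /d; field.
  rewrite sumrB !big_split/= -!mulr_sumr q1 q2 qp.2 /qavg -/(mom11 q u) -/(mom12 q u) -/(mom22 q u).
  by field.
rewrite (le_trans (ler_norm_sum _ _ _))// -[leRHS]mul1r -[X in X * _]qp.2 mulr_suml.
apply: ler_sum => i _; rewrite normrM (ger0_norm (qp.1 i)) ler_wpM2l ?qp.1//.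
rewrite /d (le_trans (rem _ _ _ _))// -mulrA ler_wpM2l//.
rewrite !normrM -mulrDr exprMn (ger0_norm r0) mulrC ler_wpM2r ?exprn_ge0//.
have -> : 8 * B ^+ 3 = (B + B) ^+ 3 by ring.
by apply: lerXn2r; rewrite ?nnegrE ?addr_ge0 ?lerD//; exact: le_trans (u1 i).
Qed.

(** The bootstrap draws from the sample frequencies, whose covariance only approximates the target one;
the defect is carried along as an error term. *)
Definition cov_defect q u t b c : R :=
  `|mom11 q u - t ^+ 2 * (b.1 ^+ 2 + c.1 ^+ 2)| +
  `|mom12 q u - t ^+ 2 * (b.1 * b.2 + c.1 * c.2)| +
  `|mom22 q u - t ^+ 2 * (b.2 ^+ 2 + c.2 ^+ 2)|.

Definition lindeberg_const B t b c : R := 8 * B ^+ 3 + gavg2_const b c * t ^+ 3.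

(** Both averages agree with the same second-order expansion, up to the covariance defect and third
moments. *)
Lemma lindeberg_step K q u r t B b c f x y :
  prob_vector q -> \sum_i q i * (u i).1 = 0 -> \sum_i q i * (u i).2 = 0 ->
  (forall i, `|(u i).1| <= B) -> (forall i, `|(u i).2| <= B) -> 0 < r -> 0 < t ->
  smooth K f ->
  `|qavg q u r f x y - gavg2 (t * r) b c f x y| <=
  K * (r ^+ 2 * cov_defect q u t b c + lindeberg_const B t b c * r ^+ 3).
Proof.
move=> qp q1 q2 u1 u2 r0 t0 [D1 [D2 [D11 [D12 [D22 T]]]]].
have K0 : 0 <= K by case: T => /blip_ge0.
have h1 := qavg_taylor x y qp q1 q2 u1 u2 (ltW r0) T.
have h2 := gavg2_taylor b c x y (mulr_gt0 t0 r0) T.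
move: h1 h2; set A := qavg _ _ _ _ _ _; set G := gavg2 _ _ _ _ _ _.
set Q1 := _ + mom22 q u * _; set Q2 := quad b _ _ _ _ _ + _ => h1 h2.
have hQ : `|r ^+ 2 / 2 * Q1 - (t * r) ^+ 2 / 2 * Q2| <= K * (r ^+ 2 * cov_defect q u t b c).
  have -> : r ^+ 2 / 2 * Q1 - (t * r) ^+ 2 / 2 * Q2 = r ^+ 2 *
    ((mom11 q u - t ^+ 2 * (b.1 ^+ 2 + c.1 ^+ 2)) * (D11 x y / 2) +
     (mom12 q u - t ^+ 2 * (b.1 * b.2 + c.1 * c.2)) * D12 x y +
     (mom22 q u - t ^+ 2 * (b.2 ^+ 2 + c.2 ^+ 2)) * (D22 x y / 2)).
    by rewrite /Q1 /Q2 /quad; field.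
  rewrite normrM (ger0_norm (sqr_ge0 r)) [leRHS]mulrCA ler_wpM2l ?sqr_ge0//.
  rewrite /cov_defect [leRHS]mulrDr [X in _ <= X + _]mulrDr; apply: le_trans (ler_normD _ _) _.
  have half D : blip K D -> `|D x y / 2| <= K.
    move=> DK; rewrite normrM (le_trans (ler_pM _ _ (DK.1 x y) (lexx _)))//.
    by rewrite ger0_norm ?invr_ge0// ler_piMr// invf_le1// ler1n.
  apply: lerD; last first.
    by rewrite normrM mulrC ler_wpM2r//; apply: half; exact: taylor2_D22 T.
  apply: le_trans (ler_normD _ _) _; apply: lerD; rewrite normrM mulrC ler_wpM2r//.
    by apply: half; exact: taylor2_D11 T.
  exact: (taylor2_D12 T).1.
have -> : A - G = (A - f x y - r ^+ 2 / 2 * Q1) - (G - f x y - (t * r) ^+ 2 / 2 * Q2)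
   + (r ^+ 2 / 2 * Q1 - (t * r) ^+ 2 / 2 * Q2) by ring.
rewrite (le_trans (ler_normD _ _))// [leRHS]mulrDr addrC lerD//.
rewrite (le_trans (ler_normB _ _))// (le_trans (lerD h1 h2))// le_eqVlt; apply/orP; left; apply/eqP.
by rewrite /lindeberg_const; ring.
Qed.

Lemma qavg_contract q u r f g (e : R) : prob_vector q ->
  (forall x y, `|f x y - g x y| <= e) ->
  forall x y, `|qavg q u r f x y - qavg q u r g x y| <= e.
Proof.
move=> qp fg x y; rewrite /qavg -sumrB.
rewrite (le_trans (ler_norm_sum _ _ _))// -[leRHS]mul1r -[X in X * _]qp.2 mulr_suml.
apply: ler_sum => i _; rewrite -mulrBr normrM (ger0_norm (qp.1 i)) ler_wpM2l ?qp.1//.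
Qed.

(** Replacing the n summands one at a time costs n times the error of [lindeberg_step], and
n r ^ 2 = 1. *)
Lemma lindeberg K q u t B b c f n r (x y : R) :
  prob_vector q -> \sum_i q i * (u i).1 = 0 -> \sum_i q i * (u i).2 = 0 ->
  (forall i, `|(u i).1| <= B) -> (forall i, `|(u i).2| <= B) -> 0 < t ->
  smooth K f -> 0 < r -> r ^+ 2 * n%:R = 1 ->
  `|iid_Ex q n (fun w => f (x + r * \sum_(i <- w) (u i).1) (y + r * \sum_(i <- w) (u i).2))
    - gavg2 t b c f x y| <= K * (cov_defect q u t b c + lindeberg_const B t b c * r).
Proof.
move=> qp q1 q2 u1 u2 t0 sf r0 r2; rewrite iid_Ex_iter_qavg.
set d := K * (r ^+ 2 * cov_defect q u t b c + lindeberg_const B t b c * r ^+ 3).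
(* averages are contractions for the uniform norm, so the errors of the steps add up *)
have main m : forall x y, `|iter m (qavg q u r) f x y - iter m (gavg2 (t * r) b c) f x y| <= m%:R * d.
  elim: m => [|m IH] x' y'; first by rewrite /= subrr normr0 mul0r.
  have sm : smooth K (iter m (gavg2 (t * r) b c) f).
    by elim: m {IH} => [//|m IH]; rewrite iterS; exact: smooth_gavg2.
  rewrite !iterS -[X in `|X|](subrKA (qavg q u r (iter m (gavg2 (t * r) b c) f) x' y')).
  rewrite (le_trans (ler_normD _ _))// -natr1 mulrDl mul1r lerD//.
    exact: qavg_contract.
  exact: lindeberg_step.
have := main n x y; case: n r2 main => [|n] r2 main.
  by move: r2; rewrite mulr0 => /esym/eqP; rewrite oner_eq0.
rewrite (iter_gavg2 _ _ _ (mulr_gt0 t0 r0) (smooth_blip sf)).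
have rn : r * Num.sqrt n.+1%:R = 1.
  by rewrite -[r](gtr0_norm r0) -sqrtr_sqr -sqrtrM ?sqr_ge0 ?r2 ?sqrtr1.
rewrite -mulrA rn mulr1 => /le_trans; apply.
rewrite /d mulrCA le_eqVlt; apply/orP; left; apply/eqP; congr (_ * _).
have -> : n.+1%:R * (r ^+ 2 * cov_defect q u t b c + lindeberg_const B t b c * r ^+ 3) =
  (r ^+ 2 * n.+1%:R) * (cov_defect q u t b c + lindeberg_const B t b c * r).
  by move: (n.+1%:R) => m; ring.
by rewrite r2 mul1r.
Qed.

End lindeberg.

(** * Central limit theorem for resampling *)

Section bootstrap_clt.
Context {R : realType} {C : finType}.
Variables (p : C -> R) (u : C -> R * R) (t B : R) (b c : R * R) (K : R) (f : R -> R -> R).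
Hypotheses (pp : prob_vector p) (p1 : \sum_i p i * (u i).1 = 0)
  (p2 : \sum_i p i * (u i).2 = 0)
  (u1B : forall i, `|(u i).1| <= B) (u2B : forall i, `|(u i).2| <= B) (t0 : 0 < t)
  (m11 : mom11 p u = t ^+ 2 * (b.1 ^+ 2 + c.1 ^+ 2))
  (m12 : mom12 p u = t ^+ 2 * (b.1 * b.2 + c.1 * c.2))
  (m22 : mom22 p u = t ^+ 2 * (b.2 ^+ 2 + c.2 ^+ 2))
  (sf : smooth K f).

Let K0 : 0 <= K. Proof. exact: blip_ge0 (smooth_blip sf). Qed.

Let B0 : 0 <= B.
Proof.
case: (pickP C) => [i _|C0]; first exact: le_trans (u1B i).
have := pp.2; rewrite big1 => [|i _]; last by have := C0 i.
by move/eqP; rewrite eq_sym oner_eq0.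
Qed.

Let avg n (e : seq C) (g : C -> R) := (\sum_(i <- e) g i) / n%:R.

Let avg_le n e g (M : R) : (0 < n)%N -> size e = n -> (forall i, `|g i| <= M) -> `|avg n e g| <= M.
Proof.
move=> n0 en gM; have qe := prob_vector_freq (R := R) n0 en.
rewrite /avg -sum_freq (le_trans (ler_norm_sum _ _ _))// -[leRHS]mul1r -[X in X * _]qe.2 mulr_suml.
by apply: ler_sum => i _; rewrite normrM (ger0_norm (qe.1 i)) ler_wpM2l ?qe.1.
Qed.

(** Lindeberg's theorem for the scores recentred at their means in e: the offset is then the sum over e,
and the covariance defect is controlled by the sample averages of the scores and their products. *)
Let conditional_clt n (r : R) e : (0 < n)%N -> size e = n -> 0 < r -> r ^+ 2 * n%:R = 1 ->
  `|iid_Ex (freq n e) n (fun w => f (r * \sum_(i <- w) (u i).1) (r * \sum_(i <- w) (u i).2)) -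
    gavg2 t b c f (0 + r * \sum_(i <- e) (u i).1) (0 + r * \sum_(i <- e) (u i).2)| <=
  K * (`|avg n e (fun i => (u i).1 ^+ 2 - mom11 p u)| +
       `|avg n e (fun i => (u i).1 * (u i).2 - mom12 p u)| +
       `|avg n e (fun i => (u i).2 ^+ 2 - mom22 p u)| +
       (B * `|avg n e (fun i => (u i).1)| + B * `|avg n e (fun i => (u i).2)| +
        B * `|avg n e (fun i => (u i).2)|) + lindeberg_const (2 * B) t b c * r).
Proof.
move=> n0 en r0 r2; have qe := prob_vector_freq (R := R) n0 en.
have nn : (n%:R : R) != 0 by rewrite pnatr_eq0 -lt0n.
set m1 := avg n e (fun i => (u i).1); set m2 := avg n e (fun i => (u i).2).
pose u' i := ((u i).1 - m1, (u i).2 - m2).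
have m1B : `|m1| <= B by exact: avg_le.
have m2B : `|m2| <= B by exact: avg_le.
have avgB g a : \sum_i freq n e i * (g i - a) = avg n e g - a.
  under eq_bigr do rewrite mulrBr.
  by rewrite sumrB -mulr_suml qe.2 mul1r sum_freq.
have mE g a : avg n e (fun i => g i - a) = avg n e g - a.
  by rewrite -avgB sum_freq.
have avgK g : n%:R * avg n e g = \sum_(i <- e) g i by rewrite /avg mulrC divfK.
have q1 : \sum_i freq n e i * (u' i).1 = 0 by rewrite avgB subrr.
have q2 : \sum_i freq n e i * (u' i).2 = 0 by rewrite avgB subrr.
have u1' i : `|(u' i).1| <= 2 * B.
  by rewrite (le_trans (ler_normB _ _))// mulrDl mul1r lerD.
have u2' i : `|(u' i).2| <= 2 * B.
  by rewrite (le_trans (ler_normB _ _))// mulrDl mul1r lerD.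
have h := @lindeberg _ _ K (freq n e) u' t (2 * B) b c f n r
  (0 + r * \sum_(i <- e) (u i).1) (0 + r * \sum_(i <- e) (u i).2)
  qe q1 q2 u1' u2' t0 sf r0 r2.
rewrite (_ : iid_Ex _ _ _ = iid_Ex (freq n e) n (fun w =>
   f (0 + r * \sum_(i <- e) (u i).1 + r * \sum_(i <- w) (u' i).1)
     (0 + r * \sum_(i <- e) (u i).2 + r * \sum_(i <- w) (u' i).2))); last first.
  apply: eq_Ex => w wn.
  have E (g : C -> R) : r * \sum_(i <- w) g i =
      0 + r * \sum_(i <- e) g i + r * \sum_(i <- w) (g i - avg n e g).
    rewrite add0r -mulrDr; congr (_ * _).
    rewrite sumrB big_const_seq count_predT wn iter_addr_0 -mulr_natl avgK.
    by rewrite addrCA subrr addr0.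
  by congr f; exact: E.
apply: (le_trans h); rewrite ler_wpM2l// lerD2r.
have D (g h' : C -> R) (a : R) : mom12 (freq n e) (fun i => (g i - avg n e g, h' i - avg n e h')) - a
    = avg n e (fun i => g i * h' i - a) - avg n e g * avg n e h'.
  rewrite mE /mom12/=.
  rewrite (eq_bigr (fun i => freq n e i * (g i * h' i) - avg n e h' * (freq n e i * (g i - avg n e g))
     - avg n e g * (freq n e i * h' i))); last by move=> i _; ring.
  rewrite !sumrB -!mulr_sumr avgB subrr mulr0 subr0 !sum_freq -!/(avg _ _ _).
  by rewrite addrAC.
have h3 (a x y z : R) : a = x - y * z -> `|y| <= B -> `|a| <= `|x| + B * `|z|.
  move=> -> yB; rewrite (le_trans (ler_normB _ _))// lerD2l normrM.
  by rewrite ler_wpM2r.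
rewrite /cov_defect -m11 -m12 -m22.
rewrite [leRHS]addrACA [X in _ <= X + _]addrACA.
apply: lerD; first apply: lerD.
- apply: (h3 _ _ m1) => //; rewrite -(D (fun i => (u i).1) (fun i => (u i).1)).
  by congr (_ - _); apply: eq_bigr => i _; rewrite expr2.
- apply: (h3 _ _ m1) => //; exact: D.
- apply: (h3 _ _ m2) => //; rewrite -(D (fun i => (u i).2) (fun i => (u i).2)).
  by congr (_ - _); apply: eq_bigr => i _; rewrite expr2.
Qed.

(** The conditional theorem replaces the bootstrap sum by a Gaussian average at the sum over e, and the
unconditional one, applied to that Gaussian average as test function, treats the sum over e. The
defects average to order r by [normr_Ex_mean_le]. *)
Lemma bootstrap_clt : exists M : R, forall n (r : R), (0 < n)%N -> 0 < r -> r ^+ 2 * n%:R = 1 ->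
  `|boot_Ex p n (fun w => f (r * \sum_(i <- w) (u i).1) (r * \sum_(i <- w) (u i).2)) -
    gavg2 (Num.sqrt (t ^+ 2 + t ^+ 2)) b c f 0 0| <= M * r.
Proof.
pose M1 : R := 3 * (1 + (2 * B ^+ 2) ^+ 2) + 3 * (B * (1 + B ^+ 2)) + lindeberg_const (2 * B) t b c.
exists (K * M1 + K * lindeberg_const B t b c) => n r n0 r0 r2.
have rn : r ^+ 2 = n%:R^-1.
  have nn : (n%:R : R) != 0 by rewrite pnatr_eq0 -lt0n.
  by apply: (mulIf nn); rewrite r2 mulVf.
rewrite -(gavg2D _ _ t0 t0 (smooth_blip sf)).
set Pf := gavg2 t b c f.
have := @lindeberg _ _ K p u t B b c Pf n r 0 0 pp p1 p2 u1B u2B t0 (smooth_gavg2 _ _ _ sf) r0 r2.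
rewrite {1}/cov_defect m11 m12 m22 !subrr !normr0 !addr0 add0r => h2.
set E2 := iid_Ex _ _ _ in h2; rewrite -[X in `|X|](subrKA E2) mulrDl.
rewrite (le_trans (ler_normD _ _))//; apply: lerD; last by rewrite -mulrA.
rewrite /boot_Ex /E2 -iid_ExB.
apply: le_trans; first by apply: normr_Ex_le => // e en; exact: (conditional_clt n0 en r0 r2).
rewrite iid_ExZ -mulrA ler_wpM2l// !iid_ExD iid_Ex_cst// !iid_ExZ.
have bound (g : C -> R) (M : R) : \sum_i p i * g i = 0 -> (forall i, `|g i| <= M) ->
    iid_Ex p n (fun e => `|avg n e g|) <= (1 + M ^+ 2) * r.
  move=> pg gM; apply: normr_Ex_mean_le => // i.
  by rewrite -(real_normK (num_real (g i))) lerXn2r ?nnegrE// (le_trans _ (gM i)).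
have uu (g h : C -> R) (a : R) : (forall i, `|g i| <= B) -> (forall i, `|h i| <= B) ->
   a = \sum_i p i * (g i * h i) ->
    iid_Ex p n (fun e => `|avg n e (fun i => g i * h i - a)|) <= (1 + (2 * B ^+ 2) ^+ 2) * r.
  move=> gB hB aE; have ghB i : `|g i * h i| <= B ^+ 2 by rewrite normrM expr2 ler_pM.
  have aB : `|a| <= B ^+ 2.
    rewrite aE (le_trans (ler_norm_sum _ _ _))// -[leRHS]mul1r -[X in X * _]pp.2 mulr_suml.
    by apply: ler_sum => i _; rewrite normrM (ger0_norm (pp.1 i)) ler_wpM2l ?pp.1.
  apply: bound => [|i].
    under eq_bigr do rewrite mulrBr.
    by rewrite sumrB -mulr_suml pp.2 mul1r -aE subrr.
  by rewrite (le_trans (ler_normB _ _))// mulrDl mul1r lerD.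
have b11 := uu (fun i => (u i).1) (fun i => (u i).1) (mom11 p u) u1B u1B
  (eq_bigr _ (fun i _ => congr1 (fun x => p i * x) (expr2 _))).
have b12 := uu (fun i => (u i).1) (fun i => (u i).2) (mom12 p u) u1B u2B erefl.
have b22 := uu (fun i => (u i).2) (fun i => (u i).2) (mom22 p u) u2B u2B
  (eq_bigr _ (fun i _ => congr1 (fun x => p i * x) (expr2 _))).
have b1 := ler_wpM2l B0 (bound _ _ p1 u1B).
have b2 := ler_wpM2l B0 (bound _ _ p2 u2B).
have -> : M1 * r = (1 + (2 * B ^+ 2) ^+ 2) * r + (1 + (2 * B ^+ 2) ^+ 2) * r +
  (1 + (2 * B ^+ 2) ^+ 2) * r + (B * ((1 + B ^+ 2) * r) + B * ((1 + B ^+ 2) * r) +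
   B * ((1 + B ^+ 2) * r)) + lindeberg_const (2 * B) t b c * r by rewrite /M1; ring.
apply: lerD => //; apply: lerD; last by apply: lerD => //; exact: lerD.
by apply: lerD; [apply: lerD; [exact: b11|exact: b12]|exact: b22].
Qed.

End bootstrap_clt.

(** * Smooth test functions *)

Section test_functions.
Context {R : realType}.
Implicit Types (U V : R -> R) (K x y h k a : R).

Definition blip1 K U := (forall x, `|U x| <= K) /\
  forall x h, `|U (x + h) - U x| <= K * `|h|.

(** The one-variable counterpart of [taylor2], with U1 and U2 for the first two derivatives. *)
Record taylor1 K U U1 U2 : Prop := Taylor1 {
  taylor1_U : blip1 K U; taylor1_U1 : blip1 K U1; taylor1_U2 : blip1 K U2;
  taylor1_rem1 : forall x h, `|U (x + h) - U x - h * U1 x| <= K * `|h| ^+ 2;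
  taylor1_rem2 : forall x h,
    `|U (x + h) - U x - h * U1 x - h ^+ 2 / 2 * U2 x| <= K * `|h| ^+ 3 }.

Lemma blip_prod K U V : blip1 K U -> blip1 K V -> blip (K ^+ 2) (fun x y => U x * V y).
Proof.
move=> [Ub Ul] [Vb Vl]; have K0 : 0 <= K := le_trans (normr_ge0 _) (Ub 0).
split=> [x y|x y x' y']; first by rewrite normrM expr2 ler_pM.
have -> : U x * V y - U x' * V y' = (U x - U x') * V y + U x' * (V y - V y') by ring.
rewrite (le_trans (ler_normD _ _))// !normrM mulrDr lerD//.
- rewrite expr2 mulrAC ler_pM//.
  by have := Ul x' (x - x'); rewrite addrCA subrr addr0.
- rewrite expr2 -mulrA ler_pM//.
  by have := Vl y' (y - y'); rewrite addrCA subrr addr0.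
Qed.

Lemma smooth_prod K U U1 U2 V V1 V2 : taylor1 K U U1 U2 -> taylor1 K V V1 V2 ->
  smooth (K ^+ 2) (fun x y => U x * V y).
Proof.
move=> [Ub U1b U2b Ur1 Ur2] [Vb V1b V2b Vr1 Vr2].
exists (fun x y => U1 x * V y), (fun x y => U x * V1 y), (fun x y => U2 x * V y),
  (fun x y => U1 x * V1 y), (fun x y => U x * V2 y).
split; try exact: blip_prod.
move=> x y h k; have K0 : 0 <= K := le_trans (normr_ge0 _) (Ub.1 0).
pose a := U (x + h) - U x; pose b := V (y + k) - V y.
have -> : U (x + h) * V (y + k) - (U x * V y + (h * (U1 x * V y) + k * (U x * V1 y)) +
   (h ^+ 2 / 2 * (U2 x * V y) + h * k * (U1 x * V1 y) + k ^+ 2 / 2 * (U x * V2 y))) =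
  (a - h * U1 x - h ^+ 2 / 2 * U2 x) * V y + U x * (b - k * V1 y - k ^+ 2 / 2 * V2 y) +
  ((a - h * U1 x) * b + (h * U1 x) * (b - k * V1 y)).
  by rewrite /a /b; field.
apply: (@le_trans _ _ (K * `|h| ^+ 3 * K + K * (K * `|k| ^+ 3) +
   (K * `|h| ^+ 2 * (K * `|k|) + (`|h| * K) * (K * `|k| ^+ 2)))).
  apply: (le_trans (ler_normD _ _)); apply: lerD; apply: (le_trans (ler_normD _ _));
    apply: lerD; rewrite normrM ler_pM//.
  - exact: Ur2.
  - exact: Vb.1.
  - exact: Ub.1.
  - exact: Vr2.
  - exact: Ur1.
  - exact: Vb.2.
  - by rewrite normrM ler_wpM2l//; exact: U1b.1.
  - exact: Vr1.
rewrite -subr_ge0; move: (`|h|) (`|k|) (normr_ge0 h) (normr_ge0 k) => i j i0 j0.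
rewrite (_ : _ - _ = K ^+ 2 * (2 * (i * j * (i + j)))); last by ring.
by rewrite mulr_ge0 ?sqr_ge0// !mulr_ge0// addr_ge0.
Qed.

Lemma taylor1_affine K U U1 U2 (l m : R) : taylor1 K U U1 U2 ->
  taylor1 (K * (1 + `|l|) ^+ 3) (fun x => U (m + l * x))
    (fun x => l * U1 (m + l * x)) (fun x => l ^+ 2 * U2 (m + l * x)).
Proof.
move=> [Ub U1b U2b Ur1 Ur2]; have K0 : 0 <= K := le_trans (normr_ge0 _) (Ub.1 0).
set L := 1 + `|l|; have L1 : 1 <= L by rewrite lerDl.
have lL : `|l| <= L by rewrite lerDr.
have L0 : 0 <= L by exact: le_trans L1.
have pw i j : (i + j <= 3)%N -> `|l| ^+ i * `|l| ^+ j <= L ^+ 3.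
  move=> ij; rewrite -exprD; apply: (@le_trans _ _ (L ^+ (i + j))).
    by rewrite lerXn2r ?nnegrE.
  by rewrite ler_weXn2l.
have blip1_comp W (i : nat) : (i.+1 <= 3)%N -> blip1 K W ->
    blip1 (K * L ^+ 3) (fun x => l ^+ i * W (m + l * x)).
  move=> i3 [Wb Wl]; split=> [x|x h].
    rewrite normrM normrX mulrC ler_pM ?exprn_ge0//.
    by have := pw i 0%N; rewrite expr0 mulr1 addn0; apply; exact: ltnW.
  rewrite -mulrBr normrM normrX mulrDr addrA (le_trans (ler_wpM2l _ (Wl _ _)))// ?exprn_ge0//.
  rewrite normrM (_ : _ * (K * _) = (K * `|h|) * (`|l| ^+ i * `|l| ^+ 1)); last by ring.
  rewrite [leRHS](_ : _ = (K * `|h|) * L ^+ 3); last by ring.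
  by rewrite ler_wpM2l ?mulr_ge0//; apply: pw; rewrite addn1.
split.
- by have [b1 b2] := blip1_comp U 0%N isT Ub; split=> [x|x h];
    [have := b1 x|have := b2 x h]; rewrite expr0 !mul1r.
- by have [b1 b2] := blip1_comp U1 1%N isT U1b; split=> [x|x h];
    [have := b1 x|have := b2 x h]; rewrite expr1.
- exact: blip1_comp.
- move=> x h; have := Ur1 (m + l * x) (l * h); rewrite mulrDr addrA.
  rewrite (_ : U _ - _ - _ = U (m + l * x + l * h) - U (m + l * x) - h * (l * U1 (m + l * x)));
    last by ring.
  move=> /le_trans; apply; rewrite -mulrA ler_wpM2l//.
  rewrite normrM exprMn ler_wpM2r ?exprn_ge0//.
  by have := pw 2%N 0%N; rewrite expr0 mulr1; exact.
- move=> x h; have := Ur2 (m + l * x) (l * h); rewrite mulrDr addrA.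
  rewrite (_ : U _ - _ - _ - _ = U (m + l * x + l * h) - U (m + l * x) - h * (l * U1 (m + l * x)) -
    h ^+ 2 / 2 * (l ^+ 2 * U2 (m + l * x))); last by field.
  move=> /le_trans; apply; rewrite -mulrA ler_wpM2l//.
  rewrite normrM exprMn ler_wpM2r ?exprn_ge0//.
  by have := pw 3%N 0%N; rewrite expr0 mulr1; exact.
Qed.

(** For |h| <= 1 each estimate follows from the next order one, and for |h| >= 1 from boundedness. *)
Lemma taylor1_intro U U1 U2 (A : R) : 1 <= A ->
  (forall x, `|U x| <= A) -> (forall x, `|U1 x| <= A) -> (forall x, `|U2 x| <= A) ->
  (forall x h, `|U2 (x + h) - U2 x| <= A * `|h|) ->
  (forall x h, `|U1 (x + h) - U1 x - h * U2 x| <= A * `|h| ^+ 2) ->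
  (forall x h, `|U (x + h) - U x - h * U1 x - h ^+ 2 / 2 * U2 x| <= A * `|h| ^+ 3) ->
  taylor1 (4 * A) U U1 U2.
Proof.
move=> A1 Ub U1b U2b U2l U1r Ur; have A0 : 0 <= A by exact: le_trans A1.
have A4 : A <= 4 * A by rewrite ler_peMl// ler1n.
have big (W : R -> R) x h : (forall x, `|W x| <= A) -> `|W (x + h) - W x| <= 2 * A.
  by move=> Wb; rewrite (le_trans (ler_normB _ _))// mulrDl mul1r lerD.
have r1 x h : `|U (x + h) - U x - h * U1 x| <= 3 * A * `|h| ^+ 2.
  have [h1|/ltW h1] := leP `|h| 1.
    rewrite -[X in `|X|](subrK (h ^+ 2 / 2 * U2 x)) (le_trans (ler_normD _ _))//.
    rewrite (_ : 3 * A * _ = A * `|h| ^+ 2 + 2 * A * `|h| ^+ 2); last by ring.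
    apply: lerD.
      apply: (le_trans (Ur _ _)); rewrite ler_wpM2l// exprS ler_piMl// exprn_ge0//.
    rewrite normrM normrM normrX (ger0_norm (_ : 0 <= 2^-1)) ?invr_ge0//.
    rewrite mulrC -mulrA [X in _ <= X]mulrCA mulrA mulrC -mulrA.
    rewrite mulrCA; have := U2b x; set q := `|h| ^+ 2; have q0 : 0 <= q by rewrite exprn_ge0.
    by move=> ?; nra.
  rewrite (le_trans (ler_normB _ _))// normrM.
  have := big U x h Ub; have := U1b x; move: `|h| h1 (`|U1 x|) (`|U (x + h) - U x|).
  move=> j j1 p q pA qA; have j0 : 0 <= j by exact: le_trans j1.
  have e1 : j * p <= j * A by rewrite ler_wpM2l.
  have e2 : A * j <= A * j ^+ 2 by rewrite ler_wpM2l// expr2 ler_peMl.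
  have e3 : A <= A * j by rewrite ler_peMr.
  by lra.
have l1 x h : `|U1 (x + h) - U1 x| <= 2 * A * `|h|.
  have [h1|/ltW h1] := leP `|h| 1.
    rewrite -[X in `|X|](subrK (h * U2 x)) (le_trans (ler_normD _ _))//.
    rewrite (le_trans (lerD (U1r _ _) (lexx _)))// normrM.
    have := U2b x; have := normr_ge0 h; move: `|h| h1 (`|U2 x|) => j j1 p j0 pA.
    have e1 : j * p <= j * A by rewrite ler_wpM2l.
    have e2 : A * j ^+ 2 <= A * j by rewrite ler_wpM2l// expr2 ler_piMl.
    by lra.
  rewrite (le_trans (big _ _ _ U1b))//; move: `|h| h1 => j j1.
  have e3 : A <= A * j by rewrite ler_peMr.
  by lra.
have l0 x h : `|U (x + h) - U x| <= 4 * A * `|h|.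
  have [h1|/ltW h1] := leP `|h| 1.
    rewrite -[X in `|X|](subrK (h * U1 x)) (le_trans (ler_normD _ _))//.
    rewrite (le_trans (lerD (r1 _ _) (lexx _)))// normrM.
    have := U1b x; have := normr_ge0 h; move: `|h| h1 (`|U1 x|) => j j1 p j0 pA.
    have e1 : j * p <= j * A by rewrite ler_wpM2l.
    have e2 : A * j ^+ 2 <= A * j by rewrite ler_wpM2l// expr2 ler_piMl.
    by lra.
  rewrite (le_trans (big _ _ _ Ub))//; move: `|h| h1 => j j1.
  have e3 : A <= A * j by rewrite ler_peMr.
  by lra.
split.
- by split=> [x|//]; rewrite (le_trans (Ub _)).
- split=> [x|x h]; first by rewrite (le_trans (U1b _)).
  by rewrite (le_trans (l1 _ _))// ler_wpM2r// ler_wpM2r// ler_nat.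
- split=> [x|x h]; first by rewrite (le_trans (U2b _)).
  by rewrite (le_trans (U2l _ _))// ler_wpM2r.
- by move=> x h; rewrite (le_trans (r1 _ _))// ler_wpM2r ?exprn_ge0// ler_wpM2r// ler_nat.
- by move=> x h; rewrite (le_trans (Ur _ _))// ler_wpM2r ?exprn_ge0.
Qed.

End test_functions.

Section spline.
Context {R : realType}.
Implicit Types x h : R.

(** The positive part is Lipschitz and, up to a factor, it is the second derivative of its cube: just
the regularity needed of a test function. *)
Definition pospart x : R := if 0 <= x then x else 0.

Let pp0 x : x <= 0 -> pospart x = 0.
Proof. by rewrite /pospart le_eqVlt => /orP[/eqP ->|]; [rewrite lexx|rewrite ltNge => /negbTE ->]. Qed.

Let ppx x : 0 <= x -> pospart x = x.
Proof. by rewrite /pospart => ->. Qed.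

Let pp_ge0 x : 0 <= pospart x.
Proof. by rewrite /pospart; case: ifP. Qed.

Let pp_rem1 x h : `|pospart (x + h) - pospart x| <= `|h|.
Proof.
have [h0|/ltW h0] := leP 0 h; have [x0|/ltW x0] := leP 0 x;
  have [xh|/ltW xh] := leP 0 (x + h);
  rewrite ?(ppx x0) ?(pp0 x0) ?(ppx xh) ?(pp0 xh) ?(ger0_norm h0) ?(ler0_norm h0) ler_norml; lra.
Qed.

Let pp_rem2 x h : `|pospart (x + h) ^+ 2 - pospart x ^+ 2 - h * (2 * pospart x)| <= `|h| ^+ 2.
Proof.
rewrite (real_normK (num_real h)).
have [x0|/ltW x0] := leP 0 x; have [xh|/ltW xh] := leP 0 (x + h);
  rewrite ?(ppx x0) ?(pp0 x0) ?(ppx xh) ?(pp0 xh) ler_norml; apply/andP; split; nra.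
Qed.

Let pp_rem3 x h :
  `|pospart (x + h) ^+ 3 - pospart x ^+ 3 - h * (3 * pospart x ^+ 2) - h ^+ 2 * (3 * pospart x)|
  <= `|h| ^+ 3.
Proof.
have [x0|/ltW x0] := leP 0 x; have [xh|/ltW xh] := leP 0 (x + h);
  rewrite ?(ppx x0) ?(pp0 x0) ?(ppx xh) ?(pp0 xh) -?normrX.
- by rewrite le_eqVlt; apply/orP; left; apply/eqP; congr (`|_|); ring.
- have h0 : h <= 0 by lra.
  have e : 0 <= (x + h) ^+ 2 * (- (x + h)) by rewrite mulr_ge0 ?sqr_ge0//; lra.
  have e' : 0 <= - h ^+ 3 - (x + h) ^+ 2 * (- (x + h)).
    rewrite (_ : _ - _ = x * ((x + h) ^+ 2 + (x + h) * h + h ^+ 2)); last by ring.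
    rewrite mulr_ge0// addr_ge0 ?sqr_ge0// addr_ge0 ?sqr_ge0//.
    by rewrite mulr_le0.
  rewrite (ler0_norm (_ : h ^+ 3 <= 0)); last by lra.
  rewrite ler_norml; apply/andP; split; lra.
- have h0 : 0 <= h by lra.
  have e : 0 <= (x + h) ^+ 3 by rewrite exprn_ge0.
  rewrite !expr0n/= !mulr0 !subr0 !ger0_norm ?exprn_ge0//.
  by rewrite lerXn2r ?nnegrE// gerDr.
- by rewrite !expr0n/= !mulr0 !subr0 normr0.
Qed.

(** The distribution function of the sum of three independent uniform variables on [0, 1]. *)
Definition spline x : R := (pospart x ^+ 3 - 3 * pospart (x - 1) ^+ 3 +
  3 * pospart (x - 2) ^+ 3 - pospart (x - 3) ^+ 3) / 6.

Let spline1 x : R := (pospart x ^+ 2 - 3 * pospart (x - 1) ^+ 2 +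
  3 * pospart (x - 2) ^+ 2 - pospart (x - 3) ^+ 2) / 2.

Let spline2 x : R := pospart x - 3 * pospart (x - 1) + 3 * pospart (x - 2) - pospart (x - 3).

(** Reduces a statement about the spline to its polynomial pieces. *)
Let spline_pieces (Q : R -> R -> R -> R -> R -> Prop) :
  (forall x, x <= 0 -> Q x 0 0 0 0) ->
  (forall x, 0 <= x -> x <= 1 -> Q x x 0 0 0) ->
  (forall x, 1 <= x -> x <= 2 -> Q x x (x - 1) 0 0) ->
  (forall x, 2 <= x -> x <= 3 -> Q x x (x - 1) (x - 2) 0) ->
  (forall x, 3 <= x -> Q x x (x - 1) (x - 2) (x - 3)) ->
  forall x, Q x (pospart x) (pospart (x - 1)) (pospart (x - 2)) (pospart (x - 3)).
Proof.
move=> q0 q1 q2 q3 q4 x.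
have [x0|/ltW x0] := leP x 0; first by rewrite !pp0; [exact: q0|lra..].
have [x1|/ltW x1] := leP x 1; first by rewrite (ppx x0) !pp0; [exact: q1|lra..].
have [x2|/ltW x2] := leP x 2.
  by rewrite (ppx x0) (@ppx (x - 1)) ?(@pp0 (x - 2)) ?(@pp0 (x - 3)); [exact: q2|lra..].
have [x3|/ltW x3] := leP x 3.
  by rewrite (ppx x0) (@ppx (x - 1)) ?(@ppx (x - 2)) ?(@pp0 (x - 3)); [exact: q3|lra..].
by rewrite !ppx; [exact: q4|lra..].
Qed.

Lemma spline_le0 x : x <= 0 -> spline x = 0.
Proof. by move=> x0; rewrite /spline !pp0; [rewrite !expr0n/=; field|lra..]. Qed.

Lemma spline_ge3 x : 3 <= x -> spline x = 1.
Proof. by move=> x0; rewrite /spline !ppx; [field|lra..]. Qed.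

Lemma spline_itv01 x : 0 <= spline x <= 1.
Proof.
rewrite /spline; pattern x, (pospart x), (pospart (x - 1)), (pospart (x - 2)), (pospart (x - 3)).
apply: spline_pieces => {}x.
- by move=> _; rewrite !expr0n/=; lra.
- move=> a b; apply/andP; split; rewrite !expr0n/=.
    by rewrite mulr0 subr0 addr0 subr0 divr_ge0// exprn_ge0.
  have : x ^+ 3 <= 1 by rewrite exprn_ile1.
  by lra.
- move=> a b; have [u u0 u1] : exists2 u, x = u + 1 & 0 <= u <= 1.
    by exists (x - 1); [rewrite subrK|lra].
  move: u1; rewrite u0 addrK => /andP[v0 v1]; rewrite !expr0n/=.
  have w1 : u ^+ 3 <= u ^+ 2 by rewrite exprS ler_piMl ?sqr_ge0.
  have w2 : u ^+ 2 <= u by rewrite expr2 ler_piMl.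
  have w3 : 0 <= u ^+ 3 by rewrite exprn_ge0.
  have w4 : 0 <= (1 - u) * (4 + u - 2 * u ^+ 2) by apply: mulr_ge0; lra.
  by apply/andP; split; lra.
- move=> a b; have [u u0 u1] : exists2 u, x = 3 - u & 0 <= u <= 1.
    by exists (3 - x); [ring|lra].
  move: u1; rewrite u0 => /andP[v0 v1]; rewrite !expr0n/=.
  have w1 : u ^+ 3 <= 1 by rewrite exprn_ile1.
  have w3 : 0 <= u ^+ 3 by rewrite exprn_ge0.
  by apply/andP; split; lra.
- by move=> a; apply/andP; split; lra.
Qed.

Let spline1_bound x : `|spline1 x| <= 8.
Proof.
rewrite /spline1; pattern x, (pospart x), (pospart (x - 1)), (pospart (x - 2)), (pospart (x - 3)).
apply: spline_pieces => {}x.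
- by move=> _; rewrite !expr0n/= ler_norml; lra.
- by move=> a b; rewrite !expr0n/= ler_norml; apply/andP; split; nra.
- by move=> a b; rewrite !expr0n/= ler_norml; apply/andP; split; nra.
- by move=> a b; rewrite !expr0n/= ler_norml; apply/andP; split; nra.
- by move=> a; rewrite ler_norml; apply/andP; split; lra.
Qed.

Let spline2_bound x : `|spline2 x| <= 8.
Proof.
rewrite /spline2; pattern x, (pospart x), (pospart (x - 1)), (pospart (x - 2)), (pospart (x - 3)).
by apply: spline_pieces => {}x; rewrite ler_norml; intros; lra.
Qed.

Lemma taylor1_spline : taylor1 32 spline spline1 spline2.
Proof.
rewrite (_ : 32 = 4 * 8); last by ring.
have tri (a b c e M : R) (z1 z2 z3 z4 : R) : `|z1| <= M -> `|z2| <= M -> `|z3| <= M -> `|z4| <= M ->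
   `|z1 - 3 * z2 + 3 * z3 - z4| <= 8 * M.
  by rewrite !ler_norml => /andP[? ?] /andP[? ?] /andP[? ?] /andP[? ?]; apply/andP; split; lra.
have sh x h (a : R) : x + h - a = (x - a) + h by rewrite addrAC.
apply: taylor1_intro => //; first by rewrite ler1n.
- move=> x; have /andP[] := spline_itv01 x.
  by rewrite ler_norml => ? ?; apply/andP; split; lra.
- move=> x h; rewrite /spline2 (sh x h 1) (sh x h 2) (sh x h 3).
  rewrite (_ : _ - _ = (pospart (x + h) - pospart x) - 3 * (pospart (x - 1 + h) - pospart (x - 1)) +
    3 * (pospart (x - 2 + h) - pospart (x - 2)) - (pospart (x - 3 + h) - pospart (x - 3))); last by ring.
  by apply: tri => //; exact: pp_rem1.
- move=> x h; rewrite /spline1 /spline2 (sh x h 1) (sh x h 2) (sh x h 3).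
  pose r y := pospart (y + h) ^+ 2 - pospart y ^+ 2 - h * (2 * pospart y).
  rewrite (_ : _ - _ = (r x - 3 * r (x - 1) + 3 * r (x - 2) - r (x - 3)) / 2); last by rewrite /r; field.
  rewrite normrM (ger0_norm (_ : 0 <= 2^-1)) ?invr_ge0// ler_pdivrMr//.
  apply: (@le_trans _ _ (8 * `|h| ^+ 2)); last by rewrite ler_peMr ?mulr_ge0 ?exprn_ge0 ?ler1n.
  by apply: tri => //; exact: pp_rem2.
- move=> x h; rewrite /spline /spline1 /spline2 (sh x h 1) (sh x h 2) (sh x h 3).
  pose r y := pospart (y + h) ^+ 3 - pospart y ^+ 3 - h * (3 * pospart y ^+ 2) - h ^+ 2 * (3 * pospart y).
  rewrite (_ : _ - _ = (r x - 3 * r (x - 1) + 3 * r (x - 2) - r (x - 3)) / 6); last by rewrite /r; field.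
  rewrite normrM (ger0_norm (_ : 0 <= 6^-1)) ?invr_ge0// ler_pdivrMr//.
  apply: (@le_trans _ _ (8 * `|h| ^+ 3)); last by rewrite ler_peMr ?mulr_ge0 ?exprn_ge0 ?ler1n.
  by apply: tri => //; exact: pp_rem3.
Qed.

(** The spline, reflected and rescaled from [0, 3] to [s, s + e]. The constant depends on e only, so
that steps at different places can be multiplied by [smooth_prod]. *)
Lemma smooth_step (e : R) : 0 < e -> exists K : R, forall s, exists U U1 U2 : R -> R,
  [/\ taylor1 K U U1 U2, forall x, 0 <= U x <= 1,
      forall x, x <= s -> U x = 1 & forall x, s + e <= x -> U x = 0].
Proof.
move=> e0; eexists => s.
have T := taylor1_affine (- (3 / e)) (3 / e * (s + e)) taylor1_spline.
do 3 eexists; split; [exact: T| | |] => /= x.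
- exact: spline_itv01.
- move=> xs; apply: spline_ge3.
  rewrite mulNr -mulrBr mulrAC ler_pdivlMr// ler_wpM2l//; lra.
- move=> xs; apply: spline_le0; rewrite mulNr -mulrBr.
  by rewrite mulr_ge0_le0// ?divr_ge0// ?(ltW e0)//; lra.
Qed.

(** Applied at (s, t) and at (s - e, t - e), these functions squeeze the indicator of a quadrant. *)
Lemma smooth_quadrant (s t e : R) : 0 < e -> exists (phi : R -> R -> R) (K : R),
  [/\ smooth K phi, forall x y, 0 <= phi x y <= 1,
      forall x y, x <= s -> y <= t -> phi x y = 1 &
      forall x y, s + e <= x \/ t + e <= y -> phi x y = 0].
Proof.
move=> /smooth_step[K hK]; have [U [U1 [U2 [TU U01 Us Ue]]]] := hK s.
have [V [V1 [V2 [TV V01 Vt Ve]]]] := hK t.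
exists (fun x y => U x * V y), (K ^+ 2); split; first exact: smooth_prod TU TV.
- move=> x y; have /andP[u0 u1] := U01 x; have /andP[v0 v1] := V01 y.
  by rewrite mulr_ge0//= mulr_ile1.
- by move=> x y xs yt; rewrite Us// Vt// mulr1.
- by move=> x y [xs|yt]; [rewrite Ue// mul0r|rewrite Ve// mulr0].
Qed.

End spline.

(** * Joint law of the sample and the bootstrap sample on a finite partition *)

Section finite_partition.
Context d (T : measurableType d) (R : realType) (P : probability T R) (I : finType).

Lemma probability_bigcup_fin (F : I -> set T) (Q : pred I) :
  (forall i, measurable (F i)) -> trivIset setT F ->
  P (\bigcup_(i in [set i | Q i]) F i) = (\sum_(i | Q i) P (F i))%E.
Proof.
move=> mF tF; rewrite measure_fin_bigcup//.
- have -> : [set i | Q i] = [set` [seq i <- index_enum I | Q i]].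
    by apply/seteqP; split=> i /=; rewrite mem_filter mem_index_enum andbT.
  by rewrite -fsbig_seq ?filter_uniq ?index_enum_uniq// big_filter.
- exact: finite_finset.
- exact: sub_trivIset tF.
Qed.

End finite_partition.

Section conditional_law.
Context {R : realType} d (T : measurableType d) (P : probability T R) (F : R -> R)
  (X : nat -> {RV P >-> R}) (Xs : forall n : nat, 'I_n -> {RV P >-> R}).
Hypotheses (hX : iid_with_cdf X F) (hXs : bootstrap_samples X Xs).

Let G n := g_sigma_preimage (fun i : 'I_n => X i : T -> R).

Definition sample_freq n (A : set R) (w : T) : R :=
  n%:R^-1 * \sum_(i < n) \1_A (X i w).

(** The hypotheses give the marginal law of X_i and the conditional law of the bootstrap variables on rays
only. This predicate collects the sets A for which they hold; it is closed under proper differences,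
which is enough to reach all the intervals needed, with no extension theorem. *)
Record has_bootstrap_law (A : set R) : Prop := HasBootstrapLaw {
  bootstrap_law_measurable : measurable A;
  bootstrap_law_sample : forall i, P (X i @^-1` A) = P (X 0%N @^-1` A);
  bootstrap_law_cond : forall n (i : 'I_n) B, G n B ->
    (\int[P]_(w in B) (sample_freq n A w)%:E)%E = P (Xs i @^-1` A `&` B) }.

Let G_measurable n B : G n B -> measurable B.
Proof.
move: B; apply: smallest_sub; first exact: sigma_algebra_measurable.
move=> B; rewrite -bigcup_seq => -[i _ [A mA <-]].
exact: (measurable_funPT (X i)).
Qed.

Let G_preimage n (i : 'I_n) A : measurable A -> G n (X i @^-1` A).
Proof.
move=> mA; apply: sub_sigma_algebra.
rewrite -bigcup_seq; exists i; first by rewrite /= mem_index_enum.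
by exists A => //; rewrite setTI.
Qed.

Let measurable_sample_freq n A : measurable A ->
  (forall B : set R, measurable B -> G n (sample_freq n A @^-1` B)) /\
  measurable_fun setT (sample_freq n A).
Proof.
move=> mA.
have mX (i : 'I_n) : measurable_fun setT (X i : g_sigma_algebraType
    (\big[setU/set0]_(i < n) preimage_set_system setT (X i : T -> R) measurable) -> R).
  by move=> _ B mB; rewrite setTI; exact: G_preimage.
split; last first.
  apply: measurable_funM => //; apply: measurable_sum => i.
  by apply: measurableT_comp => //; exact: measurable_indic.
have mf : measurable_fun setT (sample_freq n A : g_sigma_algebraType
    (\big[setU/set0]_(i < n) preimage_set_system setT (X i : T -> R) measurable) -> R).
  apply: measurable_funM => //; apply: measurable_sum => i.
  by apply: (measurableT_comp _ (mX i)); exact: measurable_indic.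
by move=> B mB; have := mf measurableT B mB; rewrite setTI.
Qed.

Lemma sample_freq_itv01 n A w : 0 <= sample_freq n A w <= 1.
Proof.
have h : 0 <= \sum_(i < n) (\1_A (X i w) : R) <= n%:R.
  apply/andP; split; first by apply: sumr_ge0 => i _; rewrite indicE.
  have -> : (n%:R : R) = \sum_(i < n) 1 by rewrite big_const_ord iter_addr_0.
  by apply: ler_sum => i _; rewrite indicE; case: (_ \in _).
case/andP: h => h1 h2; rewrite /sample_freq mulr_ge0 ?invr_ge0//=.
have [->|n0] := posnP n; first by rewrite invr0 mul0r.
by rewrite ler_pdivrMl ?ltr0n// mulr1.
Qed.

Let integrable_sample_freq n A B : measurable A -> measurable B ->
  P.-integrable B (EFin \o sample_freq n A).
Proof.
move=> mA mB; apply: (integrableS measurableT) => //.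
apply: measurable_bounded_integrable => //.
- by rewrite -ge0_fin_numE// fin_num_measure.
- exact: (measurable_sample_freq n mA).2.
- exists 1; split; first exact: num_real.
  move=> M M1 w _; have /andP[f0 f1] := sample_freq_itv01 n A w.
  by rewrite /= ger0_norm// (le_trans f1)// ltW.
Qed.

Lemma has_bootstrap_law_version A : has_bootstrap_law A -> forall n (i : 'I_n),
  cond_prob_version P (G n) (Xs i @^-1` A) (sample_freq n A).
Proof.
move=> [mA _ cA] n i; split.
- exact: (measurable_sample_freq n mA).1.
- exact: integrable_sample_freq.
- exact: cA.
Qed.

Lemma has_bootstrap_law_ray x : has_bootstrap_law `]-oo, x]%classic.
Proof.
split; first exact: measurable_itv.
- move=> i; have := hX.2 i x; have := hX.2 0%N x.
  by rewrite /cdf /distribution/= /pushforward => -> ->.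
- move=> n i B GB; have [_ /(_ i x) [_ _ h]] := hXs n.
  rewrite -h//; apply: eq_integral => w _; congr EFin.
  rewrite /sample_freq /empirical_cdf; congr (_ * _); apply: eq_bigr => j _.
  by rewrite indicE; congr (nat_of_bool _)%:R; apply/idP/idP; rewrite inE/= in_itv.
Qed.

Lemma has_bootstrap_law_setT : has_bootstrap_law [set: R].
Proof.
split=> // n i B GB.
rewrite (eq_integral (cst 1%E)) ?integral_cst ?mul1e//.
- by rewrite preimage_setT setTI.
- exact: G_measurable GB.
- move=> w _; rewrite /sample_freq; congr EFin.
  rewrite (eq_bigr (fun=> 1)) => [|j _]; last by rewrite indicE in_setT.
  rewrite big_const_ord iter_addr_0 mulVf// pnatr_eq0 -lt0n.
  exact: leq_ltn_trans (ltn_ord i).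
Qed.

Lemma has_bootstrap_law_setD A B : A `<=` B ->
  has_bootstrap_law A -> has_bootstrap_law B -> has_bootstrap_law (B `\` A).
Proof.
move=> AB [mA pA cA] [mB pB cB].
have PD (Y : {RV P >-> R}) D : measurable D ->
    P (Y @^-1` (B `\` A) `&` D) = (P (Y @^-1` B `&` D) - P (Y @^-1` A `&` D))%E.
  move=> mD; have mY C : measurable C -> measurable (Y @^-1` C).
    by move=> mC; exact: measurable_funPTI.
  have -> : Y @^-1` (B `\` A) `&` D = (Y @^-1` B `&` D) `\` (Y @^-1` A `&` D).
    apply/seteqP; split=> w /= [[? ?]] => [?|AD]; split=> //; first by case.
    by split=> // ?; apply: AD.
  rewrite measureD.
  - congr (_ - P _)%E; apply/seteqP; split=> w /= => [[]//|[? ?]].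
    by split=> //; split=> //; exact: AB.
  - by apply: measurableI => //; exact: mY.
  - by apply: measurableI => //; exact: mY.
  - by rewrite -ge0_fin_numE// fin_num_measure//; apply: measurableI => //; exact: mY.
split; first exact: measurableD.
- move=> i; have := PD (X i) setT measurableT; have := PD (X 0%N) setT measurableT.
  by rewrite !setIT pA pB => -> ->.
- move=> n i D GD; have mD := G_measurable GD.
  rewrite PD// -cA// -cB// -integralB_EFin//; last 2 first.
  + exact: integrable_sample_freq.
  + exact: integrable_sample_freq.
  apply: eq_integral => w _; rewrite -EFinB; congr EFin.
  rewrite /sample_freq -mulrBr -sumrB; congr (_ * _); apply: eq_bigr => j _.
  rewrite !indicE in_setD; have [|] := boolP (X j w \in A).
    by rewrite inE => /AB; rewrite -inE => ->; rewrite subrr.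
  by rewrite andbT subr0.
Qed.

Lemma has_bootstrap_law_itv x y : x <= y -> has_bootstrap_law `]x, y]%classic.
Proof.
move=> xy; have -> : `]x, y]%classic = `]-oo, y]%classic `\` `]-oo, x]%classic.
  apply/seteqP; split=> z; rewrite /= !in_itv/=.
    by move=> /andP[xz zy]; split=> //; apply/negP; rewrite -ltNge.
  by move=> [zy /negP]; rewrite -ltNge zy => ->.
apply: has_bootstrap_law_setD; [|exact: has_bootstrap_law_ray..].
by move=> z /=; rewrite !in_itv/= => /le_trans; apply.
Qed.

End conditional_law.

Section colour_law.
Context {R : realType} d (T : measurableType d) (P : probability T R) (F : R -> R)
  (X : nat -> {RV P >-> R}) (Xs : forall n : nat, 'I_n -> {RV P >-> R}).
Hypotheses (hX : iid_with_cdf X F) (hXs : bootstrap_samples X Xs).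
Context {C : finType} (tau : R -> C).
Hypothesis htau : forall c, has_bootstrap_law X Xs (tau @^-1` [set c]).

(** tau sorts observations into finitely many classes, called colours. *)
Definition colour_prob (c : C) : R := fine (P (X 0%N @^-1` (tau @^-1` [set c]))).

Let A c : set R := tau @^-1` [set c].

Let mA c : measurable (A c). Proof. exact: bootstrap_law_measurable (htau c). Qed.

Let mY (Y : {RV P >-> R}) c : measurable (Y @^-1` A c).
Proof. exact: measurable_funPTI. Qed.

Let PX i c : P (X i @^-1` A c) = (colour_prob c)%:E.
Proof.
by rewrite (bootstrap_law_sample (htau c)) -[LHS]fineK// fin_num_measure//; exact: mY.
Qed.

Lemma prob_vector_colour : prob_vector colour_prob.
Proof.
split=> [c|]; first exact: fine_ge0.
apply: EFin_inj; rewrite -sumEFin.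
under eq_bigr do rewrite -(PX 0%N).
rewrite -(@probability_bigcup_fin _ _ _ P _ (fun c => X 0%N @^-1` A c) xpredT)//.
- rewrite -[RHS](@probability_setT _ _ _ P); congr (P _).
  by apply/seteqP; split=> // x _; exists (tau (X 0%N x)).
- by move=> c c' _ _ [x [<- <-]].
Qed.

Let sample_colours n (e : n.-tuple C) : set T :=
  \bigcap_(i in [set: 'I_n]) (X i @^-1` A (tnth e i)).

Let P_sample_colours n (e : n.-tuple C) :
  P (sample_colours e) = (\prod_(c <- e) colour_prob c)%:E.
Proof.
have := hX.1 (iota 0 n) (fun j => A (nth (tau 0) e j)) (iota_uniq _ _) (fun j => mA _).
rewrite (_ : \bigcap_(j in _) _ = sample_colours e); last first.
  apply/seteqP; split=> x /= h.
    by move=> i _ /=; rewrite (tnth_nth (tau 0)); apply: h; rewrite /= mem_iota ltn_ord.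
  move=> j; rewrite /= mem_iota add0n => /= jn.
  by have := h (Ordinal jn) I; rewrite /= (tnth_nth (tau 0)).
move=> ->.
transitivity (\prod_(j <- iota 0 n) (colour_prob (nth (tau 0) e j))%:E)%E.
  by apply: eq_bigr => j _; exact: PX.
rewrite (big_morph EFin EFinM (erefl : 1%:E = 1%E)) (big_nth (tau 0)) size_tuple.
by rewrite /index_iota subn0.
Qed.

Let boot_colours n (w : n.-tuple C) : set T :=
  \bigcap_(i in [set: 'I_n]) (@Xs n i @^-1` A (tnth w i)).

(** On the event that the sample has colours e, the conditional probabilities of the colours of the
bootstrap variables are the constants freq n e. *)
Let P_joint_colours n (e w : n.-tuple C) : P (boot_colours w `&` sample_colours e) =
  ((\prod_(c <- e) colour_prob c) * \prod_(c <- w) freq n e c)%:E.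
Proof.
have mcol (Y : 'I_n -> {RV P >-> R}) (w' : n.-tuple C) :
    measurable (\bigcap_(i in [set: 'I_n]) (Y i @^-1` A (tnth w' i))).
  by apply: fin_bigcap_measurable => // i _; exact: mY.
have GB : g_sigma_preimage (fun i : 'I_n => X i : T -> R) (sample_colours e).
  apply: (@fin_bigcap_measurable _ (g_sigma_algebraType
    (\big[setU/set0]_(i < n) preimage_set_system setT (X i : T -> R) measurable))) => // i _.
  apply: sub_sigma_algebra; rewrite -bigcup_seq.
  exists i; first by rewrite /= mem_index_enum.
  by exists (A (tnth e i)) => //; rewrite setTI.
have [_ _ /(_ _ GB) <-] := (hXs n).1 (fun i => A (tnth w i))
  (fun i => sample_freq X n (A (tnth w i))) (fun i => mA _)
  (fun i => has_bootstrap_law_version (htau (tnth w i)) i).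
rewrite (eq_integral (cst (\prod_(c <- w) freq n e c)%:E)); last first.
  move=> x; rewrite inE => ex; congr EFin; rewrite [RHS]big_tuple.
  apply: eq_bigr => i _; rewrite /sample_freq /freq mulrC; congr (_ / _).
  rewrite -sum1_count big_tuple [in RHS]big_mkcond/= natr_sum; apply: eq_bigr => j _.
  have <- := ex j I; rewrite indicE.
  have -> : (X j x \in A (tnth w i)) = (tau (X j x) == tnth w i).
    by apply/idP/eqP; rewrite inE.
  by case: eqP.
rewrite integral_cst; last exact: mcol.
by rewrite muleC [RHS]EFinM; congr (_ * _)%E; exact: P_sample_colours.
Qed.

(** Events which depend on colours only have the probability computed in the two-stage finite model. *)
Lemma bootstrap_colour_law n (Q : pred (seq C)) :
  P [set x | Q [seq tau (@Xs n i x) | i <- enum 'I_n]] =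
  (boot_Ex colour_prob n (fun s => (Q s)%:R))%:E.
Proof.
pose J (ew : n.-tuple C * n.-tuple C) := boot_colours ew.2 `&` sample_colours ew.1.
have mJ ew : measurable (J ew).
  apply: measurableI; apply: fin_bigcap_measurable => // i _; exact: mY.
have tJ : trivIset setT J.
  move=> [e w] [e' w'] _ _ [x [[/= wx ex] [/= wx' ex']]]; congr pair.
    apply: eq_from_tnth => i; exact: etrans (esym (ex i I)) (ex' i I).
  apply: eq_from_tnth => i; exact: etrans (esym (wx i I)) (wx' i I).
have -> : [set x | Q [seq tau (@Xs n i x) | i <- enum 'I_n]] =
    \bigcup_(ew in [set ew : n.-tuple C * n.-tuple C | Q ew.2]) J ew.
  apply/seteqP; split=> [x Qx|x [[e w] /= Qw [wx _]]].
    exists ([tuple tau (X i x) | i < n], [tuple tau (@Xs n i x) | i < n]) => //.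
    by split=> i _ /=; rewrite tnth_mktuple.
  suff wE : w = [tuple tau (@Xs n i x) | i < n] by rewrite wE in Qw.
  by apply: eq_from_tnth => i; rewrite tnth_mktuple; exact/esym/(wx i I).
rewrite probability_bigcup_fin//.
under eq_bigr do rewrite P_joint_colours.
rewrite sumEFin /boot_Ex; congr EFin; rewrite iid_Ex_tuple.
under [RHS]eq_bigr do rewrite iid_Ex_tuple mulr_sumr.
rewrite pair_big/= big_mkcond/=; apply: eq_bigr => -[e w] _ /=.
by case: (Q w); rewrite ?mulr1 ?mulr0.
Qed.

End colour_law.

(** * Medians, median absolute deviations and empirical distribution functions *)

Section order_statistics.
Context {R : realType}.
Implicit Types (n k : nat) (x y : R).

Lemma nth_sorted_le (s : seq R) k x : sorted <=%R s -> (k < size s)%N ->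
  (nth 0 s k <= x) = (k < count (fun y => y <= x)%R s)%N.
Proof.
elim: s k => [//|a s IH] k /= ps ks.
have sorteds := path_sorted ps.
have allge : all (fun y => a <= y) s by apply: order_path_min ps; exact: le_trans.
have c0 : x < a -> count (fun y => y <= x) s = 0%N.
  move=> xa; apply/eqP; rewrite -leqn0 leqNgt -has_count; apply/negP => /hasP[y ys].
  by rewrite leNgt (lt_le_trans xa)//; exact: (allP allge).
case: k ks => [|k] ks /=.
  by case: (leP a x) => ax //; rewrite c0.
case: (leP a x) => ax /=; first by rewrite add1n ltnS; exact: IH.
by rewrite (IH k sorteds ks) c0.
Qed.

Definition count_le n (Y : 'I_n -> R) x : nat := (\sum_(i < n) (Y i <= x)%R)%N.

Lemma empirical_cdfE n (Y : 'I_n -> R) x : empirical_cdf Y x = (count_le Y x)%:R / n%:R.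
Proof. by rewrite /empirical_cdf mulrC /count_le natr_sum. Qed.

Lemma order_stat_le n (Y : 'I_n -> R) k x : (0 < k <= n)%N ->
  (order_stat Y k <= x) = (k <= count_le Y x)%N.
Proof.
move=> /andP[k0 kn]; rewrite /order_stat nth_sorted_le.
- rewrite prednK// count_sort count_map /count_le -sum1_count /= big_mkcond/= big_enum/=.
  by congr (_ <= _)%N; apply: eq_bigr => i _; case: ifP.
- by apply: sort_sorted; exact: le_total.
- by rewrite size_sort size_map size_enum_ord prednK.
Qed.

Let med_idx n : (0 < n)%N -> (0 < (n + 1) %/ 2 <= n)%N /\ (0 < (n + 2) %/ 2 <= n)%N.
Proof. by move=> n0; split; lia. Qed.

(** The strict inequality makes both middle order statistics at most x, whatever the parity of n; the
same holds for [sample_median_gt]. *)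
Lemma sample_median_le n (Y : 'I_n -> R) x : (0 < n)%N -> 2^-1 < empirical_cdf Y x ->
  sample_median Y <= x.
Proof.
move=> n0; rewrite empirical_cdfE ltr_pdivlMr ?ltr0n// mulrC ltr_pdivrMr// -natrM ltr_nat => h.
have [k1 k2] := med_idx n0.
have o1 : order_stat Y ((n + 1) %/ 2)%N <= x by rewrite order_stat_le//; lia.
have o2 : order_stat Y ((n + 2) %/ 2)%N <= x by rewrite order_stat_le//; lia.
by rewrite /sample_median; lra.
Qed.

Lemma sample_median_gt n (Y : 'I_n -> R) x : (0 < n)%N -> empirical_cdf Y x < 2^-1 ->
  x < sample_median Y.
Proof.
move=> n0; rewrite empirical_cdfE ltr_pdivrMr ?ltr0n// mulrC ltr_pdivlMr// -natrM ltr_nat => h.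
have [k1 k2] := med_idx n0.
have o1 : x < order_stat Y ((n + 1) %/ 2)%N by rewrite ltNge order_stat_le// -ltnNge; lia.
have o2 : x < order_stat Y ((n + 2) %/ 2)%N by rewrite ltNge order_stat_le// -ltnNge; lia.
by rewrite /sample_median; lra.
Qed.

(** Stated for an arbitrary sample Z, to be used with the absolute deviations from the median. *)
Let emp_le n (Y Z : 'I_n -> R) x a b : (forall i, (Y i <= a) -> (Z i <= x) || (Y i <= b)) ->
  empirical_cdf Y a <= empirical_cdf Z x + empirical_cdf Y b.
Proof.
move=> h; rewrite /empirical_cdf -mulrDr -big_split/= ler_wpM2l ?invr_ge0//.
apply: ler_sum => i _; have := h i; case: (Y i <= a) => [/(_ isT)|_] /=.
  by case: (Z i <= x); case: (Y i <= b) => //= _; rewrite ?addr0 ?add0r// ler_wpDr.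
by rewrite addr_ge0.
Qed.

Let emp_ge n (Y Z : 'I_n -> R) x a b : b <= a -> (forall i, (Z i <= x) -> (Y i <= a) && (b < Y i)) ->
  empirical_cdf Z x + empirical_cdf Y b <= empirical_cdf Y a.
Proof.
move=> ba h; rewrite /empirical_cdf -mulrDr -big_split/= ler_wpM2l ?invr_ge0//.
apply: ler_sum => i _; have := h i; case: (Z i <= x) => [/(_ isT)/andP[-> bY]|_] /=.
  by rewrite [Y i <= b]leNgt bY addr0.
rewrite add0r; have [Yb|_] := leP (Y i) b; last by [].
by rewrite (le_trans Yb ba).
Qed.

(** If the median lies in [m1, m2], the interval ]m2 - y, m1 + y] is within distance y of it; in
[sample_mad_gt] the interval ]m1 - y, m2 + y] contains all points within distance y of it. *)
Lemma sample_mad_le n (Y : 'I_n -> R) (m1 m2 y : R) : (0 < n)%N ->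
  m1 <= sample_median Y -> sample_median Y <= m2 ->
  2^-1 < empirical_cdf Y (m1 + y) - empirical_cdf Y (m2 - y) -> sample_mad Y <= y.
Proof.
move=> n0 h1 h2 h; apply: sample_median_le => //; apply: (lt_le_trans h).
rewrite lerBlDr; apply: emp_le => i Yi; rewrite ler_norml.
by case: (leP (Y i) (m2 - y)) => h3; rewrite ?orbT// orbF; apply/andP; split; lra.
Qed.

Lemma sample_mad_gt n (Y : 'I_n -> R) (m1 m2 y : R) : (0 < n)%N ->
  m1 < sample_median Y -> sample_median Y <= m2 -> m1 - y <= m2 + y ->
  empirical_cdf Y (m2 + y) - empirical_cdf Y (m1 - y) < 2^-1 -> y < sample_mad Y.
Proof.
move=> n0 h1 h2 h3 h; apply: sample_median_gt => //; apply: (le_lt_trans _ h).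
rewrite lerBrDr; apply: emp_ge => // i; rewrite ler_norml => /andP[a b].
by apply/andP; split; lra.
Qed.

Section measurability.
Context d (T : measurableType d).

Let measurable_indic_ray (a : R) : measurable_fun setT (\1_(`]-oo, a]%classic) : R -> R).
Proof. by apply: measurable_indic; exact: measurable_itv. Qed.

Lemma measurable_order_stat n (Y : 'I_n -> T -> R) k :
  (forall i, measurable_fun setT (Y i)) ->
  measurable_fun setT (fun w => order_stat (fun i => Y i w) k).
Proof.
move=> mY; have [kn|nk] := ltnP k.-1 n; last first.
  rewrite (_ : (fun w => _) = cst 0); first exact: measurable_cst.
  by apply/funext => w; rewrite /order_stat nth_default// size_sort size_map size_enum_ord.
apply: (measurability _ (RGenOInfty.measurableE R)) => _ [_ [a ->] <-].
pose c w : R := \sum_(i < n) \1_(`]-oo, a]%classic) (Y i w).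
have mc : measurable_fun setT c.
  apply: measurable_sum => i; apply: measurableT_comp; last exact: mY.
  exact: measurable_indic_ray.
rewrite (_ : _ `&` _ = setT `&` c @^-1` `]-oo, k.-1.+1%:R[%classic).
  exact: (mc measurableT _ (measurable_itv `]-oo, k.-1.+1%:R[)).
have E w : (a < order_stat (fun i => Y i w) k) = (c w < k.-1.+1%:R).
  have := @order_stat_le n (fun i => Y i w) k.-1.+1 a kn.
  rewrite ltNge /order_stat => ->; rewrite -ltnNge -(ltr_nat R) /count_le natr_sum.
  congr (_ < _); apply: eq_bigr => i _; rewrite indicE.
  by congr (nat_of_bool _)%:R; apply/idP/idP; rewrite inE/= in_itv.
by rewrite !setTI; apply/seteqP; split=> w; rewrite /= !in_itv/= andbT E.
Qed.

Lemma measurable_sample_median n (Y : 'I_n -> T -> R) :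
  (forall i, measurable_fun setT (Y i)) ->
  measurable_fun setT (fun w => sample_median (fun i => Y i w)).
Proof.
move=> mY; apply: measurable_funM => //; apply: measurable_funD; exact: measurable_order_stat.
Qed.

Lemma measurable_sample_mad n (Y : 'I_n -> T -> R) :
  (forall i, measurable_fun setT (Y i)) ->
  measurable_fun setT (fun w => sample_mad (fun i => Y i w)).
Proof.
move=> mY; apply: (measurable_sample_median
  (Y := fun i w => `|Y i w - sample_median (fun i => Y i w)|)) => i.
apply: measurableT_comp => //; apply: measurable_funB => //.
exact: measurable_sample_median.
Qed.

Lemma measurable_empirical_cdf n (Y : 'I_n -> T -> R) x :
  (forall i, measurable_fun setT (Y i)) ->
  measurable_fun setT (fun w => empirical_cdf (fun i => Y i w) x).
Proof.
move=> mY; rewrite (_ : (fun w => _) = fun w => n%:R^-1 * \sum_(i < n) \1_(`]-oo, x]%classic) (Y i w)).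
  apply: measurable_funM => //; apply: measurable_sum => i; apply: measurableT_comp; last exact: mY.
  exact: measurable_indic_ray.
apply/funext => w; congr (_ * _); apply: eq_bigr => i _; rewrite indicE.
by congr (nat_of_bool _)%:R; apply/idP/idP; rewrite inE/= in_itv.
Qed.

End measurability.

End order_statistics.

(** * Quantiles and distribution functions *)

Section quantile_theory.
Context {R : realType}.
Implicit Types (H : R -> R) (p x y e : R).

Lemma continuous_at_ball H x e : {for x, continuous H} -> 0 < e ->
  exists2 del : R, 0 < del & forall y, `|x - y| < del -> `|H x - H y| < e.
Proof.
move=> /cvgrPdist_lt cH e0; have /nbhs_ballP[del /= d0 h] := cH e e0.
by exists del => // y xy; exact: h.
Qed.

Lemma near_ball (A : set R) x : (\forall y \near x, A y) ->
  exists2 del : R, 0 < del & forall y, `|x - y| < del -> A y.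
Proof. by move=> /nbhs_ballP[del /= d0 h]; exists del => // y xy; exact: h. Qed.

Lemma quantile_ge H p y : {homo H : a b / a <= b} -> (exists x, p <= H x) ->
  H y < p -> y <= quantile H p.
Proof.
move=> ndH ex Hy; apply: lb_le_inf => // x /= px.
by rewrite leNgt; apply/negP => /ltW /ndH; rewrite leNgt (lt_le_trans Hy).
Qed.

Lemma quantile_le H p x y : {homo H : a b / a <= b} -> H y < p ->
  p <= H x -> quantile H p <= x.
Proof.
move=> ndH Hy px; apply: ge_inf => //; exists y => z /= pz.
by rewrite leNgt; apply/negP => /ltW /ndH; rewrite leNgt (lt_le_trans Hy).
Qed.

(** Monotonicity puts H below p to the left of the quantile and at least p to its right; continuity
closes the gap. *)
Lemma quantileK H p : {homo H : a b / a <= b} -> (exists x, p <= H x) ->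
  (exists y, H y < p) -> {for quantile H p, continuous H} -> H (quantile H p) = p.
Proof.
move=> ndH ex [y Hy] cH; set q := quantile H p in cH *.
apply/eqP; rewrite eq_le; apply/andP; split; rewrite leNgt; apply/negP => Hq.
  have [|del d0 h] := continuous_at_ball cH (_ : 0 < H q - p); first by rewrite subr_gt0.
  have := h (q - del / 2); rewrite opprB addrCA subrr addr0 gtr0_norm ?divr_gt0//.
  rewrite ltr_pdivrMr// ltr_pMr// ltr1n => /(_ isT); rewrite ltr_norml => /andP[_ h2].
  have : q <= q - del / 2 by apply: (quantile_le ndH Hy); lra.
  have : 0 < del / 2 by rewrite divr_gt0.
  by lra.
have [|del d0 h] := continuous_at_ball cH (_ : 0 < p - H q); first by rewrite subr_gt0.
have := h (q + del / 2); rewrite opprD addrA subrr sub0r normrN gtr0_norm ?divr_gt0//.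
rewrite ltr_pdivrMr// ltr_pMr// ltr1n => /(_ isT); rewrite ltr_norml => /andP[h2 _].
have : q + del / 2 <= q by apply: (quantile_ge ndH ex); lra.
have : 0 < del / 2 by rewrite divr_gt0.
by lra.
Qed.

End quantile_theory.

Section cdf_theory.
Context {R : realType} d (T : measurableType d) (P : probability T R)
  (F : R -> R) (Y : {RV P >-> R}).
Hypothesis cdfY : forall x, cdf Y x = (F x)%:E.
Implicit Types (a b x y : R).

Lemma probability_ray x : P (Y @^-1` `]-oo, x]%classic) = (F x)%:E.
Proof. exact: cdfY. Qed.

Lemma cdf_homo : {homo F : a b / a <= b}.
Proof. by move=> a b ab; rewrite -lee_fin -!cdfY; exact: cdf_nondecreasing. Qed.

Lemma cdf_ge0r x : 0 <= F x.
Proof. by rewrite -lee_fin -cdfY cdf_ge0. Qed.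

Let mY (A : set R) : measurable A -> measurable (Y @^-1` A).
Proof. by move=> mA; exact: measurable_funPTI. Qed.

Lemma probability_itv a b : a <= b -> P (Y @^-1` `]a, b]%classic) = (F b - F a)%:E.
Proof.
move=> ab; rewrite EFinB -!probability_ray.
have -> : Y @^-1` `]a, b]%classic = Y @^-1` `]-oo, b]%classic `\` Y @^-1` `]-oo, a]%classic.
  apply/seteqP; split=> w; rewrite /= !in_itv/=.
    by move=> /andP[aY ->]; split=> //; rewrite leNgt aY.
  by move=> [-> /negP]; rewrite -ltNge => ->.
rewrite measureD.
- congr (_ - P _)%E; apply/seteqP; split=> w; rewrite /= !in_itv/=; first by case.
  by move=> Ya; split=> //; exact: le_trans ab.
- by apply: mY; exact: measurable_itv.
- by apply: mY; exact: measurable_itv.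
- by rewrite -ge0_fin_numE// fin_num_measure//; apply: mY; exact: measurable_itv.
Qed.

Lemma cdf_ge_ex p : p < 1 -> exists x, p <= F x.
Proof.
move=> p1; have := cvg_cdfy1 Y; rewrite (_ : cdf Y = EFin \o F); last by apply/funext.
move=> /fine_cvgP[_] /cvgrPdist_lt /(_ (1 - p)); rewrite subr_gt0 => /(_ p1) h.
have [x /=] := filter_ex h; rewrite ltr_norml => /andP[_ h2]; exists x.
by have := h2; rewrite /=; lra.
Qed.

Lemma cdf_lt_ex p : 0 < p -> exists x, F x < p.
Proof.
move=> p0; have := cvg_cdfNy0 Y; rewrite (_ : cdf Y = EFin \o F); last by apply/funext.
move=> /fine_cvgP[_] /cvgrPdist_lt /(_ p p0) h.
have [x /=] := filter_ex h; rewrite sub0r normrN => h2; exists x.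
exact: le_lt_trans (ler_norm _) h2.
Qed.

Variable v : R.

Definition absdev_cdf y : R := fine (P [set w | `|Y w - v| <= y]).

Let absdev_set y : [set w | `|Y w - v| <= y] = Y @^-1` `[v - y, v + y]%classic.
Proof.
by apply/seteqP; split=> w; rewrite /= in_itv/= ler_norml => /andP[a b]; apply/andP; split; lra.
Qed.

Let mabsdev y : measurable [set w | `|Y w - v| <= y].
Proof. by rewrite absdev_set; apply: mY; exact: measurable_itv. Qed.

Lemma absdev_cdf_homo : {homo absdev_cdf : a b / a <= b}.
Proof.
move=> a b ab; apply: fine_le; rewrite ?fin_num_measure//.
by apply: le_measure; rewrite ?inE// => w /= /le_trans; apply.
Qed.

Lemma absdev_cdf_lt0 y : y < 0 -> absdev_cdf y = 0.
Proof.
move=> y0; rewrite /absdev_cdf (_ : [set w | _] = set0) ?measure0//.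
by apply/seteqP; split=> // w /=; rewrite leNgt (lt_le_trans y0).
Qed.

(** The closed interval [v - y, v + y] lies between ]v - y, v + y] and ]v - y - e, v + y]. *)
Lemma absdev_cdf_bounds y e : 0 <= y -> 0 < e ->
  F (v + y) - F (v - y) <= absdev_cdf y <= F (v + y) - F (v - y - e).
Proof.
move=> y0 e0; rewrite /absdev_cdf absdev_set -!lee_fin fineK ?fin_num_measure//; last first.
  by apply: mY; exact: measurable_itv.
rewrite -!probability_itv; [|lra..]; apply/andP; split.
all: apply: le_measure; rewrite ?inE; try by apply: mY; exact: measurable_itv.
all: by move=> w; rewrite /= !in_itv/= => /andP[h1 h2]; apply/andP; split; lra.
Qed.

Lemma absdev_cdfE y : 0 <= y -> {for v - y, continuous F} ->
  absdev_cdf y = F (v + y) - F (v - y).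
Proof.
move=> y0 cF; have := absdev_cdf_bounds y0; set a := absdev_cdf y => h.
apply/eqP; rewrite eq_le; apply/andP; split; last first.
  by have /andP[] := h 1 ltr01.
rewrite leNgt; apply/negP => lt.
have [|del d0 hd] := continuous_at_ball cF (_ : 0 < a - (F (v + y) - F (v - y))).
  by rewrite subr_gt0.
have d20 : 0 < del / 2 by rewrite divr_gt0.
have := hd (v - y - del / 2); rewrite opprB addrCA subrr addr0 gtr0_norm//.
rewrite ltr_pdivrMr// ltr_pMr// ltr1n => /(_ isT); rewrite ltr_norml => /andP[_ h2].
by have /andP[_] := h _ d20; lra.
Qed.

Lemma absdev_cdf_ge_ex p : p < 1 -> exists x, p <= absdev_cdf x.
Proof.
move=> p1; pose q : R := (1 - p) / 3; have q0 : 0 < q by rewrite divr_gt0// subr_gt0.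
have q1 : 1 - q < 1 by rewrite gtrBl.
have [x1 h1] := cdf_ge_ex q1.
have [x2 h2] := cdf_lt_ex q0.
exists (`|x1 - v| + `|x2 - v|); set y := _ + _.
have y0 : 0 <= y by rewrite addr_ge0.
have /andP[h _] := absdev_cdf_bounds y0 ltr01.
have a1 : F x1 <= F (v + y).
  by apply: cdf_homo; have := ler_norm (x1 - v); have := normr_ge0 (x2 - v); rewrite /y; lra.
have a2 : F (v - y) <= F x2.
  apply: cdf_homo; have := ler_norm (- (x2 - v)); rewrite normrN.
  by have := normr_ge0 (x1 - v); rewrite /y; lra.
have : p = 1 - 3 * q by rewrite /q; field.
by lra.
Qed.

Lemma absdev_quantile_gt0 p : 0 < p -> p < 1 -> {for v, continuous F} ->
  0 < quantile absdev_cdf p.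
Proof.
move=> p0 p1 cF; have p20 : 0 < p / 2 by rewrite divr_gt0.
have [del d0 h] := continuous_at_ball cF p20.
have d40 : 0 < del / 4 by rewrite divr_gt0.
apply: (lt_le_trans d40); apply: quantile_ge.
- exact: absdev_cdf_homo.
- exact: absdev_cdf_ge_ex.
have /andP[_ hu] := absdev_cdf_bounds (ltW d40) d40.
apply: (le_lt_trans hu).
have := h (v + del / 4); have := h (v - del / 4 - del / 4).
rewrite !ltr_norml => h1 h2.
have /andP[a1 a2] := h1 ltac:(apply/andP; split; lra).
have /andP[a3 a4] := h2 ltac:(apply/andP; split; lra).
by lra.
Qed.

End cdf_theory.

(** * Linear approximations of the median and the median absolute deviation *)

Section linearization.
Context {R : realType} (n : nat) (Y : 'I_n -> R) (r v xi f fp fm : R).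
Hypotheses (n0 : (0 < n)%N) (r0 : 0 < r) (f0 : 0 < f) (g0 : 0 < fm + fp).
Local Notation H := (empirical_cdf Y).

(** The error of the first-order expansion of the empirical distribution function, on the scale r and
with slope f'. *)
Definition increment_rem (x s f' : R) : R := (H (x + s * r) - H x) / r - s * f'.

(** The solution s of H v + s r f = 1/2. *)
Definition lin_median : R := - ((H v - 2^-1) / r) / f.

(** The solution t of H (v + xi) - H (v - xi) + r ((s + t) fp - (s - t) fm) = 1/2, for s the
linear approximation of the median. *)
Definition lin_mad : R :=
  (- ((H (v + xi) - H (v - xi) - 2^-1) / r) + (fm - fp) * lin_median) / (fm + fp).

Let M1 : R := (sample_median Y - v) / r.
Let M2 : R := (sample_mad Y - xi) / r.

Lemma lin_median_le (s e : R) : `|increment_rem v s f| <= e -> M1 <= s -> lin_median <= s + e / f.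
Proof.
rewrite /increment_rem ler_norml => /andP[h1 h2]; rewrite /M1 ler_pdivrMr// lerBlDl => m.
have Hs : 2^-1 <= H (v + s * r).
  by rewrite leNgt; apply/negP => /(sample_median_gt n0); rewrite ltNge m.
have : 0 <= (H (v + s * r) - 2^-1) / r by rewrite divr_ge0 ?subr_ge0// ltW.
have e1 : e / f * f = e by rewrite divfK// gt_eqF.
rewrite /lin_median => h3; rewrite ler_pdivrMr// (mulrDl s) e1; rewrite !mulrBl in h2 h3 *; lra.
Qed.

Lemma lin_median_ge (s e : R) : `|increment_rem v s f| <= e -> s < M1 -> s - e / f <= lin_median.
Proof.
rewrite /increment_rem ler_norml => /andP[h1 h2]; rewrite /M1 ltr_pdivlMr// ltrBrDl => m.
have Hs : H (v + s * r) <= 2^-1.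
  by rewrite leNgt; apply/negP => /(sample_median_le n0); rewrite leNgt m.
have : (H (v + s * r) - 2^-1) / r <= 0 by rewrite mulr_le0_ge0 ?subr_le0// invr_ge0 ltW.
have e1 : e / f * f = e by rewrite divfK// gt_eqF.
rewrite /lin_median => h3; rewrite ler_pdivlMr// (mulrBl f s) e1; rewrite !mulrBl in h1 h3 *; lra.
Qed.

Let lin_madE : (fm + fp) * lin_mad =
  - ((H (v + xi) - H (v - xi) - 2^-1) / r) + (fm - fp) * lin_median.
Proof. by rewrite /lin_mad mulrC divfK// gt_eqF. Qed.

Let bd (a b q : R) : `|b| <= q -> a * b <= `|a| * q.
Proof. by move=> bq; rewrite (le_trans (ler_norm _))// normrM ler_wpM2l. Qed.

(** The median is known to lie between s1 and s2 on the scale r, which costs the term (s2 - s1) fp, and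
its linear approximation to lie within q of s1; [lin_mad_ge] is the reverse comparison. *)
Lemma lin_mad_le (s1 s2 t e q : R) : s1 < M1 -> M1 <= s2 -> 0 <= xi + t * r ->
  `|lin_median - s1| <= q ->
  `|increment_rem (v + xi) (s2 + t) fp| <= e -> `|increment_rem (v - xi) (s1 - t) fm| <= e ->
  M2 <= t ->
  (fm + fp) * lin_mad <= (fm + fp) * t + `|fm - fp| * q + (s2 - s1) * fp + 2 * e.
Proof.
rewrite /M1 ltr_pdivlMr// ltrBrDl ler_pdivrMr// lerBlDl => h1 h2 h3 hq.
rewrite /increment_rem !ler_norml => /andP[_ a2] /andP[a3 _].
rewrite /M2 ler_pdivrMr// lerBlDl => m.
have s12 : s1 * r <= s2 * r by lra.
have E : 2^-1 <= H (v + s2 * r + (xi + t * r)) - H (v + s1 * r - (xi + t * r)).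
  rewrite leNgt; apply/negP => E; have : xi + t * r < sample_mad Y.
    by apply: (sample_mad_gt n0 h1 h2 _ E); lra.
  by rewrite ltNge m.
rewrite (_ : v + s2 * r + (xi + t * r) = v + xi + (s2 + t) * r) in E; last by ring.
rewrite (_ : v + s1 * r - (xi + t * r) = v - xi + (s1 - t) * r) in E; last by ring.
have E' : 0 <= (H (v + xi + (s2 + t) * r) - H (v - xi + (s1 - t) * r) - 2^-1) / r.
  by rewrite divr_ge0 ?subr_ge0// ltW.
have b1 := bd (fm - fp) hq; rewrite lin_madE mulrBr in b1 *; rewrite !mulrBl in a2 a3 b1 E' *; lra.
Qed.

Lemma lin_mad_ge (s1 s2 t e q : R) : s1 < M1 -> M1 <= s2 -> 0 <= xi + t * r ->
  `|lin_median - s1| <= q ->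
  `|increment_rem (v + xi) (s1 + t) fp| <= e -> `|increment_rem (v - xi) (s2 - t) fm| <= e ->
  t < M2 ->
  (fm + fp) * t - `|fm - fp| * q - (s2 - s1) * fm - 2 * e <= (fm + fp) * lin_mad.
Proof.
rewrite /M1 ltr_pdivlMr// ltrBrDl ler_pdivrMr// lerBlDl => h1 h2 h3 hq.
rewrite /increment_rem !ler_norml => /andP[a1 _] /andP[_ a4].
rewrite /M2 ltr_pdivlMr// ltrBrDl => m.
have E : H (v + s1 * r + (xi + t * r)) - H (v + s2 * r - (xi + t * r)) <= 2^-1.
  rewrite leNgt; apply/negP => E; have : sample_mad Y <= xi + t * r.
    exact: (sample_mad_le n0 (ltW h1) h2 E).
  by rewrite leNgt m.
rewrite (_ : v + s1 * r + (xi + t * r) = v + xi + (s1 + t) * r) in E; last by ring.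
rewrite (_ : v + s2 * r - (xi + t * r) = v - xi + (s2 - t) * r) in E; last by ring.
have E' : (H (v + xi + (s1 + t) * r) - H (v - xi + (s2 - t) * r) - 2^-1) / r <= 0.
  by rewrite mulr_le0_ge0 ?subr_le0// invr_ge0 ltW.
have b1 := bd (- (fm - fp)) hq; rewrite normrN mulNr mulrBr in b1; rewrite lin_madE; rewrite !mulrBl in a1 a4 b1 E' *; lra.
Qed.

End linearization.

(** * Sequences of events of vanishing probability *)

Section asymptotically_negligible.
Context {R : realType} d (T : measurableType d) (P : probability T R).
Implicit Types E : nat -> set T.

(** Outer probability tending to 0, so that the events at hand need not be shown measurable. *)
Definition negligible_seq E := forall eta : R, 0 < eta -> \forall n \near \oo,
  exists B, [/\ measurable B, E n `<=` B & (P B <= eta%:E)%E].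

Lemma negligible_seqS E E' : (\forall n \near \oo, E n `<=` E' n) ->
  negligible_seq E' -> negligible_seq E.
Proof.
move=> EE' nE' eta e0; apply: filterS2 EE' (nE' _ e0) => n EE' [B [mB E'B PB]].
by exists B; split=> //; exact: subset_trans E'B.
Qed.

Lemma negligible_seqU E E' : negligible_seq E -> negligible_seq E' ->
  negligible_seq (fun n => E n `|` E' n).
Proof.
move=> nE nE' eta e0; have e20 : 0 < eta / 2 by rewrite divr_gt0.
apply: filterS2 (nE _ e20) (nE' _ e20) => n [B [mB EB PB]] [B' [mB' EB' PB']].
exists (B `|` B'); split; [exact: measurableU|exact: setUSS|].
rewrite (le_trans (measureU2 _ mB mB'))// (le_trans (leeD PB PB'))// -EFinD lee_fin.
by rewrite -splitr.
Qed.

Lemma negligible_seq_has (I : eqType) (s : seq I) (E : I -> nat -> set T) :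
  (forall i, i \in s -> negligible_seq (E i)) ->
  negligible_seq (fun n => [set w | exists2 i, i \in s & E i n w]).
Proof.
elim: s => [|i s IH] nE.
  move=> eta e0; apply: nearW => n; exists set0; split => //.
    by move=> w [].
  by rewrite measure0 lee_fin ltW.
have := negligible_seqU (nE i (mem_head _ _)) (IH (fun j js => nE j (@mem_behead _ (i :: s) j js))).
apply: negligible_seqS; apply: nearW => n w [j].
by rewrite inE => /orP[/eqP ->|js Ej]; [left|right; exists j].
Qed.

(** It is enough to treat E off an event of arbitrarily small probability, which may depend on the target
accuracy. *)
Lemma negligible_seq_tight E : (forall eta : R, 0 < eta -> exists (K : nat -> set T) E',
    [/\ forall n, measurable (K n), \forall n \near \oo, (P (K n) <= eta%:E)%E,
     negligible_seq E' & \forall n \near \oo, E n `<=` K n `|` E' n]) ->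
  negligible_seq E.
Proof.
move=> h eta e0; have e20 : 0 < eta / 2 by rewrite divr_gt0.
have [K [E' [mK PK nE' EK]]] := h _ e20.
apply: filterS3 PK EK (nE' _ e20) => n PK EK [B [mB EB PB]].
exists (K n `|` B); split; first exact: measurableU.
  by apply: subset_trans EK _; exact: setUS.
rewrite (le_trans (measureU2 _ (mK n) mB))//.
by rewrite (le_trans (leeD PK PB))// -EFinD lee_fin -splitr.
Qed.

End asymptotically_negligible.

(** * Increments of the bootstrap empirical distribution function *)

Section chebyshev.
Context {R : realType} d (T : measurableType d) (P : probability T R) (F : R -> R)
  (X : nat -> {RV P >-> R}) (Xs : forall n : nat, 'I_n -> {RV P >-> R}).
Hypotheses (hX : iid_with_cdf X F) (hXs : bootstrap_samples X Xs).

(** Chebyshev's inequality for the centred indicator of A, coloured by membership; p (1 - p) is bounded by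
p so that small sets have small deviations. *)
Lemma bootstrap_chebyshev (A : set R) (n : nat) (r eps : R) : has_bootstrap_law X Xs A ->
  (0 < n)%N -> 0 < r -> r ^+ 2 * n%:R = 1 -> 0 < eps ->
  (P [set w | (eps <= `|n%:R^-1 * (\sum_(i < n) \1_A (@Xs n i w)) - fine (P (X 0%N @^-1` A))| / r)%R]
   <= (2 * fine (P (X 0%N @^-1` A)) / eps ^+ 2)%:E)%E.
Proof.
move=> gA n0 r0 rn e0; set p := fine _.
pose tau (x : R) : bool := x \in A.
have tauT : tau @^-1` [set true] = A.
  by apply/seteqP; split=> x /=; rewrite /tau; [move/set_mem|move/mem_set].
have tauF : tau @^-1` [set false] = [set: R] `\` A.
  rewrite setTD; apply/seteqP; split=> x /=; rewrite /tau; first by move/negbT; rewrite notin_setE.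
  by move=> nA; apply/negbTE; rewrite notin_setE.
have htau c : has_bootstrap_law X Xs (tau @^-1` [set c]).
  case: c; rewrite ?tauT ?tauF//.
  by apply: has_bootstrap_law_setD => //; exact: has_bootstrap_law_setT.
pose q := @colour_prob _ _ _ P X _ tau.
have qv : prob_vector q := prob_vector_colour htau.
have qT : q true = p by rewrite /q /colour_prob tauT.
have qF : q false = 1 - p by rewrite -qv.2 big_bool/= qT addrC addrK.
pose g (c : bool) : R := c%:R - p.
have gT : g true = 1 - p by [].
have gF : g false = - p by rewrite /g sub0r.
have qg : \sum_c q c * g c = 0 by rewrite big_bool/= qT qF gT gF; ring.
pose Q (s : seq bool) := eps <= `|\sum_(c <- s) g c| * r.
rewrite (_ : [set w | _] = [set x | Q [seq tau (@Xs n i x) | i <- enum 'I_n]]); last first.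
  apply/seteqP; suff h w : `|n%:R^-1 * (\sum_(i < n) \1_A (@Xs n i w)) - p| / r =
    `|\sum_(c <- [seq tau (@Xs n i w) | i <- enum 'I_n]) g c| * r.
    by split=> w /=; rewrite /Q h.
  rewrite big_map big_enum /= /g sumrB sumr_const card_ord.
  have -> : \sum_(i < n) (tau (@Xs n i w))%:R - p *+ n =
      n%:R * (n%:R^-1 * (\sum_(i < n) \1_A (@Xs n i w)) - p) :> R.
    rewrite mulrBr mulrA divff ?pnatr_eq0 -?lt0n// mul1r [n%:R * p]mulr_natl; congr (_ - _).
  rewrite normrM normr_nat mulrAC [RHS]mulrC; congr (_ * _).
  by apply: (mulIf (lt0r_neq0 r0)); rewrite mulVf ?gt_eqF// -mulrA -expr2 mulrC rn.
rewrite (bootstrap_colour_law hX hXs htau) lee_fin -/q.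
have e20 : 0 < eps ^+ 2 by rewrite exprn_gt0.
have qfreq e : size e = n -> prob_vector (freq n e : bool -> R).
  exact: prob_vector_freq.
apply: (@le_trans _ _ (r ^+ 2 / eps ^+ 2 * boot_Ex q n (fun s => (\sum_(c <- s) g c) ^+ 2))).
  rewrite /boot_Ex -iid_ExZ; apply: iid_Ex_le => // e en; rewrite -iid_ExZ; apply: iid_Ex_le => [|s _].
    exact: qfreq.
  case: (boolP (Q s)) => [|_]; last by rewrite mulr_ge0// ?sqr_ge0// divr_ge0 ?sqr_ge0.
  rewrite /Q => h; rewrite mulrAC ler_pdivlMr// mul1r -exprMn.
  rewrite -(real_normK (num_real (r * _))) normrM (gtr0_norm r0) (mulrC r).
  by rewrite lerXn2r// nnegrE (le_trans (ltW e0)).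
rewrite (le_trans (ler_wpM2l _ (boot_Ex_sqr_sum_le n0 qv qg)))//.
  by rewrite divr_ge0 ?sqr_ge0.
rewrite big_bool/= qT qF gT gF.
have -> : r ^+ 2 / eps ^+ 2 * (2 * n%:R * (p * (1 - p) ^+ 2 + (1 - p) * (- p) ^+ 2)) =
  (r ^+ 2 * n%:R) * (2 * (p * (1 - p))) / eps ^+ 2 by ring.
rewrite rn mul1r ler_pM2r ?invr_gt0// ler_pM2l//.
rewrite ler_piMr ?gerBl//; have := qv.1 true; by rewrite qT.
Qed.

Definition bootstrap_cdf n (w : T) : R -> R := empirical_cdf (fun i => @Xs n i w).
Local Notation H := bootstrap_cdf.

Lemma chebyshev_increment (x y : R) (n : nat) (r eps : R) :
  (0 < n)%N -> 0 < r -> r ^+ 2 * n%:R = 1 -> 0 < eps ->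
  (P [set w | (eps <= `|(H n w y - H n w x) - (F y - F x)| / r)%R]
   <= (2 * `|F y - F x| / eps ^+ 2)%:E)%E.
Proof.
move=> n0 r0 rn e0.
wlog xy : x y / x <= y.
  move=> h; have [xy|/ltW yx] := leP x y; first exact: h.
  rewrite distrC; rewrite (_ : [set w | _] = [set w | eps <= `|(H n w x - H n w y) - (F x - F y)| / r]); first exact: h.
  apply/seteqP; split=> w /=; rewrite (_ : H n w y - H n w x - _ = - (H n w x - H n w y - (F x - F y))) ?normrN//; ring.
have cdfX z : cdf (X 0%N) z = (F z)%:E by exact: hX.2.
have -> : `|F y - F x| = fine (P (X 0%N @^-1` `]x, y]%classic)).
  rewrite (probability_itv cdfX xy)/= ger0_norm// subr_ge0; exact: (cdf_homo cdfX).
have gA := has_bootstrap_law_itv hX hXs xy.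
apply: le_trans (bootstrap_chebyshev gA n0 r0 rn e0).
suff h w : H n w y - H n w x = n%:R^-1 * (\sum_(i < n) \1_(`]x, y]%classic) (@Xs n i w)).
  rewrite le_eqVlt; apply/orP; left; apply/eqP; congr (P _).
  by apply/seteqP; split=> w /=; rewrite h (probability_itv cdfX xy).
rewrite /bootstrap_cdf /empirical_cdf -mulrBr -sumrB; congr (_ * _); apply: eq_bigr => i _.
rewrite indicE mem_setE in_itv/=; case: (leP (@Xs n i w) x) => h /=.
  by rewrite (le_trans h xy) subrr.
by rewrite subr0.
Qed.

End chebyshev.

Section step.
Context {R : realType}.

(** The scale 1 / sqrt n of the fluctuations. *)
Definition step (n : nat) : R := (Num.sqrt n%:R)^-1.

Lemma step_gt0 n : (0 < n)%N -> 0 < step n.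
Proof. by move=> n0; rewrite invr_gt0 sqrtr_gt0 ltr0n. Qed.

Lemma sqr_step n : (0 < n)%N -> step n ^+ 2 * n%:R = 1.
Proof. by move=> n0; rewrite exprVn sqr_sqrtr// mulVf// pnatr_eq0 -lt0n. Qed.

Lemma step_lt (del : R) : 0 < del -> \forall n \near \oo, (0 < n)%N /\ step n < del.
Proof.
move=> d0; have := @nbhs_infty_gtr R (del ^- 2).
apply: filterS => n h.
have n0 : (0 < n)%N by rewrite -(ltr0n R) (le_lt_trans _ h)// invr_ge0 sqr_ge0.
split=> //; rewrite -[del]invrK ltf_pV2 ?posrE ?invr_gt0 ?sqrtr_gt0 ?ltr0n//.
have <- : `|del^-1| = del^-1 by rewrite gtr0_norm// invr_gt0.
by rewrite -sqrtr_sqr exprVn ltr_sqrt ?ltr0n.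
Qed.

Lemma derivable_expansion (F : R -> R) (x e : R) : derivable F x 1 -> 0 < e ->
  exists2 del : R, 0 < del &
    forall h, `|h| < del -> `|F (x + h) - F x - h * derive1 F x| <= e * `|h|.
Proof.
move=> dF e0; have := dF; rewrite /derivable => /cvg_ex[l hl].
have E : derive1 F x = l by rewrite derive1E /derive; exact/cvg_lim.
move: hl; rewrite E => /cvgrPdist_le /(_ e e0); rewrite near_withinE => /nbhs_ballP[del /= d0 h].
exists del => // k kd; have [->|k0] := eqVneq k 0; first by rewrite addr0 !mul0r subrr subr0 normr0 mulr0.
have := h k; rewrite /ball/= sub0r normrN => /(_ kd k0) /=.
rewrite /GRing.scale/= mulr1 (addrC k x) => hk.
rewrite (_ : _ - _ - _ = - (k * (l - k^-1 * (F (x + k) - F x)))); last by field.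
by rewrite normrN normrM mulrC ler_wpM2r.
Qed.

End step.

Lemma measurable_superlevel {R : realType} d (T : measurableType d) (g : T -> R) c :
  measurable_fun setT g -> measurable [set w | c <= g w].
Proof.
move=> mg; rewrite (_ : [set w | _] = setT `&` g @^-1` `[c, +oo[%classic).
  by apply: mg => //; exact: measurable_itv.
by rewrite setTI; apply/seteqP; split=> w; rewrite /= in_itv/= andbT.
Qed.

Section local_increments.
Context {R : realType} d (T : measurableType d) (P : probability T R) (F : R -> R)
  (X : nat -> {RV P >-> R}) (Xs : forall n : nat, 'I_n -> {RV P >-> R}).
Hypotheses (hX : iid_with_cdf X F) (hXs : bootstrap_samples X Xs).
Local Notation Y n w := (fun i => @Xs n i w).

Let mH n x : measurable_fun setT (fun w => empirical_cdf (Y n w) x).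
Proof. by apply: measurable_empirical_cdf => i; exact: measurable_funPT. Qed.

(** The bias is o(1) by differentiability; the variance of the rescaled increment is at most twice the
F-mass of an interval of length |s| r, which tends to 0. *)
Lemma increment_rem_negligible (x s eps : R) : derivable F x 1 -> 0 < eps ->
  negligible_seq P (fun n => [set w | eps < `|increment_rem (Y n w) (step n) x s (derive1 F x)|]).
Proof.
move=> dF eps0 eta eta0; have e20 : 0 < eps / 2 by rewrite divr_gt0.
have s10 : 0 < 1 + `|s| by rewrite ltr_pwDl.
have e'0 : 0 < eps / 2 / (1 + `|s|) by rewrite divr_gt0.
have [del d0 hdel] := derivable_expansion dF e'0.
pose K : R := eps / 2 + `|s| * `|derive1 F x|.
have K0 : 0 < K by rewrite ltr_pwDl// mulr_ge0.
pose del2 := eta * (eps / 2) ^+ 2 / (2 * K).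
have del20 : 0 < del2 by rewrite divr_gt0 ?mulr_gt0 ?exprn_gt0.
have del0 : 0 < Num.min (del / (1 + `|s|)) del2 by rewrite lt_min divr_gt0.
near=> n.
have [n0 rd] : (0 < n)%N /\ step n < Num.min (del / (1 + `|s|)) del2.
  by near: n; exact: step_lt.
move: rd; rewrite lt_min => /andP[rd1 rd2].
have r0 := step_gt0 n0 : 0 < step n :> R; have rn := sqr_step n0 : step n ^+ 2 * n%:R = 1 :> R.
move: (step n) r0 rn rd1 rd2 => r r0 rn rd1 rd2; have ri0 : 0 < r^-1 by rewrite invr_gt0.
have sr : `|s * r| < del.
  rewrite normrM (gtr0_norm r0) (le_lt_trans (y := (1 + `|s|) * r))//.
    by rewrite ler_wpM2r ?lerDr// ltW.
  by rewrite mulrC -ltr_pdivlMr.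
have bias : `|(F (x + s * r) - F x) / r - s * derive1 F x| <= eps / 2.
  have := hdel _ sr; rewrite (_ : _ - _ * derive1 F x = ((F (x + s * r) - F x) / r - s * derive1 F x) * r); last first.
    by field; exact: lt0r_neq0.
  rewrite !normrM (gtr0_norm r0) mulrA ler_pM2r// => /le_trans; apply.
  by rewrite mulrAC ler_pdivrMr// ler_wpM2l ?lerDr// ltW.
have incr : `|F (x + s * r) - F x| <= K * r.
  rewrite -ler_pdivrMr//; have -> : `|F (x + s * r) - F x| / r = `|(F (x + s * r) - F x) / r|.
    by rewrite normrM (gtr0_norm ri0).
  rewrite -(subrK (s * derive1 F x) (_ / r)) (le_trans (ler_normD _ _))// lerD// normrM//.
exists [set w | eps / 2 <= `|(bootstrap_cdf Xs n w (x + s * r) - bootstrap_cdf Xs n w x) - (F (x + s * r) - F x)| / r].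
split.
- apply: measurable_superlevel; apply: measurable_funM => //; apply: measurableT_comp => //.
  by apply: measurable_funB => //; apply: measurable_funB; exact: mH.
- move=> w /=; rewrite /increment_rem /bootstrap_cdf => h.
  set u := _ - empirical_cdf _ x in h *.
  have := ler_normB ((u - (F (x + s * r) - F x)) / r) (- ((F (x + s * r) - F x) / r - s * derive1 F x)).
  rewrite opprK (_ : _ + _ = u / r - s * derive1 F x); last by ring.
  rewrite normrN normrM (gtr0_norm ri0) => h2.
  lra.
- apply: le_trans (chebyshev_increment hX hXs _ _ n0 r0 rn e20) _.
  rewrite lee_fin ler_pdivrMr ?exprn_gt0// (le_trans (ler_wpM2l _ incr))//.
  move: rd2; rewrite /del2 ltr_pdivlMr ?mulr_gt0// => /ltW; apply: le_trans.
  by rewrite le_eqVlt; apply/orP; left; apply/eqP; ring.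
Unshelve. all: by end_near. Qed.

Lemma lin_median_tight (f : R) : F (quantile F 2^-1) = 2^-1 -> 0 < f -> forall eta : R, 0 < eta ->
  exists2 K : R, 0 < K & \forall n \near \oo,
  (P [set w | (K <= `|lin_median (Y n w) (step n) (quantile F 2^-1) f|)%R] <= eta%:E)%E.
Proof.
set v := quantile F _ => Fv f0 eta eta0.
pose c : R := eta^-1 + 1; have c1 : 1 <= c by rewrite lerDr invr_ge0 ltW.
have c0 : 0 < c by exact: lt_le_trans c1.
exists (c / f); first by rewrite divr_gt0.
near=> n.
have [n0 _] : (0 < n)%N /\ step n < (1 : R) by near: n; exact: step_lt.
have r0 : 0 < (step n : R) := step_gt0 n0.
have := bootstrap_chebyshev hX hXs (has_bootstrap_law_ray hX hXs v) n0 r0 (sqr_step n0) c0.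
have cdfX z : cdf (X 0%N) z = (F z)%:E by exact: hX.2.
rewrite (probability_ray cdfX)/= Fv => h.
apply: le_trans (le_trans h _); last first.
  rewrite lee_fin divff// div1r -[leRHS]invrK lef_pV2 ?posrE ?exprn_gt0 ?invr_gt0//.
  by rewrite (le_trans _ (ler_eXnr _ c1))// lerDl.
rewrite le_eqVlt; apply/orP; left; apply/eqP; congr (P _).
apply/seteqP; suff E w : `|lin_median (Y n w) (step n) v f| =
    `|n%:R^-1 * (\sum_(i < n) \1_(`]-oo, v]%classic) (@Xs n i w)) - 2^-1| / step n / f.
  by split=> w /=; rewrite E ler_pM2r ?invr_gt0.
have <- : empirical_cdf (Y n w) v = n%:R^-1 * (\sum_(i < n) \1_(`]-oo, v]%classic) (@Xs n i w)).
  rewrite /empirical_cdf; congr (_ * _); apply: eq_bigr => i _.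
  by rewrite indicE mem_setE in_itv.
have ri0 : 0 < (step n : R)^-1 by rewrite invr_gt0.
have fi0 : 0 < f^-1 by rewrite invr_gt0.
by rewrite /lin_median normrM normrN normrM (gtr0_norm ri0) (gtr0_norm fi0).
Unshelve. all: by end_near. Qed.

End local_increments.

(** * Comparison of the estimators with their linear approximations *)

Lemma grid_cell {R : realType} (s : nat -> R) m x : s 0%N < x -> x <= s m ->
  exists2 j, (j < m)%N & s j < x <= s j.+1.
Proof.
elim: m => [|m IH] s0 sm; first by move: (lt_le_trans s0 sm); rewrite ltxx.
have [xm|mx] := leP x (s m); last by exists m; rewrite // mx.
by have [j jm h] := IH s0 xm; exists j => //; exact: ltnW.
Qed.

Section comparison.
Context {R : realType} d (T : measurableType d) (P : probability T R) (F : R -> R)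
  (X : nat -> {RV P >-> R}) (Xs : forall n : nat, 'I_n -> {RV P >-> R}).
Hypotheses (hX : iid_with_cdf X F) (hXs : bootstrap_samples X Xs).
Let v := quantile F 2^-1.
Context (xi : R).
Let f := derive1 F v.
Let fp := derive1 F (v + xi).
Let fm := derive1 F (v - xi).
Hypotheses (xi0 : 0 < xi) (dv : derivable F v 1) (dp : derivable F (v + xi) 1)
  (dm : derivable F (v - xi) 1) (Fv : F v = 2^-1) (f0 : 0 < f) (g0 : 0 < fm + fp).
Local Notation Y n w := (fun i => @Xs n i w).

Definition scaled_median n w : R := (sample_median (Y n w) - v) / step n.
Definition scaled_mad n w : R := (sample_mad (Y n w) - xi) / step n.
Definition median_approx n w : R := lin_median (Y n w) (step n) v f.
Definition mad_approx n w : R := lin_mad (Y n w) (step n) v xi f fp fm.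
Local Notation M1 := scaled_median.
Local Notation M2 := scaled_mad.
Local Notation Z1 := median_approx.
Local Notation Z2 := mad_approx.

(** The level s separates M and Z by more than e. *)
Definition separated (M Z : nat -> T -> R) (s e : R) n : set T :=
  [set w | (M n w <= s /\ s + e < Z n w) \/ (s < M n w /\ Z n w < s - e)].

Lemma separated_median_negligible (s e : R) : 0 < e -> negligible_seq P (separated M1 Z1 s e).
Proof.
move=> e0; have ef0 : 0 < e * f by rewrite mulr_gt0.
have := increment_rem_negligible hX hXs s dv ef0; apply: negligible_seqS.
near=> n => w h /=; rewrite ltNge; apply/negP => rem.
have [n0 _] : (0 < n)%N /\ step n < (1 : R) by near: n; exact: step_lt.
have r0 := step_gt0 n0 : 0 < step n :> R.
have efK : e * f / f = e by rewrite mulfK// gt_eqF.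
case: h => -[Ms Zs].
  have := lin_median_le n0 r0 f0 rem Ms; rewrite efK leNgt => /negP; exact.
have := lin_median_ge n0 r0 f0 rem Ms; rewrite efK leNgt => /negP; exact.
Unshelve. all: by end_near. Qed.

(** Off an event of small probability Z1 is bounded by K. A grid of mesh del covers [-K - 1, K + 1], and the
comparison for the median at the grid points locates M1 in a cell and Z1 within 2 del of it. Then
[lin_mad_le] and [lin_mad_ge] bound the discrepancy by a multiple of del plus the increment
errors at the finitely many grid points. *)
Lemma separated_mad_negligible (t e : R) : 0 < e -> negligible_seq P (separated M2 Z2 t e).
Proof.
move=> e0; apply: negligible_seq_tight => eta eta0.
have [K K0 PK] := lin_median_tight hX hXs Fv f0 eta0.
pose g : R := fm + fp; have ge0 : 0 < g * e by rewrite mulr_gt0.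
(* collects the coefficients of del in the bounds of lin_mad_le and lin_mad_ge *)
pose D : R := 2 * `|fm - fp| + `|fp| + `|fm| + 1.
have D0 : 0 < D by rewrite ltr_wpDl// !addr_ge0// mulr_ge0.
pose del : R := Num.min 1 (g * e / (2 * D)).
have del0 : 0 < del by rewrite lt_min ltr01 divr_gt0// mulr_gt0.
have del1 : del <= 1 by rewrite ge_min lexx.
have delD : del * D <= g * e / 2.
  apply: (@le_trans _ _ (g * e / (2 * D) * D)); first by rewrite ler_wpM2r ?(ltW D0)// ge_min lexx orbT.
  by rewrite le_eqVlt; apply/orP; left; apply/eqP; field; rewrite gt_eqF.
(* the errors add up to at most g e / 2 + 2 e' < g e *)
pose e' : R := g * e / 8; have e'0 : 0 < e' by rewrite divr_gt0.
pose m := Num.bound ((2 * K + 2) / del).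
(* the extra unit beyond K makes room for the tolerance del <= 1 at the ends of the grid *)
pose s (j : nat) : R := - K - 1 + j%:R * del.
have sS j : s j.+1 = s j + del by rewrite /s -natr1; ring.
have sm : K + 1 <= s m.
  have : (2 * K + 2) / del < m%:R.
    by apply: archi_boundP; rewrite divr_ge0 ?(ltW del0)// addr_ge0// mulr_ge0// ltW.
  rewrite ltr_pdivrMr// /s => h; lra.
have [J memJ] : exists J : seq nat, forall j, (j <= m)%N -> j \in J.
  by exists (iota 0 m.+1) => j jm; rewrite mem_iota add0n ltnS.
pose bad j n : set T := separated M1 Z1 (s j) del n `|`
  ([set w | e' < `|increment_rem (Y n w) (step n) (v + xi) (s j + t) fp|] `|`
   [set w | e' < `|increment_rem (Y n w) (step n) (v - xi) (s j - t) fm|]).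
exists (fun n => [set w | K <= `|Z1 n w|]).
exists (fun n => [set w | exists2 j, j \in J &
  bad j n w]).
split=> //.
- move=> n; apply: measurable_superlevel; apply: measurableT_comp => //.
  apply: measurable_funM => //; apply: measurableT_comp => //; apply: measurable_funM => //.
  by apply: measurable_funB => //; apply: measurable_empirical_cdf => i; exact: measurable_funPT.
- apply: (@negligible_seq_has _ _ _ _ _ J bad) => j _.
  apply: negligible_seqU; first exact: separated_median_negligible.
  by apply: negligible_seqU; exact: increment_rem_negligible hX hXs _ _ _ _ _.
have t10 : 0 < xi / (1 + `|t|) by rewrite divr_gt0// ltr_pwDl.
near=> n => w Mt.
have [n0 rt] : (0 < n)%N /\ step n < xi / (1 + `|t|) by near: n; exact: step_lt.
have r0 := step_gt0 n0 : 0 < step n :> R.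
have xit : 0 <= xi + t * step n.
  move: rt; rewrite ltr_pdivlMr ?ltr_pwDl// => rt.
  have := ler_norm (- t * step n); rewrite normrM normrN (gtr0_norm r0); nra.
have [KZ|ZK] := leP K `|Z1 n w|; [by left|right].
apply: contrapT => /= nE.
have good j : (j <= m)%N -> ~ bad j n w.
  by move=> jm h; apply: nE; exists j => //; exact: memJ.
move: ZK; rewrite ltr_norml => /andP[ZK1 ZK2].
have ML : s 0%N < M1 n w.
  rewrite ltNge; apply/negP => h; apply: (good 0%N) => //; left; left; split=> //.
  by rewrite /s mul0r addr0; lra.
have MU : M1 n w <= s m.
  rewrite leNgt; apply/negP => h; apply: (good m) => //; left; right; split=> //; lra.
have [j jm /andP[j1 j2]] := grid_cell ML MU.
have gj := good j (ltnW jm); have gj1 := good j.+1 jm.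
have hq : `|Z1 n w - s j| <= 2 * del.
  rewrite ler_norml; apply/andP; split.
    rewrite leNgt; apply/negP => h; apply: gj; left; right; split=> //; lra.
  rewrite leNgt; apply/negP => h; apply: gj1; left; left; split=> //; rewrite sS; lra.
have ip k : ~ bad k n w ->
  `|increment_rem (Y n w) (step n) (v + xi) (s k + t) fp| <= e' /\
  `|increment_rem (Y n w) (step n) (v - xi) (s k - t) fm| <= e'.
  by move=> h; split; rewrite leNgt; apply/negP => h'; apply: h; right; [left|right].
have [ip0 im0] := ip _ gj; have [ip1 im1] := ip _ gj1.
have a1 : del * fp <= del * `|fp| by rewrite ler_wpM2l ?ler_norm// ltW.
have a2 : del * fm <= del * `|fm| by rewrite ler_wpM2l ?ler_norm// ltW.
have a3 : 0 <= del * `|fp| by rewrite mulr_ge0// ltW.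
have a4 : 0 <= del * `|fm| by rewrite mulr_ge0// ltW.
have sd : s j.+1 - s j = del by rewrite sS addrAC subrr add0r.
rewrite /D !mulrDr mulrA (mulrC del 2) in delD.
case: Mt => -[Mt Zt].
  have := lin_mad_le n0 r0 g0 j1 j2 xit hq ip1 im0 Mt; rewrite sd -/g.
  have : g * (t + e) < g * Z2 n w by rewrite ltr_pM2l.
  rewrite /e' -/(Z2 n w); lra.
have := lin_mad_ge n0 r0 g0 j1 j2 xit hq ip0 im1 Mt; rewrite sd -/g.
have : g * Z2 n w < g * (t - e) by rewrite ltr_pM2l.
rewrite /e' -/(Z2 n w); lra.
Unshelve. all: by end_near. Qed.

End comparison.

(** * The bivariate normal limit *)

Section prob_integral.
Context d (T : measurableType d) {R : realType} (P : probability T R).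
Variables (A : set T) (f : T -> R).
Hypotheses (mA : measurable A) (mf : measurable_fun setT f) (f01 : forall x, 0 <= f x <= 1).

Let f0 x : 0 <= f x. Proof. by have /andP[] := f01 x. Qed.

Let intf : (\int[P]_x (f x)%:E)%E \is a fin_num.
Proof.
apply: integrable_fin_num => //; apply: (@integrable_bounded _ _ _ _ _ 1) => // x.
by rewrite ger0_norm//; have /andP[] := f01 x.
Qed.

Let mI : measurable_fun setT (fun x => (\1_A x)%:E : \bar R).
Proof. by apply/measurable_EFinP; exact: measurable_indic. Qed.

Let PA : P A = (\int[P]_x (\1_A x)%:E)%E. Proof. by rewrite integral_indic// setIT. Qed.

Lemma fine_integral_le_prob : (forall x, ~ A x -> f x = 0) ->
  fine (\int[P]_x (f x)%:E)%E <= fine (P A).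
Proof.
move=> fA; apply: fine_le => //; first exact: fin_num_measure.
rewrite PA; apply: ge0_le_integral => //; first by move=> x _; rewrite lee_fin.
- exact/measurable_EFinP.
move=> x _; rewrite lee_fin indicE; case: (boolP (x \in A)) => [_|/negP nx].
  by have /andP[] := f01 x.
by rewrite fA// => Ax; apply: nx; rewrite inE.
Qed.

Lemma fine_prob_le_integral : (forall x, A x -> f x = 1) ->
  fine (P A) <= fine (\int[P]_x (f x)%:E)%E.
Proof.
move=> fA; apply: fine_le => //; first exact: fin_num_measure.
rewrite PA; apply: ge0_le_integral => //.
- exact/measurable_EFinP.
move=> x _; rewrite lee_fin indicE; case: (boolP (x \in A)) => // Ax.
by rewrite fA//; move: Ax; rewrite inE.
Qed.

End prob_integral.

Section limit_law.
Context {R : realType}.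
Implicit Types (b c : R * R) (z : R * R).

Lemma mx2E (a1 a2 a3 a4 : R) : [/\ mx2 a1 a2 a3 a4 0 0 = a1, mx2 a1 a2 a3 a4 0 1 = a2,
  mx2 a1 a2 a3 a4 1 0 = a3 & mx2 a1 a2 a3 a4 1 1 = a4].
Proof. by split; rewrite mxE. Qed.

Lemma measurable_affine2 (m : R * R) (A : 'M[R]_2) : measurable_fun setT (affine2 m A).
Proof.
apply/measurable_fun_pairP; split; rewrite /comp/=; apply: measurable_funD => //;
  try apply: measurable_funD => //; exact: measurable_funM.
Qed.

(** The normal law is defined on the copy of R whose sigma-algebra is generated by the half-open intervals.
It has the Borel sets as measurable sets, but it is a different structure on the same type. *)
Let plane : measurableType _ := (measurableTypeR R * measurableTypeR R)%type.

Let measurable_affine2_plane (m : R * R) (A : 'M[R]_2) :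
  @measurable_fun _ _ plane (R * R)%type setT (affine2 m A) := measurable_affine2 m A.

Definition affine_mfun b c : {mfun plane >-> (R * R)%type} :=
  HB.pack (affine2 (0, 0) (mx2 b.1 c.1 b.2 c.2))
    (isMeasurableFun.Build _ _ _ _ _ (measurable_affine2_plane (0, 0) (mx2 b.1 c.1 b.2 c.2))).

Definition bivariate_normal b c : probability (R * R)%type R :=
  distribution (normal_prob (0 : R) 1 \x normal_prob (0 : R) 1)%E (affine_mfun b c).

Lemma bivariate_normalP b c (S : 'M[R]_2) :
  mx2 b.1 c.1 b.2 c.2 *m (mx2 b.1 c.1 b.2 c.2)^T = S -> is_bivariate_normal (bivariate_normal b c) (0, 0) S.
Proof. by move=> AS; exists (mx2 b.1 c.1 b.2 c.2). Qed.

Definition quadrant z : set (R * R) := [set x | x.1 <= z.1 /\ x.2 <= z.2].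

Lemma measurable_quadrant z : measurable (quadrant z).
Proof.
rewrite (_ : quadrant z = `]-oo, z.1]%classic `*` `]-oo, z.2]%classic).
  by apply: measurableX; exact: measurable_itv.
by apply/seteqP; split=> x; rewrite /quadrant/= !in_itv.
Qed.

(** The iterated Gaussian average is an integral against the product of two standard normal laws, by Fubini. *)
Lemma gavg2_bivariate_normal K (phi : R -> R -> R) b c : blip K phi ->
  (forall x y, 0 <= phi x y) -> gavg2 1 b c phi 0 0 = fine (\int[bivariate_normal b c]_x (phi x.1 x.2)%:E)%E.
Proof.
move=> fK p0; have [e1 e2 e3 e4] := mx2E b.1 c.1 b.2 c.2.
set A := mx2 _ _ _ _ in e1 e2 e3 e4.
have mphi := blip_measurable fK.
rewrite ge0_integral_distribution; [|exact/measurable_EFinP|by move=> x; rewrite lee_fin].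
have mg : measurable_fun setT (fun x : R * R => phi (affine2 (0, 0) A x).1 (affine2 (0, 0) A x).2).
  apply: (measurableT_comp mphi (g := affine2 (0, 0) A)); exact: measurable_affine2.
have [_ e] := @Rfubini _ _ _ _ R (normal_prob 0 1) (normal_prob 0 1) _ K mg (fun p => fK.1 _ _).
apply: etrans e; rewrite /gavg2 /gavg; apply: eq_Rintegral => x _; apply: eq_Rintegral => y _.
by rewrite /affine2/= e1 e2 e3 e4 !add0r.
Qed.

Lemma gavg2_le_joint_cdf K phi b c z : blip K phi -> (forall x y, 0 <= phi x y <= 1) ->
  (forall x y, z.1 <= x \/ z.2 <= y -> phi x y = 0) ->
  gavg2 1 b c phi 0 0 <= fine (joint_cdf (bivariate_normal b c) z).
Proof.
move=> fK p01 pz; rewrite (gavg2_bivariate_normal _ _ fK); last by move=> x y; have /andP[] := p01 x y.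
apply: (@fine_integral_le_prob _ _ R (bivariate_normal b c) (quadrant z) (fun x => phi x.1 x.2)
  (measurable_quadrant z) (blip_measurable fK) (fun x => p01 _ _)) => x nx; apply: pz; have [x1|x1] := leP z.1 x.1; first by left.
have [x2|x2] := leP z.2 x.2; first by right.
by exfalso; apply: nx; split; exact: ltW.
Qed.

Lemma joint_cdf_le_gavg2 K phi b c z : blip K phi -> (forall x y, 0 <= phi x y <= 1) ->
  (forall x y, x <= z.1 -> y <= z.2 -> phi x y = 1) ->
  fine (joint_cdf (bivariate_normal b c) z) <= gavg2 1 b c phi 0 0.
Proof.
move=> fK p01 pz; rewrite (gavg2_bivariate_normal _ _ fK); last by move=> x y; have /andP[] := p01 x y.
apply: (@fine_prob_le_integral _ _ R (bivariate_normal b c) (quadrant z) (fun x => phi x.1 x.2)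
  (measurable_quadrant z) (blip_measurable fK) (fun x => p01 _ _)) => x.
by move=> [x1 x2]; exact: pz.
Qed.

End limit_law.

(** * Central limit theorem for the linear approximations *)

Lemma mx2_gram {R : realType} (b c : R * R) :
  mx2 b.1 c.1 b.2 c.2 *m (mx2 b.1 c.1 b.2 c.2)^T =
  mx2 (b.1 ^+ 2 + c.1 ^+ 2) (b.1 * b.2 + c.1 * c.2)
      (b.1 * b.2 + c.1 * c.2) (b.2 ^+ 2 + c.2 ^+ 2).
Proof.
have ord2 (i : 'I_2) : i = 0 \/ i = 1.
  by case: i => [[|[|//]] ?]; [left|right]; exact: val_inj.
apply/matrixP => i j; rewrite !mxE !big_ord_recl big_ord0 !mxE/= addr0.
by case: (ord2 i) => ->; case: (ord2 j) => -> /=; rewrite ?expr2// (mulrC b.2) (mulrC c.2).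
Qed.

Section influence.
Context {R : realType} (a f g beta : R) (p : bool * bool -> R).
Hypotheses (f0 : 0 < f) (g0 : 0 < g).
Hypotheses (pTT : p (true, true) = 2^-1 - a) (pTF : p (true, false) = a)
  (pFT : p (false, true) = a) (pFF : p (false, false) = 2^-1 - a).

(** The influence function of (Med, MAD) at an observation x of colour c = (x <= v, v - xi < x <= v + xi). *)
Definition influence (c : bool * bool) : R * R :=
  (- ((c.1)%:R - 2^-1) / f, (- ((c.2)%:R - 2^-1) - beta / f * ((c.1)%:R - 2^-1)) / g).

Let k := Num.sqrt (2^-1 - a).
Let l := Num.sqrt a.
(** [loading1] and [loading2] are the columns of a square root of Sigma. The square roots k and l of the
probabilities 1/2 - a and a, with a = F (v - xi), come from the symmetry of the law of the colours:
its centred indicators are +-1/2, equal with probability 1 - 2 a and opposite with probability 2 a. *)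
Definition loading1 : R * R := (- k / f, (- k - beta * k / f) / g).
Definition loading2 : R * R := (- l / f, (l - beta * l / f) / g).

Lemma sum_bool2 (h : bool * bool -> R) :
  \sum_c h c = h (true, true) + h (true, false) + h (false, true) + h (false, false).
Proof.
rewrite (eq_bigr (fun c => h (c.1, c.2))); last by case.
by rewrite -(pair_bigA _ (fun i j => h (i, j)))/= !big_bool/= addrA.
Qed.

Let E := (sum_bool2, pTT, pTF, pFT, pFF).
Let fN : f != 0. Proof. by rewrite gt_eqF. Qed.
Let gN : g != 0. Proof. by rewrite gt_eqF. Qed.

Let dev : (((true%:R : R) - 2^-1 = 2^-1) * ((false%:R : R) - 2^-1 = - 2^-1))%type.
Proof.
split; last by rewrite sub0r.
have -> : true%:R = 1 :> R by [].
lra. Qed.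

Lemma influence_mean1 : \sum_c p c * (influence c).1 = 0.
Proof. by rewrite !E /influence/= !dev; field. Qed.

Lemma influence_mean2 : \sum_c p c * (influence c).2 = 0.
Proof. by rewrite !E /influence/= !dev; field; rewrite fN gN. Qed.

Lemma influence_bound : exists B, (forall c, `|(influence c).1| <= B) /\ (forall c, `|(influence c).2| <= B).
Proof.
exists (\sum_c (`|(influence c).1| + `|(influence c).2|)); split=> c.
  by rewrite (bigD1 c)//= -addrA lerDl addr_ge0// sumr_ge0// => i _; rewrite addr_ge0.
by rewrite (bigD1 c)//= addrAC lerDr addr_ge0// sumr_ge0// => i _; rewrite addr_ge0.
Qed.

Hypotheses (a0 : 0 <= a) (a1 : a <= 2^-1).
Let k2 : k ^+ 2 = 2^-1 - a. Proof. by rewrite sqr_sqrtr ?subr_ge0. Qed.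
Let l2 : l ^+ 2 = a. Proof. by rewrite sqr_sqrtr. Qed.

Lemma loading11 : loading1.1 ^+ 2 + loading2.1 ^+ 2 = 1 / (2 * f ^+ 2).
Proof.
rewrite /loading1 /loading2/= (_ : _ + _ = (k ^+ 2 + l ^+ 2) / f ^+ 2); last by field.
by rewrite k2 l2; field.
Qed.

Lemma loading12 : loading1.1 * loading1.2 + loading2.1 * loading2.2 =
  1 / (2 * f * g) * (1 - 4 * a + beta / f).
Proof.
rewrite /loading1 /loading2/= (_ : _ + _ =
  (k ^+ 2 * (1 + beta / f) + l ^+ 2 * (beta / f - 1)) / (f * g)); last by field; rewrite fN gN.
by rewrite k2 l2; field; rewrite fN gN.
Qed.

Lemma loading22 : loading1.2 ^+ 2 + loading2.2 ^+ 2 = 1 / (2 * g ^+ 2) *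
  (1 + (beta ^+ 2 + 4 * (1 - (2 * a + 2^-1)) * beta * f) / f ^+ 2).
Proof.
rewrite /loading1 /loading2/= (_ : _ + _ =
  (k ^+ 2 * (1 + beta / f) ^+ 2 + l ^+ 2 * (1 - beta / f) ^+ 2) / g ^+ 2); last by field; rewrite fN gN.
by rewrite k2 l2; field; rewrite fN gN.
Qed.

(** Each of the two levels of sampling contributes Sigma / 2, hence t ^ 2 = 1/2. *)
Let t := Num.sqrt (2^-1 : R).
Let t2 : t ^+ 2 = 2^-1. Proof. by rewrite sqr_sqrtr ?invr_ge0. Qed.

Lemma influence_mom11 : mom11 p influence = t ^+ 2 * (loading1.1 ^+ 2 + loading2.1 ^+ 2).
Proof. by rewrite loading11 t2 /mom11 !E /influence/= !dev; field. Qed.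

Lemma influence_mom12 : mom12 p influence = t ^+ 2 * (loading1.1 * loading1.2 + loading2.1 * loading2.2).
Proof. by rewrite loading12 t2 /mom12 !E /influence/= !dev; field; rewrite fN gN. Qed.

Lemma influence_mom22 : mom22 p influence = t ^+ 2 * (loading1.2 ^+ 2 + loading2.2 ^+ 2).
Proof. by rewrite loading22 t2 /mom22 !E /influence/= !dev; field; rewrite fN gN. Qed.

(** [bootstrap_clt] for the influence function; the two levels combine to variance t ^ 2 + t ^ 2 = 1 along
the loadings. *)
Lemma influence_clt (K : R) phi : prob_vector p -> smooth K phi ->
  exists M : R, forall n r, (0 < n)%N -> 0 < r -> r ^+ 2 * n%:R = 1 ->
  `|boot_Ex p n (fun w => phi (r * \sum_(i <- w) (influence i).1) (r * \sum_(i <- w) (influence i).2)) -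
    gavg2 1 loading1 loading2 phi 0 0| <= M * r.
Proof.
move=> pp sphi; have [B [B1 B2]] := influence_bound.
have t0 : 0 < t by rewrite sqrtr_gt0 invr_gt0.
have := bootstrap_clt pp influence_mean1 influence_mean2 B1 B2 t0
  influence_mom11 influence_mom12 influence_mom22 sphi.
rewrite (_ : Num.sqrt _ = 1)// t2 (_ : 2^-1 + 2^-1 = 1) ?sqrtr1//; by field.
Qed.

End influence.

Lemma boot_Ex_le {R : realType} {C : finType} (p : C -> R) n (G H : seq C -> R) : (0 < n)%N ->
  prob_vector p -> (forall s, G s <= H s) -> boot_Ex p n G <= boot_Ex p n H.
Proof.
move=> n0 pp GH; apply: iid_Ex_le => // e en; apply: iid_Ex_le => //; exact: prob_vector_freq.
Qed.

Section approximations.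
Context {R : realType} d (T : measurableType d) (P : probability T R) (F : R -> R)
  (X : nat -> {RV P >-> R}) (Xs : forall n : nat, 'I_n -> {RV P >-> R}).
Hypotheses (hX : iid_with_cdf X F) (hXs : bootstrap_samples X Xs).
Let v := quantile F 2^-1.
Context (xi : R).
Let f := derive1 F v.
Let fp := derive1 F (v + xi).
Let fm := derive1 F (v - xi).
Let a := F (v - xi).
Hypotheses (xi0 : 0 < xi) (Fv : F v = 2^-1) (Fxi : F (v + xi) = a + 2^-1)
  (f0 : 0 < f) (g0 : 0 < fm + fp).

Let tau (x : R) : bool * bool := (x <= v, (v - xi < x) && (x <= v + xi)).

Let cell (c : bool * bool) : set R := tau @^-1` [set c].

Let cellTT : cell (true, true) = `]v - xi, v]%classic.
Proof.
apply/seteqP; split=> x; rewrite /cell/= in_itv/=; first by case=> -> /andP[->].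
by move=> /andP[h1 h2]; rewrite /tau h1 h2 (le_trans h2)// lerDl ltW.
Qed.

Let cellTF : cell (true, false) = `]-oo, v - xi]%classic.
Proof.
apply/seteqP; split=> x; rewrite /cell/= in_itv/=; rewrite /tau.
  case=> xv /negbT; rewrite negb_and -leNgt => /orP[//|]; rewrite -ltNge => h.
  by have := lt_le_trans h xv; rewrite gtrDl ltNge ltW.
move=> h; rewrite ltNge h/=; congr pair; rewrite (le_trans h)// gerBl ltW//.
Qed.

Let cellFT : cell (false, true) = `]v, v + xi]%classic.
Proof.
apply/seteqP; split=> x; rewrite /cell/= in_itv/= /tau.
  by case=> /negbT; rewrite -ltNge => -> /andP[_ ->].
by move=> /andP[h1 h2]; rewrite leNgt h1 h2 (lt_trans _ h1)// gtrBl.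
Qed.

Let cellFF : cell (false, false) = `]v + xi, +oo[%classic.
Proof.
apply/seteqP; split=> x; rewrite /cell/= in_itv/= andbT /tau.
  case=> /negbT; rewrite -ltNge => h /negbT; rewrite negb_and -leNgt -ltNge => /orP[h'|//].
  by have := lt_le_trans h h'; rewrite ltNge gerBl ltW.
move=> h; rewrite leNgt (lt_trans _ h) ?ltrDl// (leNgt x) h andbF//.
Qed.

Let htau c : has_bootstrap_law X Xs (tau @^-1` [set c]).
Proof.
rewrite -/(cell c); case: c => -[] [].
- by rewrite cellTT; apply: has_bootstrap_law_itv hX hXs _ _ _; rewrite gerBl ltW.
- by rewrite cellTF; exact: has_bootstrap_law_ray hX hXs _.
- by rewrite cellFT; apply: has_bootstrap_law_itv hX hXs _ _ _; rewrite lerDl ltW.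
rewrite cellFF (_ : `]v + xi, +oo[%classic = [set: R] `\` `]-oo, v + xi]%classic).
  apply: has_bootstrap_law_setD => //; first exact: has_bootstrap_law_ray hX hXs _.
  exact: has_bootstrap_law_setT.
by rewrite setTD setCitvl.
Qed.

Let p := @colour_prob _ _ _ P X _ tau.
Let pp : prob_vector p := prob_vector_colour htau.
Let cdfX z : cdf (X 0%N) z = (F z)%:E. Proof. exact: hX.2. Qed.

Let pTT : p (true, true) = 2^-1 - a.
Proof. by rewrite /p /colour_prob -/(cell _) cellTT (probability_itv cdfX) ?gerBl ?(ltW xi0)//= Fv. Qed.

Let pTF : p (true, false) = a.
Proof. by rewrite /p /colour_prob -/(cell _) cellTF (probability_ray cdfX). Qed.

Let pFT : p (false, true) = a.
Proof.
rewrite /p /colour_prob -/(cell _) cellFT (probability_itv cdfX) ?lerDl ?(ltW xi0)//= Fv Fxi.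
by rewrite addrK.
Qed.

Let pFF : p (false, false) = 2^-1 - a.
Proof. have := pp.2; rewrite sum_bool2 pTT pTF pFT => h; lra. Qed.

Let a0 : 0 <= a. Proof. exact: cdf_ge0r cdfX _. Qed.
Let a1 : a <= 2^-1. Proof. by rewrite -Fv; apply: (cdf_homo cdfX); rewrite gerBl ltW. Qed.

Let psi := influence f (fm + fp) (fm - fp).

Let colours n w := [seq tau (@Xs n i w) | i <- enum 'I_n].

Let colours_sum n w (h : bool * bool -> R) :
  \sum_(c <- colours n w) h c = \sum_(i < n) h (tau (@Xs n i w)).
Proof. by rewrite big_map big_enum. Qed.

Let centred_mean n (h : 'I_n -> bool) : (0 < n)%N ->
  (n%:R^-1 * (\sum_(i < n) (h i)%:R) - 2^-1) / step n = step n * \sum_(i < n) ((h i)%:R - 2^-1) :> R.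
Proof.
move=> n0; have r0 := step_gt0 n0 : 0 < step n :> R; have rn := sqr_step n0 : step n ^+ 2 * n%:R = 1 :> R.
have nN : n%:R != 0 :> R by rewrite pnatr_eq0 -lt0n.
rewrite sumrB sumr_const card_ord -[2^-1 *+ n]mulr_natl.
apply: (mulIf (lt0r_neq0 r0)); rewrite divfK ?gt_eqF// mulrAC -expr2.
by rewrite -[step n ^+ 2](mulfK nN) rn; field.
Qed.

Lemma median_approx_colours n w : (0 < n)%N ->
  median_approx F Xs n w = step n * \sum_(c <- colours n w) (psi c).1.
Proof.
move=> n0; rewrite colours_sum /median_approx /lin_median /empirical_cdf centred_mean//.
rewrite -mulrN -sumrN -mulrA; congr (_ * _).
by rewrite mulr_suml; apply: eq_bigr.
Qed.

Lemma mad_approx_colours n w : (0 < n)%N ->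
  mad_approx F Xs xi n w = step n * \sum_(c <- colours n w) (psi c).2.
Proof.
move=> n0; rewrite /mad_approx /lin_mad -/(median_approx F Xs n w) median_approx_colours//.
rewrite !colours_sum (_ : empirical_cdf _ (v + xi) - empirical_cdf _ (v - xi) =
  n%:R^-1 * (\sum_(i < n) (tau (@Xs n i w)).2%:R)); last first.
  rewrite /empirical_cdf -mulrBr -sumrB; congr (_ * _); apply: eq_bigr => i _ /=.
  rewrite ltNge; case: (leP (@Xs n i w) (v - xi)) => h /=; last by rewrite subr0.
  by rewrite (le_trans h) ?subrr// lerD2l -subr_ge0 opprK addr_ge0// ltW.
rewrite centred_mean//; apply: (mulIf (lt0r_neq0 g0)); rewrite divfK ?gt_eqF//.
rewrite -mulrN mulrCA -mulrDr -mulrA; congr (_ * _).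
rewrite mulr_sumr mulr_suml -sumrN -big_split/=; apply: eq_bigr => i _.
rewrite /psi /influence/= divfK ?gt_eqF// -/v -/fp -/fm.
by rewrite mulNr mulrN; congr (_ - _); rewrite mulrA mulrAC.
Qed.

Definition limit_law := bivariate_normal (loading1 a f (fm + fp) (fm - fp)) (loading2 a f (fm + fp) (fm - fp)).

(** The joint distribution function of the linear approximations, as an event. *)
Let approx_event (s t : R) n : set T :=
  [set w | median_approx F Xs n w <= s /\ mad_approx F Xs xi n w <= t].

Let approx_eventP s t n : (0 < n)%N -> P (approx_event s t n) =
  (boot_Ex p n (fun l => ((step n * (\sum_(c <- l) (psi c).1) <= s) &&
                     (step n * (\sum_(c <- l) (psi c).2) <= t))%:R))%:E.
Proof.
move=> n0; rewrite -(bootstrap_colour_law hX hXs htau); congr (P _).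
by apply/seteqP; split=> w; rewrite /approx_event/= -median_approx_colours// -mad_approx_colours// => /andP.
Qed.

Let clt_near (K : R) phi (eta : R) : smooth K phi -> 0 < eta -> \forall n \near \oo, (0 < n)%N /\
  `|boot_Ex p n (fun w => phi (step n * \sum_(i <- w) (psi i).1) (step n * \sum_(i <- w) (psi i).2)) -
    gavg2 1 (loading1 a f (fm + fp) (fm - fp)) (loading2 a f (fm + fp) (fm - fp)) phi 0 0| <= eta.
Proof.
move=> sphi eta0; have [M hM] := influence_clt (fm - fp) f0 g0 pTT pTF pFT pFF a0 a1 pp sphi.
have M0 : 0 < 1 + `|M| by rewrite ltr_pwDl.
have := @step_lt R _ (divr_gt0 eta0 M0); apply: filterS => n [n0 rn]; split=> //.
have r0 := step_gt0 n0 : 0 < step n :> R.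
apply: le_trans (hM _ _ n0 r0 (sqr_step n0)) _.
rewrite ltr_pdivlMr// in rn; apply: le_trans (ltW rn); rewrite mulrC ler_wpM2l ?(ltW r0)//.
by rewrite (le_trans (ler_norm _))// lerDr.
Qed.

Lemma approx_event_le s t e eta : 0 < e -> 0 < eta -> \forall n \near \oo,
  (P (approx_event s t n) <= (fine (joint_cdf limit_law (s + e, t + e)) + eta)%:E)%E.
Proof.
move=> e0 eta0; have [phi [K [sphi p01 pst pe]]] := smooth_quadrant s t e0.
apply: filterS (clt_near sphi eta0) => n [n0 h].
rewrite approx_eventP// lee_fin.
have h1 := gavg2_le_joint_cdf (loading1 a f (fm + fp) (fm - fp)) (loading2 a f (fm + fp) (fm - fp))
  (z := (s + e, t + e)) (smooth_blip sphi) p01 pe.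
rewrite -/limit_law in h1; move: h; rewrite ler_norml => /andP[_ h].
apply: le_trans (_ : _ <= boot_Ex p n (fun w => phi (step n * \sum_(i <- w) (psi i).1) (step n * \sum_(i <- w) (psi i).2))) _; last by lra.
apply: boot_Ex_le => // l; case: andP => [[h2 h3]|_]; first by rewrite pst.
by have /andP[] := p01 (step n * \sum_(i <- l) (psi i).1) (step n * \sum_(i <- l) (psi i).2).
Qed.

Lemma approx_event_ge s t e eta : 0 < e -> 0 < eta -> \forall n \near \oo,
  ((fine (joint_cdf limit_law (s - e, t - e)) - eta)%:E <= P (approx_event s t n))%E.
Proof.
move=> e0 eta0; have [phi [K [sphi p01 pst pe]]] := smooth_quadrant (s - e) (t - e) e0.
apply: filterS (clt_near sphi eta0) => n [n0 h].
rewrite approx_eventP// lee_fin.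
have h1 := joint_cdf_le_gavg2 (loading1 a f (fm + fp) (fm - fp)) (loading2 a f (fm + fp) (fm - fp))
  (z := (s - e, t - e)) (smooth_blip sphi) p01 pst.
rewrite -/limit_law in h1; move: h; rewrite ler_norml => /andP[h _].
apply: le_trans (_ : boot_Ex p n (fun w => phi (step n * \sum_(i <- w) (psi i).1) (step n * \sum_(i <- w) (psi i).2)) <= _); first by lra.
apply: boot_Ex_le => // l; case: andP => [_|nst].
  by have /andP[] := p01 (step n * \sum_(i <- l) (psi i).1) (step n * \sum_(i <- l) (psi i).2).
rewrite pe// !subrK; apply: contrapT => /not_orP[/negP h2 /negP h3]; apply: nst.
by split; apply: ltW; rewrite ltNge.
Qed.

End approximations.

(** * Convergence of the joint distribution functions *)

Section squeeze.
Context {R : realType} d (T : measurableType d) (P : probability T R).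

(** At a continuity point the two bounds differ by arbitrarily little. *)
Lemma cvg_probability_squeeze (mu : probability (R * R)%type R) (z : R * R) (E : nat -> set T) :
  (forall n, measurable (E n)) -> {for z, continuous (joint_cdf mu)} ->
  (forall e eta : R, 0 < e -> 0 < eta -> \forall n \near \oo,
    (P (E n) <= (fine (joint_cdf mu (z.1 + e, z.2 + e)) + eta)%:E)%E) ->
  (forall e eta : R, 0 < e -> 0 < eta -> \forall n \near \oo,
    ((fine (joint_cdf mu (z.1 - e, z.2 - e)) - eta)%:E <= P (E n))%E) ->
  (fun n => P (E n)) @ \oo --> joint_cdf mu z.
Proof.
move=> mE cz up lo.
have finE n : P (E n) \is a fin_num by exact: fin_num_measure.
have finJ x : joint_cdf mu x \is a fin_num by apply: fin_num_measure; exact: measurable_quadrant.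
rewrite -(fineK (finJ z)); apply: cvg_EFin; first exact: nearW.
have cJ : {for z, continuous (fine \o joint_cdf mu)}.
  by rewrite /continuous_at; apply: fine_cvg; rewrite fineK//; exact: cz.
apply/cvgrPdist_le => eta eta0; have e20 : 0 < eta / 2 by rewrite divr_gt0.
have [del /= d0 hdel] : exists2 del : R, 0 < del & forall x, ball z del x ->
    `|fine (joint_cdf mu z) - fine (joint_cdf mu x)| < eta / 2.
  by move/cvgrPdist_lt : cJ => /(_ _ e20) /nbhs_ballP[del /= d0 h]; exists del.
have e0 : 0 < del / 2 by rewrite divr_gt0.
have ed : del / 2 < del by rewrite ltr_pdivrMr// mulr_natr mulr2n ltrDl.
have h2 := hdel (z.1 + del / 2, z.2 + del / 2).
have h1 := hdel (z.1 - del / 2, z.2 - del / 2).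
move: (up _ _ e0 e20) (lo _ _ e0 e20); apply: filterS2 => n.
rewrite -(fineK (finE n)) !lee_fin /= => u l.
have {}h1 : `|fine (joint_cdf mu z) - fine (joint_cdf mu (z.1 - del / 2, z.2 - del / 2))| < eta / 2.
  by apply: h1; split; rewrite /ball/= opprD opprK addrA subrr add0r gtr0_norm.
have {}h2 : `|fine (joint_cdf mu z) - fine (joint_cdf mu (z.1 + del / 2, z.2 + del / 2))| < eta / 2.
  by apply: h2; split; rewrite /ball/= opprD addrA subrr add0r normrN gtr0_norm.
by rewrite ler_norml; move: h1 h2; rewrite !ltr_norml => /andP[? ?] /andP[? ?]; apply/andP; split; lra.
Qed.

Lemma probability_le_negligible (A E B : nat -> set T) (eta : R) : 0 < eta ->
  (forall n, measurable (A n)) -> (forall n, measurable (E n)) ->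
  negligible_seq P B -> (forall n, A n `<=` E n `|` B n) ->
  \forall n \near \oo, (P (A n) <= P (E n) + eta%:E)%E.
Proof.
move=> eta0 mA mE nB AEB; apply: filterS (nB _ eta0) => n [B' [mB' BB' PB']].
have AEB' : A n `<=` E n `|` B' by apply: subset_trans (AEB n) _; exact: setUS.
apply: le_trans (le_measure P _ _ AEB') _; rewrite ?inE//; first exact: measurableU.
by apply: le_trans (measureU2 P (mE n) mB') _; exact: leeD.
Qed.

End squeeze.

Section asymptotic_normality.
Context {R : realType} d (T : measurableType d) (P : probability T R) (F : R -> R)
  (X : nat -> {RV P >-> R}) (Xs : forall n : nat, 'I_n -> {RV P >-> R}).
Hypotheses (hX : iid_with_cdf X F) (hXs : bootstrap_samples X Xs).
Let v := quantile F 2^-1.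
Context (xi : R).
Hypotheses (xi0 : 0 < xi) (dv : derivable F v 1) (dp : derivable F (v + xi) 1)
  (dm : derivable F (v - xi) 1) (Fv : F v = 2^-1) (Fxi : F (v + xi) = F (v - xi) + 2^-1)
  (f0 : 0 < derive1 F v) (g0 : 0 < derive1 F (v - xi) + derive1 F (v + xi)).

Let M1 := scaled_median F Xs.
Let M2 := scaled_mad Xs xi.
Let Z1 := median_approx F Xs.
Let Z2 := mad_approx F Xs xi.

Let mH n x : measurable_fun setT (fun w => empirical_cdf (fun i => @Xs n i w) x).
Proof. by apply: measurable_empirical_cdf => i; exact: measurable_funPT. Qed.

Lemma measurable_scaled_median n : measurable_fun setT (M1 n).
Proof.
apply: measurable_funM => //; apply: measurable_funB => //.
by apply: measurable_sample_median => i; exact: measurable_funPT.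
Qed.

Lemma measurable_scaled_mad n : measurable_fun setT (M2 n).
Proof.
apply: measurable_funM => //; apply: measurable_funB => //.
by apply: measurable_sample_mad => i; exact: measurable_funPT.
Qed.

Let mZ1 n : measurable_fun setT (Z1 n).
Proof.
apply: measurable_funM => //; apply: measurableT_comp => //.
by apply: measurable_funM => //; apply: measurable_funB.
Qed.

Let mZ2 n : measurable_fun setT (Z2 n).
Proof.
apply: measurable_funM => //; apply: measurable_funD => //; last first.
  by apply: measurable_funM => //; exact: mZ1.
apply: measurableT_comp => //; apply: measurable_funM => //; apply: measurable_funB => //.
exact: measurable_funB.
Qed.

Let m2 (g h : T -> R) s t : measurable_fun setT g -> measurable_fun setT h ->
  measurable [set w | g w <= s /\ h w <= t].
Proof.
move=> mg mh; rewrite (_ : [set w | _] = (setT `&` g @^-1` `]-oo, s]%classic) `&` (setT `&` h @^-1` `]-oo, t]%classic)).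
  by apply: measurableI; [apply: mg|apply: mh] => //; exact: measurable_itv.
by rewrite !setTI; apply/seteqP; split=> w; rewrite /= !in_itv.
Qed.

Let sep s t e n := separated M1 Z1 s e n `|` separated M2 Z2 t e n.
Let nsep s t e : 0 < e -> negligible_seq P (sep s t e).
Proof.
move=> e0; apply: negligible_seqU; first exact (separated_median_negligible hX hXs dv f0 s e0).
exact (separated_mad_negligible hX hXs xi0 dv dp dm Fv f0 g0 t e0).
Qed.

Lemma scaled_pair_cvg (z : R * R) : {for z, continuous (joint_cdf (limit_law F xi))} ->
  (fun n => P [set w | M1 n w <= z.1 /\ M2 n w <= z.2]) @ \oo --> joint_cdf (limit_law F xi) z.
Proof.
have mM s t n : measurable [set w | M1 n w <= s /\ M2 n w <= t].
  by apply: m2; [exact: measurable_scaled_median|exact: measurable_scaled_mad].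
have mZ s t n : measurable [set w | Z1 n w <= s /\ Z2 n w <= t] by exact: m2.
have up := approx_event_le hX hXs xi0 Fv Fxi f0 g0.
have lo := approx_event_ge hX hXs xi0 Fv Fxi f0 g0.
move: (limit_law F xi) up lo => mu up lo.
case: z => s t cz; apply: cvg_probability_squeeze => //= e eta e0 eta0.
all: have e20 : 0 < e / 2 by rewrite divr_gt0.
all: have eta20 : 0 < eta / 2 by rewrite divr_gt0.
- have : \forall n \near \oo, (P [set w | (M1 n w <= s /\ M2 n w <= t)%R] <=
      P [set w | (Z1 n w <= s + e / 2 /\ Z2 n w <= t + e / 2)%R] + (eta / 2)%:E)%E.
    apply: probability_le_negligible (nsep s t e20) _ => // n w /= [h1 h2].
    have [z1|z1] := leP (Z1 n w) (s + e / 2); last by right; left; left.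
    by have [z2|z2] := leP (Z2 n w) (t + e / 2); [left|right; right; left].
  have := up (s + e / 2) (t + e / 2) _ _ e20 eta20.
  apply: filterS2 => n h1 /le_trans; apply.
  rewrite -!addrA -!splitr in h1.
  by rewrite [X in (_ + X)%:E](splitr eta) addrA EFinD leeD.
have : \forall n \near \oo, (P [set w | (Z1 n w <= s - 2 * (e / 2) + e / 4 /\ Z2 n w <= t - 2 * (e / 2) + e / 4)%R] <=
      P [set w | (M1 n w <= s /\ M2 n w <= t)%R] + (eta / 2)%:E)%E.
  apply: probability_le_negligible (nsep s t e20) _ => // n w /= [h1 h2].
  have [z1|z1] := leP (M1 n w) s; last by right; left; right; split=> //; lra.
  by have [z2|z2] := leP (M2 n w) t; [left|right; right; right; split=> //; lra].
have e40 : 0 < e / 4 by rewrite divr_gt0.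
have := lo (s - 2 * (e / 2) + e / 4) (t - 2 * (e / 2) + e / 4) _ _ e40 eta20.
apply: filterS2 => n h1 h2; have := le_trans h1 h2.
rewrite -leeBlDr// -EFinB; apply: le_trans; rewrite lee_fin.
rewrite (_ : s - 2 * (e / 2) + e / 4 - e / 4 = s - e); last by field.
rewrite (_ : t - 2 * (e / 2) + e / 4 - e / 4 = t - e); last by field.
lra.
Qed.

End asymptotic_normality.

(** * The population median and median absolute deviation *)

Section population.
Context {R : realType} d (T : measurableType d) (P : probability T R) (F : R -> R) (Y : {RV P >-> R}).
Hypothesis cdfY : forall x, cdf Y x = (F x)%:E.
Let v := quantile F 2^-1.
Let G := absdev_cdf Y v.
Let xi := quantile G 2^-1.
Hypotheses (cm : \forall x \near v - xi, {for x, continuous F})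
  (dv : derivable F v 1) (dm : derivable F (v - xi) 1) (dp : derivable F (v + xi) 1).

Let half0 : 0 < 2^-1 :> R. Proof. by rewrite invr_gt0. Qed.
Let half1 : 2^-1 < 1 :> R. Proof. by rewrite invf_lt1// ltr1n. Qed.

Lemma derivable_continuous_at (H : R -> R) x : derivable H x 1 -> {for x, continuous H}.
Proof. by move=> /derivable1_diffP; exact: differentiable_continuous. Qed.

Lemma cdf_median : F v = 2^-1.
Proof.
apply: quantileK (cdf_homo cdfY) _ _ _.
- exact: cdf_ge_ex cdfY _ half1.
- exact: cdf_lt_ex cdfY _ half0.
- exact: derivable_continuous_at.
Qed.

Lemma absdev_median_gt0 : 0 < xi.
Proof.
exact: (absdev_quantile_gt0 cdfY half0 half1 (derivable_continuous_at dv)).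
Qed.

(** Continuity of F near v - xi, not only at v - xi, is what rules out atoms at v - y for y near xi. *)
Lemma absdev_cdf_near : \forall y \near xi, F (v + y) - F (v - y) = G y.
Proof.
have [del d0 h] := near_ball cm; have xi0 := absdev_median_gt0.
apply/nbhs_ballP; exists (Num.min del xi) => /=; first by rewrite lt_min d0.
move=> y; rewrite /ball/= lt_min => /andP[yd yxi].
rewrite /G (absdev_cdfE cdfY)//.
  by move: yxi; rewrite ltr_norml => /andP[_]; rewrite ltrBlDr ltrDl => /ltW.
by apply: h; rewrite (_ : v - xi - (v - y) = - (xi - y)) ?normrN//; ring.
Qed.

(** The derivative of y |-> F (v + y) - F (v - y). *)
Lemma absdev_is_derive : is_derive xi 1 G (derive1 F (v - xi) + derive1 F (v + xi)).
Proof.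
apply: near_eq_is_derive absdev_cdf_near _.
have D x : derivable F x 1 -> is_derive x 1 F (derive1 F x) by move=> dF; split=> //; rewrite derive1E.
have dmi : is_derive xi 1 (fun y => v - y) (-1).
  by apply: is_derive_eq (_ : is_derive xi 1 (fun y => v - y) (0 - 1)) _; rewrite sub0r.
have dpl : is_derive xi 1 (fun y => v + y) 1.
  by apply: is_derive_eq (_ : is_derive xi 1 (fun y => v + y) (0 + 1)) _; rewrite add0r.
have D1 := @is_derive1_comp _ F (fun y => v + y) xi _ _ (D _ dp) dpl.
have D2 := @is_derive1_comp _ F (fun y => v - y) xi _ _ (D _ dm) dmi.
apply: is_derive_eq (is_deriveB D1 D2) _.
by rewrite mulr1 mulrN1 opprK addrC.
Qed.

(** The absolute deviation has probability exactly 1/2 of being at most xi, since G is continuous there. *)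
Lemma absdev_cdf_median : F (v + xi) = F (v - xi) + 2^-1.
Proof.
have dG : derivable G xi 1 by case: absdev_is_derive.
have : G xi = 2^-1.
  apply: quantileK; first exact: absdev_cdf_homo.
  - exact: (absdev_cdf_ge_ex cdfY).
  - by exists (-1); rewrite /G absdev_cdf_lt0// ltrN10.
  - exact: derivable_continuous_at.
by rewrite -(nbhs_singleton absdev_cdf_near) => h; lra.
Qed.

End population.

Theorem theorem5 (R : realType) (d : measure_display) (T : measurableType d)
    (P : probability T R) (F : R -> R) (X : nat -> {RV P >-> R})
    (Xs : forall n : nat, 'I_n -> {RV P >-> R})
    (hX : iid_with_cdf X F) (hXs : bootstrap_samples X Xs) :
  let v := quantile F 2^-1 in
  let G := fun y : R => fine (P [set w | `|X 0%N w - v| <= y]) in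
  let xi := quantile G 2^-1 in
  let Med := fun (n : nat) (w : T) => sample_median (fun i => Xs n i w) in
  let MAD := fun (n : nat) (w : T) => sample_mad (fun i => Xs n i w) in
  let f := derive1 F v in
  let g := derive1 G xi in
  let alpha := F (v - xi) + F (v + xi) in
  let beta := derive1 F (v - xi) - derive1 F (v + xi) in
  let gamma := beta ^+ 2 + 4 * (1 - alpha) * beta * f in
  let sigma11 := 1 / (2 * f ^+ 2) in
  let sigma12 := 1 / (2 * f * g) * (1 - 4 * F (v - xi) + beta / f) in
  let sigma22 := 1 / (2 * g ^+ 2) * (1 + gamma / f ^+ 2) in
  (\forall x \near v - xi, {for x, continuous F}) ->
  (\forall x \near v + xi, {for x, continuous F}) ->
  derivable F v 1 ->
  derivable F (v - xi) 1 ->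
  derivable F (v + xi) 1 ->
  0 < f ->
  0 < derive1 F (v - xi) + derive1 F (v + xi) ->
  [/\ derivable G xi 1,
      g = derive1 F (v - xi) + derive1 F (v + xi) &
      exists N : probability (R * R)%type R,
        is_bivariate_normal N (0, 0) (mx2 sigma11 sigma12 sigma12 sigma22) /\
        cvg_in_distribution P
          (fun n w => (Num.sqrt n%:R * (Med n w - v),
                       Num.sqrt n%:R * (MAD n w - xi))) N].
Proof.
move=> v G xi Med MAD f g alpha beta gamma sigma11 sigma12 sigma22 cm cp dv dm dp f0 g0.
have cdfX z : cdf (X 0%N) z = (F z)%:E by exact: hX.2.
have xi0 : 0 < xi := absdev_median_gt0 cdfX dv.
have Fv : F v = 2^-1 := cdf_median cdfX dv.
have Fxi : F (v + xi) = F (v - xi) + 2^-1 := absdev_cdf_median cdfX cm dv dm dp.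
have dG : is_derive xi 1 G (derive1 F (v - xi) + derive1 F (v + xi)) :=
  absdev_is_derive cdfX cm dv dm dp.
have gE : g = derive1 F (v - xi) + derive1 F (v + xi) by rewrite /g derive1E; case: dG.
split; [by case: dG|exact: gE|].
have a0 : 0 <= F (v - xi) := cdf_ge0r cdfX _.
have a1 : F (v - xi) <= 2^-1 by rewrite -Fv; apply: (cdf_homo cdfX); rewrite gerBl ltW.
exists (limit_law F xi); split.
  apply: bivariate_normalP; rewrite mx2_gram loading11// loading12// loading22//.
  have al : alpha = 2 * F (v - xi) + 2^-1 by rewrite /alpha Fxi; ring.
  by rewrite /sigma11 /sigma12 /sigma22 /gamma gE al.
have -> : (fun n w => (Num.sqrt n%:R * (Med n w - v), Num.sqrt n%:R * (MAD n w - xi))) =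
    (fun n w => (scaled_median F Xs n w, scaled_mad Xs xi n w)).
  apply/funext => n; apply/funext => w.
  by rewrite /scaled_median /scaled_mad /step invrK; congr pair; exact: mulrC.
split=> [n|z cz].
  by apply: measurable_fun_pair; [exact: measurable_scaled_median|exact: measurable_scaled_mad].
exact: (scaled_pair_cvg hX hXs xi0 dv dp dm Fv Fxi f0 g0 cz).
Qed.
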